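(* Let $f:\mathbb{S}^k\to\mathbb{D}(\mathbb{S})$ be a random function. Then $f$ is $\Sigma^b_1$-representable in $R\Sigma^b_1\text{-NIA}$ if and only if $f\in\mathbf{RFP}$.
   Context: Let $\mathbb{B}=\{0,1\}$, $\mathbb{S}=\mathbb{B}^*$, $\mathbb{O}=\mathbb{B}^{\mathbb{S}}$. $\mathbb{O}$ carries the $\sigma$-algebra generated by cylinders $\{\omega\mid\omega(\sigma)=b\}$ and the unique probability measure $\mu$ giving each cylinder measure $1/2$. $\mathbb{D}(\mathbb{S})$ is the set of functions $\lambda:\mathbb{S}\to[0,1]$ with $\sum_\sigma\lambda(\sigma)=1$; a random function is a map $\mathbb{S}^k\to\mathbb{D}(\mathbb{S})$. A probabilistic Turing machine (PTM) is a TM with two transition functions, at each step one of them chosen with probability $1/2$ independently; a PTM $\mathscr M$ computes the random function $f_{\mathscr M}$ with $f_{\mathscr M}(\sigma_1,\dots,\sigma_k)(\tau)$ the probability that $\mathscr M$ on input $\sigma_1\sharp\cdots\sharp\sigma_k$ outputs $\tau$. $\mathbf{RFP}$ is the class of random functions $f_{\mathscr M}$ for PTMs $\mathscr M$ running in polynomial time. The language $\mathcal{RL}$ has terms $t,s::= x\mid \epsilon\mid \mathtt{0}\mid\mathtt{1}\mid t\frown s\mid t\times s$ and formulas built from atoms $\mathtt{Flip}(t)$, $t=s$, $t\subseteq s$ with $\neg,\wedge,\vee,\exists,\forall$; over $\mathbb{S}$, $\frown$ is concatenation (written $ts$), $t\times s$ is $t$ concatenated with itself $|s|$ times, $\subseteq$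 is the prefix relation. $\mathtt{1}^t:=\mathtt{1}\times t$, $t\preceq s:=\mathtt{1}^t\subseteq\mathtt{1}^s$; $\exists x\preceq t.F:=\exists x.(\mathtt{1}^x\subseteq\mathtt{1}^t\wedge F)$; subword quantifiers $\exists x\subseteq^* t.F:=\exists x.\exists w.(w\subseteq t\wedge wx\subseteq t\wedge F)$, $\forall x\subseteq^* t.F:=\forall x.(\exists w.(w\subseteq t\wedge wx\subseteq t)\to F)$. A $\Sigma^b_1$-formula has the form $\exists x_1\preceq t_1\cdots\exists x_n\preceq t_n.G$ with all quantifiers in $G$ subword quantifiers. $\overline\sigma$ is the closed term denoting $\sigma\in\mathbb S$. For a closed formula $F$, $[\![F]\!]\subseteq\mathbb{O}$ is the (measurable) set of $\omega$ such that $F$ holds in the standard structure on $\mathbb{S}$ with $\mathtt{Flip}(t)$ interpreted as $\omega(t)=1$. $R\Sigma^b_1\text{-NIA}$ has axioms (for $\mathtt b\in\{\mathtt0,\mathtt1\}$): $x\epsilon=x$; $x(y\mathtt b)=(xy)\mathtt b$; $x\times\epsilon=\epsilon$; $x\times y\mathtt b=(x\times y)x$; $x\subseteq\epsilon\leftrightarrow x=\epsilon$; $x\subseteq y\mathtt b\leftrightarrow x\subseteq y\vee x=y\mathtt b$; $x\mathtt b=y\mathtt b\to x=y$; $x\mathtt0\neq y\mathtt1$; $x\mathtt b\neq\epsilon$; and induction on notation $B(\epsilon)\wedge\forall x.(B(x)\to B(x\mathtt0)\wedge B(x\mathtt1))\to\forall x.B(x)$ for every $\Sigma^b_1$-formula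 $B$ of $\mathcal{RL}$. A random function $f:\mathbb{S}^k\to\mathbb{D}(\mathbb{S})$ is $\Sigma^b_1$-representable in $R\Sigma^b_1\text{-NIA}$ if there is a $\Sigma^b_1$-formula $G(\vec x,y)$ with $R\Sigma^b_1\text{-NIA}\vdash\forall\vec x.\exists!y.G(\vec x,y)$ and $f(\sigma_1,\dots,\sigma_k)(\tau)=\mu([\![G(\overline{\sigma_1},\dots,\overline{\sigma_k},\overline\tau)]\!])$ for all $\sigma_1,\dots,\sigma_k,\tau\in\mathbb S$. *)

(* Defs.v *)
From HB Require Import structures.
From mathcomp Require Import all_boot all_order all_algebra.
From mathcomp Require Import all_classical all_reals all_analysis.
From mathcomp Require Import measurable_realfun.
From mathcomp Require Import zify ring lra.
Set Implicit Arguments. Unset Strict Implicit. Unset Printing Implicit Defensive.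
Import Order.TTheory GRing.Theory Num.Theory.
Local Open Scope classical_set_scope.
Local Open Scope ring_scope.

Definition cylinders (I : Type) : set (set (I -> bool)) :=
  [set C | exists i b, C = [set w | w i = b]].

Notation coin_space I := (g_sigma_algebraType (@cylinders I)).

(* Values on single cylinders alone do not determine a measure; the independence
   of distinct coordinates has to be included. *)
Definition fair (R : realType) (I : eqType) (P : probability (coin_space I) R) :=
  forall (s : seq I) (b : I -> bool), uniq s ->
    P [set w | forall i, i \in s -> w i = b i] = (2^-1 ^+ size s)%:E.

Lemma measurable_coin (I : Type) (i : I) (b : bool) :
  measurable ([set w | w i = b] : set (coin_space I)).
Proof. by apply: sub_gen_smallest; exists i, b. Qed.

Lemma measurable_coins (I : eqType) (s : seq I) (b : I -> bool) :
  measurable ([set w | forall i, i \in s -> w i = b i] : set (coin_space I)).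
Proof.
elim: s => [|j s IH].
  by rewrite (_ : mkset _ = setT) //; apply/seteqP; split.
rewrite (_ : mkset _ = [set w | w j = b j] `&`
    [set w | forall i, i \in s -> w i = b i]).
  by apply: measurableI => //; exact: measurable_coin.
apply/seteqP; split => w /=.
  move=> h; split; first by apply: h; rewrite mem_head.
  by move=> i si; apply: h; rewrite in_cons si orbT.
by move=> [h1 h2] i; rewrite in_cons => /orP[/eqP->|/h2].
Qed.

(* Existence: the binary digits of a uniform point of [0, 1[, indexed by pickle *)
Section fair_exists.
Variables (R : realType) (I : countType).

Let U := `[0%R, 1%R[%classic : set R.
Let mU : measurable (U : set (measurableTypeR R)).
Proof. exact: measurable_itv. Qed.

Definition digit (n : nat) (x : R) : bool := odd (Num.truncn (2 ^+ n.+1 * x)).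

Lemma measurable_truncn_eq (c : R) (m : nat) :
  measurable ([set x | Num.truncn (c * x) = m] : set (measurableTypeR R)).
Proof.
have mlt k : measurable ([set x | (Num.truncn (c * x) <= k)%N] : set (measurableTypeR R)).
  rewrite (_ : mkset _ = ( *%R c) @^-1` `]-oo, k.+1%:R[%classic).
    rewrite -[X in measurable X]setTI.
    by apply: mulrl_measurable => //; exact: measurable_itv.
  by apply/seteqP; split => x /=; rewrite truncn_le_nat in_itv.
case: m => [|m].
  rewrite (_ : mkset _ = [set x | (Num.truncn (c * x) <= 0)%N]) //.
  by apply/seteqP; split => x /=; rewrite leqn0 => /eqP.
rewrite (_ : mkset _ = [set x | (Num.truncn (c * x) <= m.+1)%N] `\`
  [set x | (Num.truncn (c * x) <= m)%N]); first exact: measurableD.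
apply/seteqP; split => x /=; first by move->; rewrite leqnn ltnn.
by move=> [h /negP]; lia.
Qed.

Lemma measurable_digit n b :
  measurable ([set x | digit n x = b] : set (measurableTypeR R)).
Proof.
rewrite (_ : mkset _ = \bigcup_(m in [set m | odd m = b])
   [set x | Num.truncn (2 ^+ n.+1 * x) = m]).
  by apply: bigcup_measurable => m _; exact: measurable_truncn_eq.
apply/seteqP; split => x /=; rewrite /digit.
  by move=> h; exists (Num.truncn (2 ^+ n.+1 * x)).
by move=> [m /= <- ->].
Qed.

Definition digits (x : measurableTypeR R) : coin_space I :=
  fun i => digit (pickle i) x.

Lemma measurable_digits : measurable_fun setT digits.
Proof.
apply: (@measurability _ _ (measurableTypeR R) (coin_space I) setT digits (@cylinders I)) => //.
move=> _ [_ [i [b ->]] <-]; rewrite setTI.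
exact: measurable_digit.
Qed.

Definition coin_flips (A : set (coin_space I)) : \bar R :=
  pushforward (mrestr (@lebesgue_measure R) mU) digits A.

Let flips0 : coin_flips set0 = 0%E.
Proof. by rewrite /coin_flips /pushforward preimage_set0 measure0. Qed.
Let flips_ge0 A : (0 <= coin_flips A)%E.
Proof. by rewrite /coin_flips /pushforward /mrestr measure_ge0. Qed.
Let flips_add : semi_sigma_additive coin_flips.
Proof.
move=> F mF tF mUF; rewrite /coin_flips /pushforward preimage_bigcup.
apply: measure_semi_sigma_additive.
- by move=> n; rewrite -[X in measurable X]setTI; exact: measurable_digits.
- apply/trivIsetP => /= i j _ _ ij; rewrite -preimage_setI.
  by move/trivIsetP : tF => /(_ _ _ _ _ ij) ->//; rewrite preimage_set0.
- by rewrite -preimage_bigcup -[X in measurable X]setTI; exact: measurable_digits.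
Qed.
HB.instance Definition _ := isMeasure.Build _ _ _ coin_flips flips0 flips_ge0 flips_add.
Let flipsT : coin_flips setT = 1%E.
Proof.
rewrite /coin_flips /pushforward preimage_setT /mrestr setTI.
by rewrite lebesgue_measure_itv /= lte_fin ltr01 sube0.
Qed.
HB.instance Definition _ := @Measure_isProbability.Build _ _ R coin_flips flipsT.

Let prefix_val (b : nat -> bool) n := (\sum_(i < n) b i * 2 ^ (n - i.+1))%N.

Lemma prefix_valS b n : prefix_val b n.+1 = (2 * prefix_val b n + b n)%N.
Proof.
rewrite /prefix_val big_ord_recr /= subnn expn0 muln1; congr addn.
rewrite big_distrr /=; apply: eq_bigr => i _.
by rewrite mulnCA -expnS subSn // subSS subnSK.
Qed.

Lemma prefix_val_lt b n : (prefix_val b n < 2 ^ n)%N.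
Proof.
elim: n => [|n IH]; first by rewrite /prefix_val big_ord0.
by rewrite prefix_valS expnS; case: (b n); lia.
Qed.

Lemma digits_prefix b n (x : R) : 0 <= x -> x < 1 ->
  (forall i, (i < n)%N -> digit i x = b i) <->
  Num.truncn (2 ^+ n * x) = prefix_val b n.
Proof.
move=> x0 x1.
have p2 k : 0 <= 2 ^+ k * x by rewrite mulr_ge0 // exprn_ge0.
have half k : (Num.truncn (2 ^+ k.+1 * x))./2 = Num.truncn (2 ^+ k * x).
  have /andP[h1 h2] := truncn_itv (p2 k.+1).
  apply/esym/eqP; rewrite truncn_eq //.
  move: h1 h2; set m := Num.truncn _ => h1 h2; rewrite exprS -mulrA in h1 h2.
  have e := odd_double_half m; move: e; set q := m./2; set r := odd m => e.
  have h3 : (q%:R *+ 2 : R) <= m%:R by rewrite -mulrnA ler_nat; lia.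
  have h4 : (m.+1%:R : R) <= q.+1%:R *+ 2 by rewrite -mulrnA ler_nat; case: (r) e; lia.
  rewrite !mulr2n in h3 h4.
  move: (2 ^+ k * x) h1 h2 => z h1 h2.
  by apply/andP; split; lra.
elim: n => [|n IH].
  split => // _; rewrite expr0 mul1r /prefix_val big_ord0.
  by apply/eqP; rewrite truncn_eq //= x0.
rewrite prefix_valS; split.
  move=> h; have {}IH := (IH.1 (fun i hi => h i (ltnW hi))).
  have := h n (leqnn _); rewrite /digit => hn.
  rewrite -[LHS]odd_double_half half IH hn; lia.
move=> h i; rewrite ltnS leq_eqVlt => /orP[/eqP->|].
  by rewrite /digit h oddD oddM /=; case: (b n).
apply: IH.2; rewrite -half h; case: (b n); lia.
Qed.

Lemma lebesgue_prefix b n :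
  mrestr (@lebesgue_measure R) mU [set x | forall i, (i < n)%N -> digit i x = b i]
  = (2^-1 ^+ n)%:E.
Proof.
rewrite /mrestr.
set v := prefix_val b n.
have p2 : 0 < 2 ^+ n :> R by rewrite exprn_gt0.
have v1 : v%:R + 1 <= 2 ^+ n :> R.
  by rewrite natr1 -natrX ler_nat; exact: prefix_val_lt.
rewrite (_ : _ `&` _ = `[v%:R / 2 ^+ n, (v%:R + 1) / 2 ^+ n[%classic).
  rewrite lebesgue_measure_itv /= lte_fin ltr_pM2r ?invr_gt0 //.
  rewrite ltrDl ltr01 -EFinB -mulrBl addrC addKr mul1r exprVn //.
apply/seteqP; split => x /=; rewrite /U /= !in_itv /=.
  move=> [h /andP[x0 x1]]; move/(digits_prefix _ _ x0 x1) : h => h.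
  have /truncn_itv : 0 <= 2 ^+ n * x by rewrite mulr_ge0 // ltW.
  rewrite h -/v ler_pdivrMr // ltr_pdivlMr //.
  by rewrite mulrC natr1.
rewrite ler_pdivrMr // ltr_pdivlMr // => /andP[h1 h2].
have x0 : 0 <= x.
  by rewrite -(pmulr_lge0 _ p2); apply: le_trans h1.
have x1 : x < 1.
  by rewrite -(ltr_pM2r p2) mul1r; apply: lt_le_trans h2 v1.
split; last by rewrite x0 x1.
apply/(digits_prefix _ _ x0 x1); apply/eqP.
by rewrite truncn_eq ?mulr_ge0 // ?(ltW p2) // [2 ^+ n * x]mulrC -(natr1 v) h1 h2.
Qed.

Lemma lebesgue_digits (s : seq nat) (b : nat -> bool) : uniq s ->
  mrestr (@lebesgue_measure R) mU [set x | forall i, i \in s -> digit i x = b i]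
  = (2^-1 ^+ size s)%:E.
Proof.
pose N := (\max_(i <- s) i).+1.
have sN : {subset s <= iota 0 N}.
  by move=> i si; rewrite mem_iota /= add0n ltnS; apply: leq_bigmax_seq.
move: N sN => N; move: {2}(N - size s)%N (leqnn (N - size s)%N) => d.
elim: d s b => [|d IH] s b hd sN us.
  have szs : size s = N.
    have := uniq_leq_size us sN; rewrite size_iota => h.
    by apply/eqP; rewrite eqn_leq h -subn_eq0 -leqn0 hd.
  have szi : (size (iota 0 N) <= size s)%N by rewrite size_iota szs.
  have [_ e] := uniq_min_size us sN szi.
  rewrite szs -(lebesgue_prefix b); congr mrestr; apply/seteqP; split => x /= h i.
    by move=> iN; apply: h; rewrite e mem_iota.
  by move=> /sN; rewrite mem_iota => iN; exact: h.
case: (pselect (exists2 j, (j < N)%N & j \notin s)) => [[j jN js]|no]; last first.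
  apply: IH => //; have : (size (iota 0 N) <= size s)%N.
    apply: uniq_leq_size; first exact: iota_uniq.
    move=> j; rewrite mem_iota => jN; apply: contrapT => /negP js.
    by apply: no; exists j.
  by rewrite size_iota; lia.
pose bb c i := if i == j then c else b i.
have step c : mrestr (@lebesgue_measure R) mU
    ([set x | forall i, i \in s -> digit i x = b i] `&` [set x | digit j x = c])
    = (2^-1 ^+ (size s).+1)%:E.
  rewrite -(IH (j :: s) (bb c)) /=; last 3 first.
  - lia.
  - move=> i; rewrite in_cons => /orP[/eqP->|/sN //]; rewrite mem_iota; exact: jN.
  - by rewrite js us.
  congr mrestr; apply/seteqP; split => x /=.
    move=> [h1 h2] i; rewrite in_cons /bb; case: eqP => [->|_] //= /h1 //.
  move=> h; split.
    move=> i si; rewrite h ?in_cons ?si ?orbT // /bb; case: eqP => // ij.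
    by move: js; rewrite -ij si.
  by rewrite h ?mem_head // /bb eqxx.
have ms : measurable ([set x | forall i, i \in s -> digit i x = b i] : set (measurableTypeR R)).
  rewrite (_ : mkset _ = \bigcap_(i in [set i | i \in s]) [set x | digit i x = b i]) //.
  by apply: bigcap_measurableType => i _; exact: measurable_digit.
rewrite (_ : [set x | _] = ([set x | forall i, i \in s -> digit i x = b i] `&` [set x | digit j x = true])
  `|` ([set x | forall i, i \in s -> digit i x = b i] `&` [set x | digit j x = false])); last first.
  apply/seteqP; split => x /=; last by case=> -[].
  by move=> h; case: (digit j x); [left|right].
rewrite measureU; last 3 first.
- by apply: measurableI => //; exact: measurable_digit.
- by apply: measurableI => //; exact: measurable_digit.
- by apply/seteqP; split => x //= [[_ ->] []].
transitivity ((2^-1 ^+ (size s).+1)%:E + (2^-1 ^+ (size s).+1)%:E : \bar R)%E.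
  by congr (_ + _)%E; [exact: (step true)|exact: (step false)].
by rewrite -EFinD exprS; congr EFin; field.
Qed.

Lemma coin_flips_fair : fair coin_flips.
Proof.
move=> s b us.
pose b' n := if @pickle_inv I n is Some i then b i else false.
rewrite -[in RHS](size_map pickle) -(lebesgue_digits b'); last first.
  by rewrite map_inj_uniq //; exact: (pcan_inj pickleK).
rewrite /coin_flips /pushforward; congr mrestr.
apply/seteqP; split => x /=; rewrite /digits.
  by move=> h _ /mapP[i si ->]; rewrite h // /b' pickleK_inv.
by move=> h i si; rewrite h ?map_f // /b' pickleK_inv.
Qed.

End fair_exists.

Lemma fair_exists (R : realType) (I : countType) :
  exists P : probability (coin_space I) R, fair P.
Proof. by exists (@coin_flips R I); exact: coin_flips_fair. Qed.

Lemma fair_unique (R : realType) (I : eqType) (P Q : probability (coin_space I) R) :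
  fair P -> fair Q -> forall A, measurable A -> P A = Q A.
Proof.
move=> fP fQ.
pose cyl (s : seq I) (b : I -> bool) : set (coin_space I) :=
  [set w | forall i, i \in s -> w i = b i].
pose G : set (set (coin_space I)) := [set A | A = set0 \/ exists s b, uniq s /\ A = cyl s b].
have GT : G setT by right; exists [::], (fun=> true); split => //; apply/seteqP; split.
have mG A : G A -> measurable A.
  by move=> [->//|[s [b [_ ->]]]]; exact: measurable_coins.
have GI : setI_closed G.
  move=> A B [->|[s [b [us ->]]]]; first by move=> _; left; rewrite set0I.
  move=> [->|[s' [b' [us' ->]]]]; first by left; rewrite setI0.
  have [h|/existsNP[i /not_implyP[si /not_implyP[si' ne]]]] :=
    pselect (forall i, i \in s -> i \in s' -> b i = b' i).
    right; exists (undup (s ++ s')), (fun i => if i \in s then b i else b' i).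
    split; first exact: undup_uniq.
    apply/seteqP; split => w /=.
      move=> [h1 h2] i; rewrite mem_undup mem_cat; case: ifP => [/h1 //|_ /=]; exact: h2.
    move=> h1; split => i si; rewrite h1 ?mem_undup ?mem_cat ?si ?orbT //.
    by case: ifP => // /h ->.
  left; apply/seteqP; split => w //= [h1 h2]; apply: ne.
  by rewrite -h1 // -h2.
have Gs : @measurable _ (coin_space I) `<=` <<s G >>.
  apply: smallest_sub; first exact: smallest_sigma_algebra.
  move=> _ [i [b ->]]; apply: sub_gen_smallest; right.
  exists [:: i], (fun=> b); split => //; apply/seteqP; split => w /=.
    by move=> <- j; rewrite inE => /eqP->.
  by apply; rewrite mem_head.
move=> A /Gs; apply: (@g_sigma_algebra_measure_unique _ _ _ G _ (fun=> setT)) => //.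
- by rewrite bigcup_const //; exists 0%N.
- move=> B [->|[s [b [us ->]]]]; first by rewrite !measure0.
  by have := fP s b us; have := fQ s b us => /= -> ->.
- move=> k; exact: (le_lt_trans (probability_le1 P measurableT) (ltry _)).
Qed.

Definition coin_measure (R : realType) (I : countType) : probability (coin_space I) R :=
  projT1 (cid (fair_exists R I)).

Lemma coin_measure_fair (R : realType) (I : countType) : fair (coin_measure R I).
Proof. exact: projT2 (cid (fair_exists R I)). Qed.

Notation word := (seq bool).

Record dist (R : realType) : Type := Dist {
  mass :> word -> R;
  mass_in01 : forall s, 0 <= mass s <= 1;
  mass_sum1 : \esum_(s in [set: word]) (mass s)%:E = 1%E }.

Definition random_function (R : realType) (k : nat) : Type :=
  k.-tuple word -> dist R.

(** ** The language RL, with de Bruijn indices *)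

Inductive term : Type :=
| TVar of nat
| TEps
| TBit of bool
| TCat of term & term
| TTimes of term & term.

Inductive formula : Type :=
| FFlip of term
| FEq of term & term
| FPre of term & term
| FNot of formula
| FAnd of formula & formula
| FOr of formula & formula
| FEx of formula
| FAll of formula.

Definition FImp A B := FOr (FNot A) B.
Definition FIff A B := FAnd (FImp A B) (FImp B A).

Fixpoint tsubst (f : nat -> term) (t : term) : term :=
  match t with
  | TVar n => f n
  | TEps => TEps
  | TBit b => TBit b
  | TCat t1 t2 => TCat (tsubst f t1) (tsubst f t2)
  | TTimes t1 t2 => TTimes (tsubst f t1) (tsubst f t2)
  end.

Definition tlift : term -> term := tsubst (fun n => TVar n.+1).

Definition up (f : nat -> term) (n : nat) : term :=
  if n is m.+1 then tlift (f m) else TVar 0.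

Fixpoint fsubst (f : nat -> term) (F : formula) : formula :=
  match F with
  | FFlip t => FFlip (tsubst f t)
  | FEq t s => FEq (tsubst f t) (tsubst f s)
  | FPre t s => FPre (tsubst f t) (tsubst f s)
  | FNot A => FNot (fsubst f A)
  | FAnd A B => FAnd (fsubst f A) (fsubst f B)
  | FOr A B => FOr (fsubst f A) (fsubst f B)
  | FEx A => FEx (fsubst (up f) A)
  | FAll A => FAll (fsubst (up f) A)
  end.

Definition flift : formula -> formula := fsubst (fun n => TVar n.+1).

(* [inst t] eliminates index 0; [repl t] replaces index 0 by a term that may
   itself mention index 0. *)
Definition inst (t : term) (F : formula) : formula :=
  fsubst (fun n => if n is m.+1 then TVar m else t) F.
Definition repl (t : term) (F : formula) : formula :=
  fsubst (fun n => if n is m.+1 then TVar m.+1 else t) F.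

Fixpoint tscoped (n : nat) (t : term) : bool :=
  match t with
  | TVar m => (m < n)%N
  | TEps | TBit _ => true
  | TCat t1 t2 | TTimes t1 t2 => tscoped n t1 && tscoped n t2
  end.

(* All free variables of F have index < n. *)
Fixpoint fscoped (n : nat) (F : formula) : bool :=
  match F with
  | FFlip t => tscoped n t
  | FEq t s | FPre t s => tscoped n t && tscoped n s
  | FNot A => fscoped n A
  | FAnd A B | FOr A B => fscoped n A && fscoped n B
  | FEx A | FAll A => fscoped n.+1 A
  end.

Definition ones (t : term) : term := TTimes (TBit true) t.

(* In the quantifiers below, t is a term outside the scope of the bound x,
   and x is index 0 of F. *)
Definition ex_le (t : term) (F : formula) : formula :=
  FEx (FAnd (FPre (ones (TVar 0)) (ones (tlift t))) F).

(* w <= u /\ wx <= u for the prefix relation, with w = index 0, x = index 1 *)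
Definition subword_witness (u : term) : formula :=
  FAnd (FPre (TVar 0) u) (FPre (TCat (TVar 0) (TVar 1)) u).

Definition ex_subword (t : term) (F : formula) : formula :=
  FEx (FEx (FAnd (subword_witness (tlift (tlift t))) (flift F))).

Definition all_subword (t : term) (F : formula) : formula :=
  FAll (FImp (FEx (subword_witness (tlift (tlift t)))) F).

Inductive subword_bounded : formula -> Prop :=
| SB_Flip t : subword_bounded (FFlip t)
| SB_Eq t s : subword_bounded (FEq t s)
| SB_Pre t s : subword_bounded (FPre t s)
| SB_Not A : subword_bounded A -> subword_bounded (FNot A)
| SB_And A B : subword_bounded A -> subword_bounded B ->
    subword_bounded (FAnd A B)
| SB_Or A B : subword_bounded A -> subword_bounded B ->
    subword_bounded (FOr A B)
| SB_Ex t A : subword_bounded A -> subword_bounded (ex_subword t A)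
| SB_All t A : subword_bounded A -> subword_bounded (all_subword t A).

Inductive Sigma1b : formula -> Prop :=
| Sigma1b_base A : subword_bounded A -> Sigma1b A
| Sigma1b_ex t A : Sigma1b A -> Sigma1b (ex_le t A).

(** ** Classical natural deduction with equality

    The formulas in Th may be open; since the eigenvariable conditions bear on
    the context G only, they act as their universal closures. *)

Inductive proves (Th : formula -> Prop) : seq formula -> formula -> Prop :=
| P_Ax G A : Th A -> proves Th G A
| P_Hyp G A : List.In A G -> proves Th G A
| P_NotI G A B : proves Th (A :: G) B -> proves Th (A :: G) (FNot B) ->
    proves Th G (FNot A)
| P_NotE G A B : proves Th (FNot A :: G) B ->
    proves Th (FNot A :: G) (FNot B) -> proves Th G A
| P_AndI G A B : proves Th G A -> proves Th G B -> proves Th G (FAnd A B)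
| P_AndEl G A B : proves Th G (FAnd A B) -> proves Th G A
| P_AndEr G A B : proves Th G (FAnd A B) -> proves Th G B
| P_OrIl G A B : proves Th G A -> proves Th G (FOr A B)
| P_OrIr G A B : proves Th G B -> proves Th G (FOr A B)
| P_OrE G A B C : proves Th G (FOr A B) -> proves Th (A :: G) C ->
    proves Th (B :: G) C -> proves Th G C
| P_AllI G A : proves Th (map flift G) A -> proves Th G (FAll A)
| P_AllE G A t : proves Th G (FAll A) -> proves Th G (inst t A)
| P_ExI G A t : proves Th G (inst t A) -> proves Th G (FEx A)
| P_ExE G A C : proves Th G (FEx A) ->
    proves Th (A :: map flift G) (flift C) -> proves Th G C
| P_EqI G t : proves Th G (FEq t t)
| P_EqE G A t s : proves Th G (FEq t s) -> proves Th G (inst t A) ->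
    proves Th G (inst s A).

(** ** The theory *)

Definition snoc (t : term) (b : bool) : term := TCat t (TBit b).

Inductive NIA : formula -> Prop :=
| NIA_cat_eps (x := TVar 0) : NIA (FEq (TCat x TEps) x)
| NIA_cat_bit b (x := TVar 0) (y := TVar 1) :
    NIA (FEq (TCat x (snoc y b)) (snoc (TCat x y) b))
| NIA_times_eps (x := TVar 0) : NIA (FEq (TTimes x TEps) TEps)
| NIA_times_bit b (x := TVar 0) (y := TVar 1) :
    NIA (FEq (TTimes x (snoc y b)) (TCat (TTimes x y) x))
| NIA_pre_eps (x := TVar 0) : NIA (FIff (FPre x TEps) (FEq x TEps))
| NIA_pre_bit b (x := TVar 0) (y := TVar 1) :
    NIA (FIff (FPre x (snoc y b)) (FOr (FPre x y) (FEq x (snoc y b))))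
| NIA_bit_inj b (x := TVar 0) (y := TVar 1) :
    NIA (FImp (FEq (snoc x b) (snoc y b)) (FEq x y))
| NIA_bit_neq (x := TVar 0) (y := TVar 1) :
    NIA (FNot (FEq (snoc x false) (snoc y true)))
| NIA_bit_eps b (x := TVar 0) : NIA (FNot (FEq (snoc x b) TEps))
| NIA_induction B (x := TVar 0) : Sigma1b B ->
    NIA (FImp (FAnd (inst TEps B)
                    (FAll (FImp B (FAnd (repl (snoc x false) B)
                                        (repl (snoc x true) B)))))
              (FAll B)).

(** ** Standard interpretation *)

Fixpoint teval (rho : nat -> word) (t : term) : word :=
  match t with
  | TVar n => rho n
  | TEps => [::]
  | TBit b => [:: b]
  | TCat t1 t2 => teval rho t1 ++ teval rho t2
  | TTimes t1 t2 => flatten (nseq (size (teval rho t2)) (teval rho t1))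
  end.

Definition scons (s : word) (rho : nat -> word) (n : nat) : word :=
  if n is m.+1 then rho m else s.

Fixpoint holds (w : word -> bool) (rho : nat -> word) (F : formula) : Prop :=
  match F with
  | FFlip t => w (teval rho t) = true
  | FEq t s => teval rho t = teval rho s
  | FPre t s => prefix (teval rho t) (teval rho s)
  | FNot A => ~ holds w rho A
  | FAnd A B => holds w rho A /\ holds w rho B
  | FOr A B => holds w rho A \/ holds w rho B
  | FEx A => exists s, holds w (scons s rho) A
  | FAll A => forall s, holds w (scons s rho) A
  end.

(* The environment is irrelevant for closed formulas. *)
Definition interp (F : formula) : set (coin_space word) :=
  [set w | holds w (fun=> [::]) F].

Lemma measurable_bigcup_count (T : countType) (F : T -> set (coin_space word)) :
  (forall s, measurable (F s)) -> measurable (\bigcup_s F s).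
Proof.
move=> mF.
rewrite (_ : \bigcup_s F s = \bigcup_n (if unpickle n is Some s then F s else set0)).
  by apply: bigcup_measurable => n _; case: unpickle.
apply/seteqP; split => w [].
  by move=> s _ Fs; exists (pickle s) => //; rewrite pickleK.
by move=> n _; case: unpickle => // s Fs; exists s.
Qed.

Lemma measurable_interp F : measurable (interp F).
Proof.
rewrite /interp; move: (fun=> [::]) => rho.
elim: F rho => [t|t s|t s|A IA|A IA B IB|A IA B IB|A IA|A IA] rho /=.
- exact: measurable_coin.
- have [e|e] := pselect (teval rho t = teval rho s).
    by rewrite (_ : mkset _ = setT) //; apply/seteqP; split.
  by rewrite (_ : mkset _ = set0) //; apply/seteqP; split.
- have [e|e] := boolP (prefix (teval rho t) (teval rho s)).
    by rewrite (_ : mkset _ = setT) //; apply/seteqP; split.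
  by rewrite (_ : mkset _ = set0) //; apply/seteqP; split.
- by apply: measurableC; exact: IA.
- by apply: measurableI; [exact: IA|exact: IB].
- by apply: measurableU; [exact: IA|exact: IB].
- rewrite (_ : mkset _ = \bigcup_(s in [set: word])
    [set w : coin_space word | holds w (scons s rho) A]).
    by apply: measurable_bigcup_count => s; exact: IA.
  by apply/seteqP; split => w /= [s]; [exists s|move=> _ ?; exists s].
- rewrite (_ : mkset _ = \bigcap_(s in [set: word])
    [set w : coin_space word | holds w (scons s rho) A]).
    rewrite -[X in measurable X]setCK setC_bigcap; apply: measurableC.
    apply: measurable_bigcup_count => s.
    by apply: measurableC; exact: IA.
  by apply/seteqP; split => w /= h s; [move=> _; exact: h|exact: h].
Qed.

(** ** Representability: in G, index 0 is y and index i.+1 is the i-th x *)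

Definition numeral (s : word) : term := foldl snoc TEps s.

Definition ex_unique (G : formula) : formula :=
  FEx (FAnd G (FAll (FImp
    (fsubst (fun n => if n is m.+1 then TVar m.+2 else TVar 0) G)
    (FEq (TVar 0) (TVar 1))))).

Definition instance (G : formula) (xs : seq word) (y : word) : formula :=
  fsubst (fun n => if n is m.+1 then numeral (nth [::] xs m) else numeral y) G.

Definition representable (R : realType) (k : nat)
    (f : random_function R k) : Prop :=
  exists G : formula,
    [/\ Sigma1b G,
        fscoped k.+1 G,
        proves NIA [::] (iter k FAll (ex_unique G)) &
        forall (xs : k.-tuple word) (y : word),
          (f xs y)%:E = coin_measure R word (interp (instance G xs y))].

(** ** Probabilistic Turing machines, with one two-way infinite tape *)

Inductive symbol (W : Type) : Type :=
| Blank | Bit of bool | Sharp | Work of W.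
Arguments Blank {W}.
Arguments Bit {W} _.
Arguments Sharp {W}.
Arguments Work {W} _.

Inductive move : Type := MoveL | MoveN | MoveR.

Record ptm : Type := Ptm {
  state : finType;
  work : finType;
  start : state;
  final : pred state;
  delta : bool -> state -> symbol work -> state * symbol work * move }.

(* (q, l, r): r lists the tape from the scanned cell rightwards, l lists it from
   the cell left of the scanned one leftwards; both are padded with blanks. *)
Definition config (M : ptm) : Type :=
  (state M * seq (symbol (work M)) * seq (symbol (work M)))%type.

Definition step (M : ptm) (c : bool) (x : config M) : config M :=
  let: (q, l, r) := x in
  if final q then x else
  let: (q', a, m) := delta c q (head Blank r) in
  match m with
  | MoveL => (q', behead l, head Blank l :: a :: behead r)
  | MoveN => (q', l, a :: behead r)
  | MoveR => (q', a :: l, behead r)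
  end.

(* c i is the outcome of the coin tossed at step i. *)
Definition run (M : ptm) (c : nat -> bool) (n : nat) (x : config M) :
  config M := iteri n (fun i => @step M (c i)) x.

Definition halted (M : ptm) (x : config M) : bool := final x.1.1.

Fixpoint leading_bits (W : Type) (r : seq (symbol W)) : word :=
  if r is Bit b :: r' then b :: leading_bits r' else [::].

(* The output is the longest binary word starting at the scanned cell. *)
Definition output (M : ptm) (x : config M) : word := leading_bits x.2.

(* Every word over {0,1,#} is of the form encode xs. *)
Fixpoint encode (W : Type) (xs : seq word) : seq (symbol W) :=
  match xs with
  | [::] => [::]
  | [:: s] => map Bit s
  | s :: xs' => map Bit s ++ Sharp :: encode W xs'
  end.

Definition init (M : ptm) (xs : seq word) : config M :=
  (start M, [::], encode (work M) xs).

Definition polytime (M : ptm) : Prop :=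
  exists p : {poly nat}, forall (xs : seq word) (c : nat -> bool),
    halted (run c p.[size (encode (work M) xs)] (init M xs)).

Definition outputs (M : ptm) (xs : seq word) (y : word) :
    set (coin_space nat) :=
  [set c | exists n, halted (run c n (init M xs)) /\
                     output (run c n (init M xs)) = y].

Definition RFP (R : realType) (k : nat) (f : random_function R k) : Prop :=
  exists M : ptm, polytime M /\
    forall (xs : k.-tuple word) (y : word),
      (f xs y)%:E = coin_measure R nat (outputs M xs y).

(* Main.v *)
(** From machines to formulas, one works in an arbitrary model of the theory, which suffices by
    completeness: a computation is a word listing the configurations as blocks of equal length,
    the coin tossed at step [i] is [Flip(1^i)], and induction on notation for the bounded
    existential formula "there is a history of length [x]" makes histories exist and be unique.
    On the standard model this formula describes the machine, and the toss times become pairwise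
    distinct oracle queries, so both sides have the weight of the same decision tree.

    Conversely, a function proved total has a witness that is feasible relative to the oracle: a
    restricted ultrapower of the feasible functions, saturated for universal feasible constraints,
    is a model of the theory, and would otherwise contain an argument without value. The queries
    of such a function are removed by lazy sampling: polynomially many coins are tossed first and
    are then used one after the other to answer each query not yet in a table, which preserves the
    output distribution. What remains is a deterministic feasible function of the input and the
    coins, compiled to a Turing machine whose tape has one track for each register. *)

Require Import Defs.
From mathcomp Require Import all_boot all_order all_algebra.
From mathcomp Require Import all_classical all_reals all_analysis.
From mathcomp Require Import zify.

Set Implicit Arguments. Unset Strict Implicit. Unset Printing Implicit Defensive.

Import GRing.Theory Num.Theory.

(** * Substitution *)

Lemma eq_tsubst f g t : f =1 g -> tsubst f t = tsubst g t.
Proof. by move=> e; elim: t => //= [t -> s ->|t -> s ->]. Qed.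

Lemma eq_up f g : f =1 g -> up f =1 up g.
Proof. by move=> e [|n] //=; rewrite e. Qed.

Lemma eq_fsubst f g F : f =1 g -> fsubst f F = fsubst g F.
Proof.
elim: F f g => [t|t s|t s|A IA|A IA B IB|A IA B IB|A IA|A IA] f g e /=.
- by rewrite (eq_tsubst _ e).
- by rewrite !(eq_tsubst _ e).
- by rewrite !(eq_tsubst _ e).
- by rewrite (IA _ _ e).
- by rewrite (IA _ _ e) (IB _ _ e).
- by rewrite (IA _ _ e) (IB _ _ e).
- by rewrite (IA _ _ (eq_up e)).
- by rewrite (IA _ _ (eq_up e)).
Qed.

Lemma tsubst_comp f g t :
  tsubst f (tsubst g t) = tsubst (fun n => tsubst f (g n)) t.
Proof. by elim: t => //= [t -> s ->|t -> s ->]. Qed.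

Lemma up_comp f g n : tsubst (up f) (up g n) = up (fun n => tsubst f (g n)) n.
Proof. by case: n => //= n; rewrite /tlift !tsubst_comp. Qed.

Lemma fsubst_comp f g F :
  fsubst f (fsubst g F) = fsubst (fun n => tsubst f (g n)) F.
Proof.
elim: F f g => [t|t s|t s|A IA|A IA B IB|A IA B IB|A IA|A IA] f g /=;
  rewrite ?tsubst_comp ?IA ?IB //; by rewrite (eq_fsubst _ (up_comp _ _)).
Qed.

Lemma tsubst_id t : tsubst TVar t = t.
Proof. by elim: t => //= [t -> s ->|t -> s ->]. Qed.

Lemma fsubst_id f F : f =1 TVar -> fsubst f F = F.
Proof.
elim: F f => [t|t s|t s|A IA|A IA B IB|A IA B IB|A IA|A IA] f e /=;
  rewrite ?(eq_tsubst _ e) ?tsubst_id ?IA ?IB //.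
- by move=> [|n] //=; rewrite e.
- by move=> [|n] //=; rewrite e.
Qed.

Definition subst0 (t : term) (n : nat) : term := if n is m.+1 then TVar m else t.

Lemma fsubst_up_flift f F : fsubst (up f) (flift F) = flift (fsubst f F).
Proof. by rewrite /flift !fsubst_comp; apply: eq_fsubst. Qed.

Lemma tsubst_subst0_tlift t s : tsubst (subst0 s) (tlift t) = t.
Proof. by rewrite /tlift tsubst_comp tsubst_id. Qed.

Lemma inst_fsubst f t A :
  inst (tsubst f t) (fsubst (up f) A) = fsubst f (inst t A).
Proof.
rewrite /inst !fsubst_comp; apply: eq_fsubst => -[|n] //=.
exact: tsubst_subst0_tlift.
Qed.

Lemma inst_fsubst_up t f A :
  inst t (fsubst (up f) A) = fsubst (fun n => if n is m.+1 then f m else t) A.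
Proof.
rewrite /inst fsubst_comp; apply: eq_fsubst => -[|n] //=.
exact: tsubst_subst0_tlift.
Qed.

Lemma tscoped_leq n m t : (n <= m)%N -> tscoped n t -> tscoped m t.
Proof.
by move=> nm; elim: t => //= [i /leq_trans -> //|t IHt s IHs|t IHt s IHs];
  move=> /andP[/IHt -> /IHs ->].
Qed.

Lemma fscoped_leq n m F : (n <= m)%N -> fscoped n F -> fscoped m F.
Proof.
elim: F n m => [t|t s|t s|A IA|A IA B IB|A IA B IB|A IA|A IA] n m nm /=;
  try by move=> /andP[/(tscoped_leq nm) -> /(tscoped_leq nm) ->].
- exact: tscoped_leq.
- exact: IA.
- by move=> /andP[/(IA _ _ nm) -> /(IB _ _ nm) ->].
- by move=> /andP[/(IA _ _ nm) -> /(IB _ _ nm) ->].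
- exact: IA.
- exact: IA.
Qed.

Lemma tscoped_tsubst n m f t : tscoped n t ->
  (forall i, (i < n)%N -> tscoped m (f i)) -> tscoped m (tsubst f t).
Proof.
move=> + h; elim: t => //= [t IHt s IHs|t IHt s IHs];
  by move=> /andP[/IHt -> /IHs ->].
Qed.

Lemma tscoped_tlift n t : tscoped n t -> tscoped n.+1 (tlift t).
Proof. by move=> h; apply: tscoped_tsubst h _. Qed.

Lemma fscoped_fsubst n m f F : fscoped n F ->
  (forall i, (i < n)%N -> tscoped m (f i)) -> fscoped m (fsubst f F).
Proof.
have scoped_up n' m' f' : (forall i, (i < n')%N -> tscoped m' (f' i)) ->
    forall i, (i < n'.+1)%N -> tscoped m'.+1 (up f' i).
  by move=> h [|i] //= /h; exact: tscoped_tlift.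
elim: F n m f => [t|t s|t s|A IA|A IA B IB|A IA B IB|A IA|A IA] n m f /=;
  try by move=> /andP[ht hs] e; rewrite !(tscoped_tsubst _ e).
- exact: tscoped_tsubst.
- exact: IA.
- by move=> /andP[hA hB] e; rewrite (IA _ _ _ hA e) (IB _ _ _ hB e).
- by move=> /andP[hA hB] e; rewrite (IA _ _ _ hA e) (IB _ _ _ hB e).
- by move=> h e; apply: IA h _; exact: scoped_up.
- by move=> h e; apply: IA h _; exact: scoped_up.
Qed.

Lemma eq_in_tsubst n f g t : tscoped n t ->
  (forall i, (i < n)%N -> f i = g i) -> tsubst f t = tsubst g t.
Proof.
by move=> + e; elim: t => //= [t IHt s IHs|t IHt s IHs];
  move=> /andP[/IHt -> /IHs ->].
Qed.

Lemma eq_in_fsubst n f g F : fscoped n F ->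
  (forall i, (i < n)%N -> f i = g i) -> fsubst f F = fsubst g F.
Proof.
have eq_in_up m (f' g' : nat -> term) : (forall i, (i < m)%N -> f' i = g' i) ->
    forall i, (i < m.+1)%N -> up f' i = up g' i.
  by move=> e [|i] //= im; rewrite e.
elim: F n f g => [t|t s|t s|A IA|A IA B IB|A IA B IB|A IA|A IA] n f g /=;
  try by move=> /andP[ht hs] e; rewrite !(eq_in_tsubst _ e).
- by move=> h e; rewrite (eq_in_tsubst h e).
- by move=> h e; rewrite (IA _ _ _ h e).
- by move=> /andP[hA hB] e; rewrite (IA _ _ _ hA e) (IB _ _ _ hB e).
- by move=> /andP[hA hB] e; rewrite (IA _ _ _ hA e) (IB _ _ _ hB e).
- by move=> h e; rewrite (IA _ _ _ h (eq_in_up _ _ _ e)).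
- by move=> h e; rewrite (IA _ _ _ h (eq_in_up _ _ _ e)).
Qed.

Fixpoint tbound (t : term) : nat :=
  match t with
  | TVar n => n.+1
  | TCat t1 t2 | TTimes t1 t2 => maxn (tbound t1) (tbound t2)
  | _ => 0
  end.

Fixpoint fbound (F : formula) : nat :=
  match F with
  | FFlip t => tbound t
  | FEq t s | FPre t s => maxn (tbound t) (tbound s)
  | FNot A => fbound A
  | FAnd A B | FOr A B => maxn (fbound A) (fbound B)
  | FEx A | FAll A => fbound A
  end.

Lemma tscoped_tbound t : tscoped (tbound t) t.
Proof.
by elim: t => //= t IHt s IHs; rewrite (tscoped_leq (leq_maxl _ _) IHt)
  (tscoped_leq (leq_maxr _ _) IHs).
Qed.

Lemma fscoped_fbound F : fscoped (fbound F) F.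
Proof.
elim: F => [t|t s|t s|A IA|A IA B IB|A IA B IB|A IA|A IA] //=.
- exact: tscoped_tbound.
- by rewrite !(tscoped_leq _ (tscoped_tbound _)) ?leq_maxl ?leq_maxr.
- by rewrite !(tscoped_leq _ (tscoped_tbound _)) ?leq_maxl ?leq_maxr.
- by rewrite (fscoped_leq _ IA) ?(fscoped_leq _ IB) ?leq_maxl ?leq_maxr.
- by rewrite (fscoped_leq _ IA) ?(fscoped_leq _ IB) ?leq_maxl ?leq_maxr.
- exact: fscoped_leq (leqnSn _) IA.
- exact: fscoped_leq (leqnSn _) IA.
Qed.

(** * Structures and soundness *)

Record structure : Type := Structure {
  car :> Type;
  s_eps : car;
  s_bit : bool -> car;
  s_cat : car -> car -> car;
  s_times : car -> car -> car;
  s_pre : car -> car -> Prop;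
  s_flip : car -> Prop;
  s_eq : car -> car -> Prop;
  s_refl : forall x, s_eq x x;
  s_sym : forall x y, s_eq x y -> s_eq y x;
  s_trans : forall x y z, s_eq x y -> s_eq y z -> s_eq x z;
  s_cat_congr : forall x x' y y', s_eq x x' -> s_eq y y' -> s_eq (s_cat x y) (s_cat x' y');
  s_times_congr : forall x x' y y', s_eq x x' -> s_eq y y' ->
    s_eq (s_times x y) (s_times x' y');
  s_pre_congr : forall x x' y y', s_eq x x' -> s_eq y y' -> s_pre x y -> s_pre x' y';
  s_flip_congr : forall x x', s_eq x x' -> s_flip x -> s_flip x' }.

Arguments s_eps {_}.
Arguments s_bit {_} _.

Definition strict_structure (T : Type) (eps : T) (bit : bool -> T) (cat times : T -> T -> T)
    (pre : T -> T -> Prop) (flip : T -> Prop) : structure.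
Proof.
refine (@Structure T eps bit cat times pre flip eq _ _ _ _ _ _ _).
- by [].
- by move=> x y ->.
- by move=> x y z -> ->.
- by move=> x x' y y' -> ->.
- by move=> x x' y y' -> ->.
- by move=> x x' y y' -> ->.
- by move=> x x' ->.
Defined.

Definition econs (T : Type) (x : T) (r : nat -> T) (n : nat) : T :=
  if n is m.+1 then r m else x.

Definition etl (T : Type) (r : nat -> T) (n : nat) : T := r n.+1.

Lemma econs_etl (T : Type) (r : nat -> T) : econs (r 0) (etl r) = r.
Proof. by apply/funext => -[]. Qed.

Section Sat.
Variable M : structure.
Implicit Types r : nat -> M.

Fixpoint seval r (t : term) : M :=
  match t with
  | TVar n => r n
  | TEps => s_eps
  | TBit b => s_bit b
  | TCat t1 t2 => s_cat (seval r t1) (seval r t2)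
  | TTimes t1 t2 => s_times (seval r t1) (seval r t2)
  end.

Fixpoint sat r (F : formula) : Prop :=
  match F with
  | FFlip t => s_flip (seval r t)
  | FEq t s => s_eq (seval r t) (seval r s)
  | FPre t s => s_pre (seval r t) (seval r s)
  | FNot A => ~ sat r A
  | FAnd A B => sat r A /\ sat r B
  | FOr A B => sat r A \/ sat r B
  | FEx A => exists x, sat (econs x r) A
  | FAll A => forall x, sat (econs x r) A
  end.

Lemma seval_eq r r' t : (forall n, s_eq (r n) (r' n)) -> s_eq (seval r t) (seval r' t).
Proof.
move=> e; elim: t => //= [|b|t IH s IH'|t IH s IH'].
- exact: s_refl.
- exact: s_refl.
- exact: s_cat_congr.
- exact: s_times_congr.
Qed.

Lemma sat_eq r r' F : (forall n, s_eq (r n) (r' n)) -> sat r F <-> sat r' F.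
Proof.
have sym (q q' : nat -> M) : (forall n, s_eq (q n) (q' n)) -> forall n, s_eq (q' n) (q n).
  by move=> e n; apply: s_sym.
have consE (q q' : nat -> M) x : (forall n, s_eq (q n) (q' n)) ->
    forall n, s_eq (econs x q n) (econs x q' n).
  by move=> e [|n] /=; [exact: s_refl|exact: e].
elim: F r r' => [t|t s|t s|A IA|A IA B IB|A IA B IB|A IA|A IA] r r' e /=.
- have := seval_eq t e; have := seval_eq t (sym _ _ e) => h h'.
  by split; exact: s_flip_congr.
- have := seval_eq t e; have := seval_eq s e => h h'; split => k.
    exact: s_trans (s_trans (s_sym h') k) h.
  exact: s_trans (s_trans h' k) (s_sym h).
- have := seval_eq t e; have := seval_eq s e => h h'.
  by split; apply: s_pre_congr => //; exact: s_sym.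
- by split=> h /(IA _ _ e).
- by rewrite (IA _ _ e) (IB _ _ e).
- by rewrite (IA _ _ e) (IB _ _ e).
- by split=> -[x h]; exists x; move: h; apply: (IA _ _ _).1; apply: consE => //; exact: sym.
- by split=> h x; move: (h x); apply: (IA _ _ _).1; apply: consE => //; exact: sym.
Qed.

Lemma sat_ext r r' F : r =1 r' -> sat r F <-> sat r' F.
Proof. by move=> e; apply: sat_eq => n; rewrite e; exact: s_refl. Qed.

Lemma seval_tsubst r f t : seval r (tsubst f t) = seval (fun n => seval r (f n)) t.
Proof. by elim: t => //= [t -> s ->|t -> s ->]. Qed.

Lemma sat_fsubst r f F : sat r (fsubst f F) <-> sat (fun n => seval r (f n)) F.
Proof.
have upE (q : nat -> M) (g : nat -> term) x :
    (fun n => seval (econs x q) (up g n)) =1 econs x (fun n => seval q (g n)).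
  by move=> [|n] //=; rewrite /tlift seval_tsubst.
elim: F r f => [t|t s|t s|A IA|A IA B IB|A IA B IB|A IA|A IA] r f /=;
  rewrite ?seval_tsubst ?IA ?IB //.
- by split=> -[x h]; exists x; move: h; rewrite IA (sat_ext _ (upE _ _ _)).
- by split=> h x; move: (h x); rewrite IA (sat_ext _ (upE _ _ _)).
Qed.

Lemma sat_flift r x F : sat (econs x r) (flift F) <-> sat r F.
Proof. by rewrite sat_fsubst. Qed.

Lemma sat_inst r t F : sat r (inst t F) <-> sat (econs (seval r t) r) F.
Proof. by rewrite sat_fsubst; apply: sat_ext => -[]. Qed.

Lemma seval_tlift r x t : seval (econs x r) (tlift t) = seval r t.
Proof. by rewrite seval_tsubst. Qed.

Lemma sat_imp r A B : sat r (FImp A B) <-> (sat r A -> sat r B).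
Proof.
split=> [[]//|h]; have [/h|] := pselect (sat r A); by [right|left].
Qed.

Lemma sat_iff r A B : sat r (FIff A B) <-> (sat r A <-> sat r B).
Proof. by rewrite -[sat r (FIff A B)]/(sat r (FImp A B) /\ sat r (FImp B A)) !sat_imp. Qed.

Lemma sat_induction r B (x := TVar 0) :
  sat r (FImp (FAnd (inst TEps B) (FAll (FImp B (FAnd (repl (snoc x false) B)
                                                      (repl (snoc x true) B))))) (FAll B)) <->
  (sat (econs s_eps r) B ->
   (forall y b, sat (econs y r) B -> sat (econs (s_cat y (s_bit b)) r) B) ->
   forall y, sat (econs y r) B).
Proof.
have sat_and q A C : sat q (FAnd A C) <-> sat q A /\ sat q C by [].
have sat_all C : sat r (FAll C) <-> forall y, sat (econs y r) C by [].
have sat_repl y b : sat (econs y r) (repl (snoc x b) B) <->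
    sat (econs (s_cat y (s_bit b)) r) B by rewrite sat_fsubst; apply: sat_ext => -[].
have sat_step y : sat (econs y r) (FImp B (FAnd (repl (snoc x false) B) (repl (snoc x true) B)))
    <-> (sat (econs y r) B -> forall b, sat (econs (s_cat y (s_bit b)) r) B).
  rewrite sat_imp sat_and !sat_repl; split=> h /h; last by [].
  by move=> [h_false h_true] [].
rewrite sat_imp sat_and sat_inst !sat_all; split=> [h h0 hS|h [h0 hS]].
  by apply: h; split=> // y; apply/sat_step => hy b; exact: hS.
by apply: h => // y b hy; exact: (sat_step y).1 (hS y) hy b.
Qed.

Lemma sat_iterAll k A : (forall r, sat r (iter k FAll A)) <-> forall r, sat r A.
Proof.
elim: k => // k <-; split=> h r.
  by rewrite -(econs_etl r); have := h (etl r); rewrite iterS; exact.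
by rewrite iterS => x; exact: h.
Qed.

Lemma sat_ex_unique r A : sat r (ex_unique A) <->
  exists2 y, sat (econs y r) A & forall z, sat (econs z r) A -> s_eq z y.
Proof.
have only_y y : sat (econs y r) (FAll (FImp
    (fsubst (fun n => if n is m.+1 then TVar m.+2 else TVar 0) A) (FEq (TVar 0) (TVar 1)))) <->
    forall z, sat (econs z r) A -> s_eq z y.
  have satE z : sat (econs z (econs y r)) (FImp
      (fsubst (fun n => if n is m.+1 then TVar m.+2 else TVar 0) A) (FEq (TVar 0) (TVar 1))) <->
      (sat (econs z r) A -> s_eq z y).
    by rewrite sat_imp sat_fsubst (sat_ext _ (r' := econs z r)) //; case.
  by split=> h z; have /satE := h z.
by split=> [[y [hy /only_y]]|[y hy /only_y]]; exists y.
Qed.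

Lemma soundness (Th : formula -> Prop) (G : seq formula) A :
  (forall B r, Th B -> sat r B) -> proves Th G A ->
  forall r, (forall B, List.In B G -> sat r B) -> sat r A.
Proof.
move=> hTh; elim=> {G A}
  [G A /hTh //|G A hA r hG|G A B _ h1 _ h2 r hG|G A B _ h1 _ h2 r hG
  |G A B _ h1 _ h2 r hG|G A B _ h r hG|G A B _ h r hG|G A B _ h r hG|G A B _ h r hG
  |G A B C _ h _ h1 _ h2 r hG|G A _ h r hG|G A t _ h r hG|G A t _ h r hG
  |G A C _ h _ h1 r hG|G t r hG|G A t s _ h _ h1 r hG] /=.
- exact: hG.
- move=> hA; have hG' B' : List.In B' (A :: G) -> sat r B' by case=> [<-//|/hG].
  exact: (h2 r hG') (h1 r hG').
- apply: contrapT => nA.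
  have hG' B' : List.In B' (FNot A :: G) -> sat r B' by case=> [<-//|/hG].
  exact: (h2 r hG') (h1 r hG').
- by split; [exact: h1|exact: h2].
- by case: (h r hG).
- by case: (h r hG).
- by left; exact: h.
- by right; exact: h.
- by case: (h r hG) => hA; [apply: h1|apply: h2] => B' [<-//|/hG].
- by move=> x; apply: h => B /List.in_map_iff[B' [<- /hG]]; rewrite sat_flift.
- by rewrite sat_inst; exact: h.
- by exists (seval r t); rewrite -sat_inst; exact: h.
- have [x hx] := h r hG; rewrite -(sat_flift r x); apply: h1 => B [<-//|].
  by move=> /List.in_map_iff[B' [<- /hG]]; rewrite sat_flift.
- exact: s_refl.
- rewrite sat_inst; have := h1 r hG; rewrite sat_inst; apply: (sat_eq _ _).1 => -[|n] /=.
    exact: h.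
  exact: s_refl.
Qed.

End Sat.

(** * Completeness *)

Section Derivations.
Variable Th : formula -> Prop.
Notation "G |- A" := (proves Th G A) (at level 70).

Lemma proves_weaken G G' A :
  G |- A -> (forall B, List.In B G -> List.In B G') -> G' |- A.
Proof.
have incl_cons (B : formula) G1 G2 : (forall C, List.In C G1 -> List.In C G2) ->
    forall C, List.In C (B :: G1) -> List.In C (B :: G2).
  by move=> s C [->|/s]; [left|right].
have incl_map G1 G2 : (forall C, List.In C G1 -> List.In C G2) ->
    forall C, List.In C (map flift G1) -> List.In C (map flift G2).
  move=> s C /List.in_map_iff[C' [<- /s h]]; apply/List.in_map_iff; by exists C'.
move=> d; elim: d G' => {G A}
  [G A hA|G A hA|G A B _ h1 _ h2|G A B _ h1 _ h2
  |G A B _ h1 _ h2|G A B _ h|G A B _ h|G A B _ h|G A B _ h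
  |G A B C _ h _ h1 _ h2|G A _ h|G A t _ h|G A t _ h
  |G A C _ h _ h1|G t|G A t s _ h _ h1] G' s'.
- exact: P_Ax.
- by apply: P_Hyp; exact: s'.
- by apply: (@P_NotI _ _ _ B); [apply: h1|apply: h2]; exact: incl_cons.
- by apply: (@P_NotE _ _ _ B); [apply: h1|apply: h2]; exact: incl_cons.
- by apply: P_AndI; [apply: h1|apply: h2].
- by apply: P_AndEl; apply: h.
- by apply: P_AndEr; apply: h.
- by apply: P_OrIl; apply: h.
- by apply: P_OrIr; apply: h.
- by apply: P_OrE (h _ s') _ _; [apply: h1|apply: h2]; exact: incl_cons.
- by apply: P_AllI; apply: h; exact: incl_map.
- by apply: P_AllE; apply: h.
- by apply: P_ExI (h _ s').
- apply: P_ExE (h _ s') _; apply: h1; apply: incl_cons; exact: incl_map.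
- exact: P_EqI.
- by apply: P_EqE (h _ s') (h1 _ s').
Qed.

Lemma fsubst_iterAll n f A :
  fsubst f (iter n FAll A) = iter n FAll (fsubst (iter n up f) A).
Proof. by elim: n f => // n IH f; rewrite iterS /= IH -iterSr. Qed.

Lemma iter_up_lt n f i : (i < n)%N -> iter n up f i = TVar i.
Proof. by elim: n i => // n IH [|i] //= h; rewrite IH. Qed.

Lemma iter_up_ge n f i : iter n up f (n + i) = tsubst (fun j => TVar (j + n)) (f i).
Proof.
elim: n => [|n IH] /=.
  by rewrite add0n -[LHS]tsubst_id; apply: eq_tsubst => j; rewrite addn0.
by rewrite IH /tlift tsubst_comp; apply: eq_tsubst => j; rewrite /= addnS.
Qed.

Lemma proves_iterAll_elim n G A (s : nat -> term) : G |- iter n FAll A ->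
  G |- fsubst (fun i => if (i < n)%N then s i else TVar (i - n)) A.
Proof.
elim: n A => [|n IH] A.
  by rewrite /= fsubst_id // => i; rewrite /= subn0.
rewrite iterS => /(P_AllE (s n)).
rewrite /inst fsubst_iterAll => /IH; rewrite fsubst_comp.
rewrite (@eq_fsubst _ (fun i => if (i < n.+1)%N then s i else TVar (i - n.+1))) // => i.
case: (ltngtP i n) => [lt|gt|->].
- by rewrite iter_up_lt //= lt ltnS ltnW.
- have [j ->] : exists j, i = (n + j.+1)%N by exists (i - n.+1)%N; lia.
  rewrite iter_up_ge /= ltnNge leq_addl /= addnK ltnNge -addSnnS leq_addr /=.
  by congr TVar; lia.
- rewrite -[X in iter _ _ _ X]addn0 iter_up_ge /= ltnS leqnn tsubst_comp.
  by rewrite -[RHS]tsubst_id; apply: eq_tsubst => j /=; rewrite ltnNge leq_addl /= addnK.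
Qed.

Lemma proves_axiom_iterAll n G A : Th A -> G |- iter n FAll A.
Proof.
move=> hA; elim: n G => [|n IH] G; first exact: P_Ax.
by rewrite iterS; apply: P_AllI; exact: IH.
Qed.

Lemma proves_axiom_fsubst G A s : Th A -> G |- fsubst s A.
Proof.
move=> /(proves_axiom_iterAll (fbound A) G)/(proves_iterAll_elim s).
by rewrite (eq_in_fsubst (g := s) (fscoped_fbound A)) // => i ->.
Qed.

Lemma proves_fsubst G A s : G |- A -> map (fsubst s) G |- fsubst s A.
Proof.
have map_lift G' f : map (fsubst (up f)) (map flift G') = map flift (map (fsubst f) G').
  by rewrite -!map_comp; apply: eq_map => B /=; exact: fsubst_up_flift.
move=> d; elim: d s => {G A}
  [G A hA|G A hA|G A B _ h1 _ h2|G A B _ h1 _ h2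
  |G A B _ h1 _ h2|G A B _ h|G A B _ h|G A B _ h|G A B _ h
  |G A B C _ h _ h1 _ h2|G A _ h|G A t _ h|G A t _ h
  |G A C _ h _ h1|G t|G A t t' _ h _ h1] s.
- exact: proves_axiom_fsubst.
- by apply: P_Hyp; apply: List.in_map.
- by apply: (@P_NotI _ _ _ (fsubst s B)); [apply: h1|apply: h2].
- by apply: (@P_NotE _ _ _ (fsubst s B)); [apply: h1|apply: h2].
- by apply: P_AndI; [apply: h1|apply: h2].
- by apply: P_AndEl; apply: h.
- by apply: P_AndEr; apply: h.
- by apply: P_OrIl; apply: h.
- by apply: P_OrIr; apply: h.
- by apply: P_OrE (h s) (h1 s) (h2 s).
- by apply: P_AllI; rewrite -map_lift; exact: h.
- by rewrite -inst_fsubst; apply: P_AllE; apply: h.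
- by apply: (@P_ExI _ _ _ (tsubst s t)); rewrite inst_fsubst; exact: h.
- apply: P_ExE (h s) _; rewrite -map_lift -fsubst_up_flift; exact: h1.
- exact: P_EqI.
- rewrite -inst_fsubst; apply: P_EqE (h s) _; rewrite inst_fsubst; exact: h1.
Qed.

Definition consistent (G : seq formula) : Prop := ~ exists2 B, G |- B & G |- FNot B.

Definition fresh_var (G : seq formula) : nat := foldr (fun F => maxn (fbound F)) 0 G.

Lemma fscoped_fresh_var G F : List.In F G -> fscoped (fresh_var G) F.
Proof.
elim: G => //= C G IH [->|/IH h]; first exact: fscoped_leq (leq_maxl _ _) (fscoped_fbound F).
exact: fscoped_leq (leq_maxr _ _) h.
Qed.

(* A derivation using the fresh witness is turned by [s] into one that uses the
   eigenvariable 0 of the existential elimination rule. *)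
Lemma consistent_witness G A (m := fresh_var (FEx A :: G)) :
  consistent (FEx A :: G) -> consistent (inst (TVar m) A :: FEx A :: G).
Proof.
move=> con [B hB hnB]; apply: con.
pose s i := if i == m then TVar 0 else TVar i.+1.
have s_lt i : (i < m)%N -> s i = TVar i.+1.
  by rewrite /s; case: eqP => // ->; rewrite ltnn.
have s_lift F : List.In F (FEx A :: G) -> fsubst s F = flift F.
  by move=> /fscoped_fresh_var h; exact: eq_in_fsubst h s_lt.
have s_context : map (fsubst s) (inst (TVar m) A :: FEx A :: G) = A :: map flift (FEx A :: G).
  rewrite map_cons; congr cons; last exact: (List.map_ext_in _ _ _ s_lift).
  have hA : fscoped m.+1 A := @fscoped_fresh_var (FEx A :: G) (FEx A) (or_introl erefl).
  rewrite /inst fsubst_comp -[RHS](fsubst_id A (fun=> erefl)); apply: eq_in_fsubst hA _.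
  by case=> [|i] /= im; [rewrite /s eqxx|rewrite s_lt].
suff absurd C : FEx A :: G |- C by exists (FEq TEps TEps); exact: absurd.
apply: P_ExE; first by apply: P_Hyp; left.
rewrite -s_context; apply: (@P_NotE _ _ _ (fsubst s B)).
  by apply: proves_weaken (proves_fsubst s hB) _ => D; right.
by apply: proves_weaken (proves_fsubst s hnB) _ => D; right.
Qed.

End Derivations.

Section Enumeration.
Variables (C : countType) (T : Type) (x0 : T) (code : T -> C) (decode : C -> T).

Definition enumerate (n : nat) : T := odflt x0 (omap decode (unpickle n)).

Lemma enumerate_surj : cancel code decode -> forall x, exists n, enumerate n = x.
Proof. by move=> codeK x; exists (pickle (code x)); rewrite /enumerate pickleK /= codeK. Qed.

End Enumeration.

Fixpoint term_tree (t : term) : GenTree.tree nat :=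
  match t with
  | TVar n => GenTree.Leaf n
  | TEps => GenTree.Node 0 [::]
  | TBit b => GenTree.Node (1 + b) [::]
  | TCat t s => GenTree.Node 3 [:: term_tree t; term_tree s]
  | TTimes t s => GenTree.Node 4 [:: term_tree t; term_tree s]
  end.

Fixpoint tree_term (x : GenTree.tree nat) : term :=
  match x with
  | GenTree.Leaf n => TVar n
  | GenTree.Node 0 _ => TEps
  | GenTree.Node 1 _ => TBit false
  | GenTree.Node 2 _ => TBit true
  | GenTree.Node 3 [:: t; s] => TCat (tree_term t) (tree_term s)
  | GenTree.Node _ [:: t; s] => TTimes (tree_term t) (tree_term s)
  | _ => TEps
  end.

Lemma term_treeK : cancel term_tree tree_term.
Proof. by elim=> //= [[]|t -> s ->|t -> s ->]. Qed.

Fixpoint formula_tree (F : formula) : GenTree.tree nat :=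
  match F with
  | FFlip t => GenTree.Node 0 [:: term_tree t]
  | FEq t s => GenTree.Node 1 [:: term_tree t; term_tree s]
  | FPre t s => GenTree.Node 2 [:: term_tree t; term_tree s]
  | FNot A => GenTree.Node 3 [:: formula_tree A]
  | FAnd A B => GenTree.Node 4 [:: formula_tree A; formula_tree B]
  | FOr A B => GenTree.Node 5 [:: formula_tree A; formula_tree B]
  | FEx A => GenTree.Node 6 [:: formula_tree A]
  | FAll A => GenTree.Node 7 [:: formula_tree A]
  end.

Fixpoint tree_formula (x : GenTree.tree nat) : formula :=
  match x with
  | GenTree.Node 0 [:: t] => FFlip (tree_term t)
  | GenTree.Node 1 [:: t; s] => FEq (tree_term t) (tree_term s)
  | GenTree.Node 2 [:: t; s] => FPre (tree_term t) (tree_term s)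
  | GenTree.Node 3 [:: A] => FNot (tree_formula A)
  | GenTree.Node 4 [:: A; B] => FAnd (tree_formula A) (tree_formula B)
  | GenTree.Node 5 [:: A; B] => FOr (tree_formula A) (tree_formula B)
  | GenTree.Node 6 [:: A] => FEx (tree_formula A)
  | GenTree.Node 7 [:: A] => FAll (tree_formula A)
  | _ => FFlip TEps
  end.

Lemma formula_treeK : cancel formula_tree tree_formula.
Proof.
by elim=> //= [t|t s|t s|A ->|A -> B ->|A -> B ->|A ->|A ->] //; rewrite !term_treeK.
Qed.

Section Completeness.
Variables (Th : formula -> Prop) (A0 : formula).
Hypothesis unprovable : ~ proves Th [::] A0.
Notation "G |- A" := (proves Th G A) (at level 70).

Definition henkin_step (F : formula) (G : seq formula) : seq formula :=
  if `[< consistent Th (F :: G) >] then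
    if F is FEx B then inst (TVar (fresh_var (F :: G))) B :: F :: G else F :: G
  else G.

Fixpoint henkin (n : nat) : seq formula :=
  if n is m.+1 then henkin_step (enumerate A0 tree_formula m) (henkin m) else [:: FNot A0].

Lemma henkin_consistent n : consistent Th (henkin n).
Proof.
elim: n => [|n IH] /=.
  by move=> [B hB hnB]; apply: unprovable; exact: P_NotE hB hnB.
rewrite /henkin_step; case: asboolP => // con.
by case: (enumerate _ _ n) con => // A; exact: consistent_witness.
Qed.

Lemma henkin_leq m n B : (m <= n)%N -> List.In B (henkin m) -> List.In B (henkin n).
Proof.
move=> /subnK <-; elim: (n - m)%N => //= k IH /IH h.
rewrite /henkin_step; case: asboolP => // _.
by case: (enumerate _ _ _) => *; rewrite /=; tauto.
Qed.

Definition henkin_proves (B : formula) : Prop := exists n, henkin n |- B.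

Lemma henkin_proves_derivable D : (forall G, G |- D) -> henkin_proves D.
Proof. by move=> h; exists 0; exact: h. Qed.

Lemma henkin_proves_mono B D : (forall G, G |- B -> G |- D) -> henkin_proves B -> henkin_proves D.
Proof. by move=> h [n /h ?]; exists n. Qed.

Lemma henkin_proves_mono2 B C D : (forall G, G |- B -> G |- C -> G |- D) ->
  henkin_proves B -> henkin_proves C -> henkin_proves D.
Proof.
move=> h [m hm] [n hn]; exists (maxn m n); apply: h.
  by apply: proves_weaken hm _ => E; apply: henkin_leq; exact: leq_maxl.
by apply: proves_weaken hn _ => E; apply: henkin_leq; exact: leq_maxr.
Qed.

Lemma henkin_decides F n (en : enumerate A0 tree_formula n = F) :
  henkin_proves (FNot F) \/ henkin n.+1 = if F is FEx B
    then inst (TVar (fresh_var (F :: henkin n))) B :: F :: henkin n else F :: henkin n.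
Proof.
rewrite /= /henkin_step en; case: asboolP => [_|/contrapT[C hC hnC]]; first by right.
by left; exists n; exact: P_NotI hC hnC.
Qed.

Lemma henkin_proves_not B : henkin_proves (FNot B) <-> ~ henkin_proves B.
Proof.
split=> [hn h|nB].
  have [n hn'] : henkin_proves (FAnd B (FNot B)).
    by apply: henkin_proves_mono2 h hn => G; exact: P_AndI.
  by apply: (@henkin_consistent n); exists B; [exact: P_AndEl hn'|exact: P_AndEr hn'].
have [n en] := enumerate_surj A0 formula_treeK B.
case: (henkin_decides en) => // e; case: nB; exists n.+1; apply: P_Hyp; rewrite e.
by case: (B) => *; rewrite /=; tauto.
Qed.

Lemma henkin_proves_ex B : henkin_proves (FEx B) -> exists t, henkin_proves (inst t B).
Proof.
have [n en] := enumerate_surj A0 formula_treeK (FEx B).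
case: (henkin_decides en) => [/henkin_proves_not //|e] _.
by exists (TVar (fresh_var (FEx B :: henkin n))), n.+1; apply: P_Hyp; rewrite e; left.
Qed.

Lemma henkin_proves_notall B : ~ henkin_proves (FAll B) -> henkin_proves (FEx (FNot B)).
Proof.
move=> /henkin_proves_not; apply: henkin_proves_mono => G h.
apply: (@P_NotE _ _ _ (FAll B)); last by apply: proves_weaken h _ => C; right.
apply: P_AllI; apply: (@P_NotE _ _ _ (flift (FEx (FNot B)))).
  rewrite -[flift _]/(FEx (fsubst (up (fun n => TVar n.+1)) (FNot B))).
  apply: (@P_ExI _ _ _ (TVar 0)); apply: P_Hyp; left.
  by rewrite inst_fsubst_up fsubst_id // => -[].
by apply: P_Hyp; right; left.
Qed.

Definition henkin_eq (t s : term) : Prop := henkin_proves (FEq t s).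

Lemma henkin_eq_refl t : henkin_eq t t.
Proof. by apply: henkin_proves_derivable => G; exact: P_EqI. Qed.

Lemma henkin_eq_inst B t s :
  henkin_eq t s -> henkin_proves (inst t B) -> henkin_proves (inst s B).
Proof. by apply: henkin_proves_mono2 => G; exact: P_EqE. Qed.

Lemma henkin_eq_sym t s : henkin_eq t s -> henkin_eq s t.
Proof.
move=> h; have := @henkin_eq_inst (FEq (TVar 0) (tlift t)) _ _ h.
rewrite /inst /= -!/(subst0 _) !tsubst_subst0_tlift; apply; exact: henkin_eq_refl.
Qed.

Lemma henkin_eq_trans t s u : henkin_eq t s -> henkin_eq s u -> henkin_eq t u.
Proof.
move=> h h'; have := @henkin_eq_inst (FEq (tlift t) (TVar 0)) _ _ h'.
by rewrite /inst /= -!/(subst0 _) !tsubst_subst0_tlift; apply.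
Qed.

Lemma henkin_eq_congr (op : term -> term -> term) :
  (forall f t s, tsubst f (op t s) = op (tsubst f t) (tsubst f s)) ->
  forall x x' y y', henkin_eq x x' -> henkin_eq y y' -> henkin_eq (op x y) (op x' y').
Proof.
move=> opE x x' y y' h h'; apply: (@henkin_eq_trans _ (op x' y)).
  have := @henkin_eq_inst (FEq (tlift (op x y)) (op (TVar 0) (tlift y))) _ _ h.
  rewrite /inst /= !opE -!/(subst0 _) !tsubst_subst0_tlift; apply; exact: henkin_eq_refl.
have := @henkin_eq_inst (FEq (tlift (op x' y)) (op (tlift x') (TVar 0))) _ _ h'.
rewrite /inst /= !opE -!/(subst0 _) !tsubst_subst0_tlift; apply; exact: henkin_eq_refl.
Qed.

Lemma henkin_pre_congr x x' y y' : henkin_eq x x' -> henkin_eq y y' ->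
  henkin_proves (FPre x y) -> henkin_proves (FPre x' y').
Proof.
move=> h h' hxy; have := @henkin_eq_inst (FPre (TVar 0) (tlift y)) _ _ h.
have := @henkin_eq_inst (FPre (tlift x') (TVar 0)) _ _ h'.
rewrite /inst /= -!/(subst0 _) !tsubst_subst0_tlift => pre_r pre_l.
by apply: pre_r; exact: pre_l.
Qed.

Lemma henkin_flip_congr x x' :
  henkin_eq x x' -> henkin_proves (FFlip x) -> henkin_proves (FFlip x').
Proof. by move=> h; exact: (@henkin_eq_inst (FFlip (TVar 0)) _ _ h). Qed.

Definition term_model : structure := Structure TEps TBit
  henkin_eq_refl henkin_eq_sym henkin_eq_trans
  (@henkin_eq_congr TCat (fun _ _ _ => erefl)) (@henkin_eq_congr TTimes (fun _ _ _ => erefl))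
  henkin_pre_congr henkin_flip_congr.

Lemma seval_term_model (s : nat -> term_model) t : seval s t = tsubst s t.
Proof. by elim: t => //= [t -> u ->|t -> u ->]. Qed.

Lemma henkin_proves_or A B :
  henkin_proves (FOr A B) <-> henkin_proves A \/ henkin_proves B.
Proof.
split=> [h|[]]; last 2 first.
- by apply: henkin_proves_mono => G; exact: P_OrIl.
- by apply: henkin_proves_mono => G; exact: P_OrIr.
apply: contrapT => /not_orP[/henkin_proves_not hA /henkin_proves_not hB].
have /henkin_proves_not : henkin_proves (FNot (FOr A B)); last by [].
apply: henkin_proves_mono2 hA hB => G hA hB; apply: (@P_NotI _ _ _ B); last first.
  by apply: proves_weaken hB _ => C; right.
apply: P_OrE; first by apply: P_Hyp; left.
  apply: (@P_NotE _ _ _ A); first by apply: P_Hyp; right; left.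
  by apply: proves_weaken hA _ => C; do 3 right.
by apply: P_Hyp; left.
Qed.

Lemma sat_term_model (s : nat -> term_model) F : sat s F <-> henkin_proves (fsubst s F).
Proof.
have consE (s' : nat -> term_model) (t : term_model) A :
    fsubst (econs t s' : nat -> term) A = inst t (fsubst (up s') A).
  by rewrite inst_fsubst_up; apply: eq_fsubst => -[].
elim: F s => [t|t u|t u|A IA|A IA B IB|A IA B IB|A IA|A IA] s /=;
  rewrite ?seval_term_model //.
- by rewrite IA henkin_proves_not.
- rewrite IA IB; split=> [[]|h]; first by apply: henkin_proves_mono2 => G; exact: P_AndI.
  by split; move: h; apply: henkin_proves_mono => G; [exact: P_AndEl|exact: P_AndEr].
- by rewrite IA IB henkin_proves_or.
- split=> [[t /IA]|].
    by rewrite consE; apply: henkin_proves_mono => G; exact: P_ExI.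
  by move=> /henkin_proves_ex[t ht]; exists t; apply/IA; rewrite consE.
- split=> [h|h t].
    apply: contrapT => /henkin_proves_notall /henkin_proves_ex[t].
    rewrite -[inst _ _]/(FNot (inst t (fsubst (up s) A))) => /henkin_proves_not.
    by apply; rewrite -consE; apply/IA; exact: h.
  by apply/IA; rewrite consE; apply: henkin_proves_mono h => G; exact: P_AllE.
Qed.

Lemma term_model_axioms B (s : nat -> term_model) : Th B -> sat s B.
Proof.
by move=> hB; apply/sat_term_model; apply: henkin_proves_derivable => G; exact: proves_axiom_fsubst.
Qed.

Lemma term_model_refutes : ~ sat (TVar : nat -> term_model) A0.
Proof.
move=> /sat_term_model; rewrite fsubst_id //; apply/henkin_proves_not.
by exists 0; apply: P_Hyp; left.
Qed.

End Completeness.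

Section Quotient.
Variable M : structure.

Definition eqclass : Type := {c : set M | exists x, c = s_eq x}.
Definition eqclass_of (x : M) : eqclass := exist _ (s_eq x) (ex_intro _ x erefl).
Definition eqclass_repr (c : eqclass) : M := projT1 (cid (projT2 c)).

Lemma eqclass_of_eq x y : eqclass_of x = eqclass_of y <-> s_eq x y.
Proof.
split=> [[e]|h]; first by rewrite e; exact: s_refl.
apply: eq_exist; apply/funext => z; apply/propext; split=> k.
  exact: s_trans (s_sym h) k.
exact: s_trans h k.
Qed.

Lemma eqclass_reprK c : eqclass_of (eqclass_repr c) = c.
Proof.
by case: c => c hc; apply: eq_exist; rewrite /eqclass_repr /=; case: cid => x /= ->.
Qed.

Lemma repr_eqclass_of x : s_eq (eqclass_repr (eqclass_of x)) x.
Proof. by rewrite -eqclass_of_eq eqclass_reprK. Qed.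

Definition quotient : structure :=
  strict_structure (eqclass_of s_eps) (fun b => eqclass_of (s_bit b))
    (fun x y => eqclass_of (s_cat (eqclass_repr x) (eqclass_repr y)))
    (fun x y => eqclass_of (s_times (eqclass_repr x) (eqclass_repr y)))
    (fun x y => s_pre (eqclass_repr x) (eqclass_repr y))
    (fun x => s_flip (eqclass_repr x)).

Lemma seval_quotient r t :
  seval (M := quotient) (fun n => eqclass_of (r n)) t = eqclass_of (seval r t).
Proof.
elim: t => //= [t -> s ->|t -> s ->]; apply/eqclass_of_eq.
  by apply: s_cat_congr; exact: repr_eqclass_of.
by apply: s_times_congr; exact: repr_eqclass_of.
Qed.

Lemma sat_quotient r F :
  sat (M := quotient) (fun n => eqclass_of (r n)) F <-> sat r F.
Proof.
have consE (q : nat -> M) x : ((fun n => eqclass_of (econs x q n)) : nat -> quotient) =1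
    econs (eqclass_of x : quotient) (fun n => eqclass_of (q n)).
  by case.
elim: F r => [t|t s|t s|A IA|A IA B IB|A IA B IB|A IA|A IA] r /=;
  rewrite ?seval_quotient ?IA ?IB //.
- split; apply: s_flip_congr; first exact: repr_eqclass_of.
  by apply: s_sym; exact: repr_eqclass_of.
- exact: eqclass_of_eq.
- split; apply: s_pre_congr; try exact: repr_eqclass_of.
    by apply: s_sym; exact: repr_eqclass_of.
  by apply: s_sym; exact: repr_eqclass_of.
- split=> [[c]|[x]].
    by rewrite -(eqclass_reprK c) -(sat_ext _ (consE _ _)) IA => h; exists (eqclass_repr c).
  by rewrite -IA (sat_ext _ (consE _ _)); exists (eqclass_of x).
- split=> h.
    by move=> x; rewrite -IA (sat_ext _ (consE _ _)).
  by move=> c; rewrite -(eqclass_reprK c) -(sat_ext _ (consE _ _)) IA.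
Qed.

End Quotient.

Definition model (Th : formula -> Prop) (M : structure) : Prop :=
  (forall x y : M, s_eq x y -> x = y) /\ forall A (r : nat -> M), Th A -> sat r A.

Theorem completeness (Th : formula -> Prop) (A : formula) :
  (forall M : structure, model Th M -> forall r : nat -> M, sat r A) ->
  proves Th [::] A.
Proof.
move=> h; apply: contrapT => nA.
pose M := term_model Th A; apply: (@term_model_refutes _ _ nA).
rewrite -sat_quotient; apply: h; split=> // B r hB.
have -> : r = (fun n => eqclass_of (eqclass_repr (r n) : M)).
  by apply/funext => n; rewrite eqclass_reprK.
by rewrite sat_quotient; exact: term_model_axioms.
Qed.

(** * Definable predicates, uniformly over the models of the theory *)

Record NIA_model : Type := NIAModel {
  NIA_structure :> structure;
  NIA_modelP : model NIA NIA_structure }.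

Definition term_definable (n : nat) (f : forall M : structure, (nat -> M) -> M) : Prop :=
  exists2 t, tscoped n t & forall M r, f M r = seval r t.

Definition definable (C : formula -> Prop) (n : nat)
    (P : forall M : structure, (nat -> M) -> Prop) : Prop :=
  exists F, [/\ C F, fscoped n F & forall (M : NIA_model) (r : nat -> M), sat r F <-> P M r].

Definition subword (M : structure) (x t : M) : Prop :=
  exists w, s_pre w t /\ s_pre (s_cat w x) t.

Definition embed (M : structure) (s : word) : M := foldl (fun x b => s_cat x (s_bit b)) s_eps s.

Lemma sat_ex_subword (M : structure) (r : nat -> M) t A :
  sat r (ex_subword t A) <-> exists x, subword x (seval r t) /\ sat (econs x r) A.
Proof.
rewrite /=; split=> [[x [u]]|[x [[u [ut uxt]] hA]]].
  by rewrite !seval_tlift sat_flift => -[[ut uxt] hA]; exists x; split=> //; exists u.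
by exists x, u; rewrite !seval_tlift sat_flift.
Qed.

Lemma sat_all_subword (M : structure) (r : nat -> M) t A :
  sat r (all_subword t A) <-> forall x, subword x (seval r t) -> sat (econs x r) A.
Proof.
have satE x : sat (econs x r) (FImp (FEx (subword_witness (tlift (tlift t)))) A) <->
    (subword x (seval r t) -> sat (econs x r) A).
  by rewrite sat_imp; split=> h [u [ut uxt]]; apply: h; exists u; move: ut uxt;
    rewrite /= !seval_tlift.
by split=> h x; have /satE := h x.
Qed.

Lemma sat_all_subword_not (M : structure) (r : nat -> M) t A :
  sat r (all_subword t A) <-> ~ sat r (ex_subword t (FNot A)).
Proof.
rewrite sat_all_subword sat_ex_subword; split=> [h [x [/h]]//|h x hx].
by apply: contrapT => nA; apply: h; exists x.
Qed.

Lemma sat_ex_le (M : structure) (r : nat -> M) t A : sat r (ex_le t A) <-> exists x,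
  s_pre (s_times (s_bit true) x) (s_times (s_bit true) (seval r t)) /\ sat (econs x r) A.
Proof. by split=> -[x hx]; exists x; move: hx; rewrite /= seval_tlift. Qed.

Lemma fscoped_ex_subword n t A : tscoped n t -> fscoped n.+1 A -> fscoped n (ex_subword t A).
Proof. by move=> ht hA /=; rewrite !tscoped_tlift //=; apply: fscoped_fsubst hA _ => i; exact. Qed.

Lemma fscoped_all_subword n t A : tscoped n t -> fscoped n.+1 A -> fscoped n (all_subword t A).
Proof. by move=> ht hA /=; rewrite !tscoped_tlift. Qed.

Lemma tdef_var n i : (i < n)%N -> term_definable n (fun M r => r i).
Proof. by exists (TVar i). Qed.

Lemma tdef_eps n : term_definable n (fun M r => s_eps).
Proof. by exists TEps. Qed.

Lemma tdef_bit n b : term_definable n (fun M r => s_bit b).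
Proof. by exists (TBit b). Qed.

Lemma tdef_cat n f g : term_definable n f -> term_definable n g ->
  term_definable n (fun M r => s_cat (f M r) (g M r)).
Proof.
move=> [t ht et] [s hs es]; exists (TCat t s); first by rewrite /= ht.
by move=> M r /=; rewrite et es.
Qed.

Lemma tdef_times n f g : term_definable n f -> term_definable n g ->
  term_definable n (fun M r => s_times (f M r) (g M r)).
Proof.
move=> [t ht et] [s hs es]; exists (TTimes t s); first by rewrite /= ht.
by move=> M r /=; rewrite et es.
Qed.

Lemma tdef_embed n s : term_definable n (fun M r => embed M s).
Proof.
elim/last_ind: s => [|s b IH]; first exact: tdef_eps.
have [t ht et] := tdef_cat IH (tdef_bit n b).
by exists t => // M r; rewrite -et /embed foldl_rcons.
Qed.

Lemma tdef_weaken k n f : term_definable n f ->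
  term_definable (k + n) (fun M r => f M (fun i => r (k + i))).
Proof.
move=> [t ht et]; exists (tsubst (fun i => TVar (k + i)) t) => [|M r]; last first.
  by rewrite et seval_tsubst.
by apply: tscoped_tsubst ht _ => i /= h; rewrite ltn_add2l.
Qed.

Lemma definable_sub (C C' : formula -> Prop) n P :
  (forall F, C F -> C' F) -> definable C n P -> definable C' n P.
Proof. by move=> s [F [hC hF FP]]; exists F; split=> //; exact: s. Qed.

Lemma definable_ext C n P (Q : forall M : structure, (nat -> M) -> Prop) : definable C n P ->
  (forall (M : NIA_model) (r : nat -> M), P M r <-> Q M r) -> definable C n Q.
Proof. by move=> [F [hC hF FP]] e; exists F; split=> // M r; rewrite FP. Qed.

Notation sb_definable := (definable subword_bounded).

Lemma sbdef_flip n f : term_definable n f -> sb_definable n (fun M r => s_flip (f M r)).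
Proof.
by move=> [t ht et]; exists (FFlip t); split=> // [|M r]; [constructor|rewrite et].
Qed.

Lemma sbdef_eq n f g : term_definable n f -> term_definable n g ->
  sb_definable n (fun M r => f M r = g M r).
Proof.
move=> [t ht et] [s hs es]; exists (FEq t s); split; first by constructor.
  by rewrite /= ht.
move=> M r; rewrite et es /=; split=> [|->]; last exact: s_refl.
exact: (NIA_modelP M).1.
Qed.

Lemma sbdef_pre n f g : term_definable n f -> term_definable n g ->
  sb_definable n (fun M r => s_pre (f M r) (g M r)).
Proof.
move=> [t ht et] [s hs es]; exists (FPre t s); split; first by constructor.
  by rewrite /= ht.
by move=> M r; rewrite et es.
Qed.

Lemma sbdef_not n P : sb_definable n P -> sb_definable n (fun M r => ~ P M r).
Proof.
move=> [F [hC hF FP]]; exists (FNot F); split=> // [|M r]; first by constructor.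
by rewrite /= FP.
Qed.

Lemma sbdef_and n P Q : sb_definable n P -> sb_definable n Q ->
  sb_definable n (fun M r => P M r /\ Q M r).
Proof.
move=> [F [hC hF FP]] [F' [hC' hF' FP']]; exists (FAnd F F'); split.
- by constructor.
- by rewrite /= hF.
- by move=> M r; rewrite /= FP FP'.
Qed.

Lemma sbdef_or n P Q : sb_definable n P -> sb_definable n Q ->
  sb_definable n (fun M r => P M r \/ Q M r).
Proof.
move=> [F [hC hF FP]] [F' [hC' hF' FP']]; exists (FOr F F'); split.
- by constructor.
- by rewrite /= hF.
- by move=> M r; rewrite /= FP FP'.
Qed.

Lemma sbdef_imp n P Q : sb_definable n P -> sb_definable n Q ->
  sb_definable n (fun M r => P M r -> Q M r).
Proof.
move=> [F [hC hF FP]] [F' [hC' hF' FP']]; exists (FImp F F'); split.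
- by apply: SB_Or => //; exact: SB_Not.
- by rewrite /= hF.
- by move=> M r; rewrite sat_imp FP FP'.
Qed.

Lemma sbdef_ex n t (Q : forall M : structure, M -> (nat -> M) -> Prop) :
  term_definable n t -> sb_definable n.+1 (fun M r => Q M (r 0) (etl r)) ->
  sb_definable n (fun M r => exists x, subword x (t M r) /\ Q M x r).
Proof.
move=> [t' ht et] [F [hC hF FP]]; exists (ex_subword t' F); split.
- by constructor.
- exact: fscoped_ex_subword.
- move=> M r; rewrite et sat_ex_subword.
  by split=> -[x [hx hQ]]; exists x; split=> //; apply/(FP M (econs x r)).
Qed.

Lemma sbdef_all n t (Q : forall M : structure, M -> (nat -> M) -> Prop) :
  term_definable n t -> sb_definable n.+1 (fun M r => Q M (r 0) (etl r)) ->
  sb_definable n (fun M r => forall x, subword x (t M r) -> Q M x r).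
Proof.
move=> [t' ht et] [F [hC hF FP]]; exists (all_subword t' F); split.
- by constructor.
- exact: fscoped_all_subword.
- by move=> M r; rewrite et sat_all_subword; split=> h x hx;
    apply/(FP M (econs x r)); exact: h.
Qed.

Lemma sbdef_false n : sb_definable n (fun M r => False).
Proof.
apply: definable_ext (sbdef_not (sbdef_eq (tdef_eps n) (tdef_eps n))) _ => M r.
by split=> // h; exact: h.
Qed.

Lemma sbdef_in n (T : Type) (L : seq T) (P : T -> forall M : structure, (nat -> M) -> Prop) :
  (forall s, sb_definable n (P s)) ->
  sb_definable n (fun M r => exists2 s, List.In s L & P s M r).
Proof.
move=> hP; elim: L => [|s L IH].
  by apply: definable_ext (sbdef_false n) _ => M r; split=> // -[].
apply: definable_ext (sbdef_or (hP s) IH) _ => M r.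
split=> [[h|[u hu h]]|[u [->|hu] h]].
- by exists s => //; left.
- by exists u => //; right.
- by left.
- by right; exists u.
Qed.

Lemma S1def_sbdef n P : sb_definable n P -> definable Sigma1b n P.
Proof. by apply: definable_sub => F; exact: Sigma1b_base. Qed.

Lemma S1def_ex n t (Q : forall M : structure, M -> (nat -> M) -> Prop) :
  term_definable n t -> definable Sigma1b n.+1 (fun M r => Q M (r 0) (etl r)) ->
  definable Sigma1b n (fun M r => exists x,
    s_pre (s_times (s_bit true) x) (s_times (s_bit true) (t M r)) /\ Q M x r).
Proof.
move=> [t' ht et] [F [hC hF FP]]; exists (ex_le t' F); split.
- exact: Sigma1b_ex.
- by rewrite /= tscoped_tlift.
- by move=> M r; rewrite sat_ex_le et; split=> -[x hx]; exists x; move: hx; rewrite FP.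
Qed.

Ltac tdef_extension := fail.
Ltac tdef := lazy beta delta [etl];
  first [ by apply: tdef_var | exact: tdef_eps | exact: tdef_bit | exact: tdef_embed
        | apply: tdef_cat; tdef | apply: tdef_times; tdef | assumption | tdef_extension
        | match goal with H : term_definable _ ?f |- term_definable _ (fun M r => ?f M _) =>
            first [ exact (tdef_weaken 1 H) | exact (tdef_weaken 2 H) | exact (tdef_weaken 3 H)
                  | exact (tdef_weaken 4 H) | exact (tdef_weaken 5 H) ]
          end ].
Ltac sbdef := lazy beta;
  match goal with
  | |- sb_definable _ (fun M r => s_flip _) => apply: sbdef_flip; tdef
  | |- sb_definable _ (fun M r => s_pre _ _) => apply: sbdef_pre; tdef
  | |- sb_definable _ (fun M r => _ = _) => apply: sbdef_eq; tdef
  | |- sb_definable _ (fun M r => ~ _) => apply: sbdef_not; sbdef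
  | |- sb_definable _ (fun M r => _ /\ _) => apply: sbdef_and; sbdef
  | |- sb_definable _ (fun M r => _ \/ _) => apply: sbdef_or; sbdef
  | |- sb_definable _ (fun M r => exists x, subword x _ /\ _) => apply: sbdef_ex; [tdef|sbdef]
  | |- sb_definable _ (fun M r => forall x, subword x _ -> _) => apply: sbdef_all; [tdef|sbdef]
  | |- sb_definable _ (fun M r => exists2 s, List.In s _ & _) => apply: sbdef_in => ?; sbdef
  | |- sb_definable _ (fun M r => _ -> _) => apply: sbdef_imp; sbdef
  | _ => idtac
  end.

Lemma NIA_ind n P (M : NIA_model) (r : nat -> M) : definable Sigma1b n P ->
  P M (econs s_eps r) ->
  (forall x b, P M (econs x r) -> P M (econs (s_cat x (s_bit b)) r)) ->
  forall x, P M (econs x r).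
Proof.
move=> [F [hF _ FP]] h0 hS x; rewrite -FP.
have /sat_induction ind := (NIA_modelP M).2 _ r (NIA_induction hF).
apply: ind => [|y b]; first exact/FP.
by rewrite !FP; exact: hS.
Qed.

Lemma NIA_sb_ind n P (M : NIA_model) (r : nat -> M) : sb_definable n P ->
  P M (econs s_eps r) ->
  (forall x b, P M (econs x r) -> P M (econs (s_cat x (s_bit b)) r)) ->
  forall x, P M (econs x r).
Proof. by move=> /S1def_sbdef; exact: NIA_ind. Qed.

(** * Words inside a model *)

Declare Scope nia_scope.
Delimit Scope nia_scope with nia.
Notation "x ^^ y" := (s_cat x y) (at level 40, left associativity) : nia_scope.
Notation "x ** y" := (s_times x y) (at level 39, left associativity) : nia_scope.
Notation "x <=p y" := (s_pre x y) (at level 70) : nia_scope.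
Notation eps := s_eps.
Notation one := (s_bit true).
Notation len x := (s_times (s_bit true) x).
Local Open Scope nia_scope.

Section Arithmetic.
Variable M : NIA_model.
Implicit Types (x y z u v w l : M) (b c : bool).

Notation env0 := (fun _ : nat => (eps : M)).
Notation env1 a := (econs a env0).
Notation env2 a a' := (econs a (env1 a')).

Let strict := (NIA_modelP M).1.
Let NIA_axiom := (NIA_modelP M).2.

Lemma cat_eps x : x ^^ eps = x.
Proof. exact: strict (NIA_axiom (env1 x) NIA_cat_eps). Qed.

Lemma cat_snoc x y b : x ^^ (y ^^ s_bit b) = x ^^ y ^^ s_bit b.
Proof. exact: strict (NIA_axiom (env2 x y) (NIA_cat_bit b)). Qed.

Lemma times_eps x : x ** eps = eps.
Proof. exact: strict (NIA_axiom (env1 x) NIA_times_eps). Qed.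

Lemma times_snoc x y b : x ** (y ^^ s_bit b) = x ** y ^^ x.
Proof. exact: strict (NIA_axiom (env2 x y) (NIA_times_bit b)). Qed.

Lemma pre_eps x : x <=p eps <-> x = eps.
Proof.
have := NIA_axiom (env1 x) NIA_pre_eps; rewrite sat_iff /= => -> .
by split=> [/strict|->] //; exact: s_refl.
Qed.

Lemma pre_snoc x y b : x <=p y ^^ s_bit b <-> x <=p y \/ x = y ^^ s_bit b.
Proof.
have := NIA_axiom (env2 x y) (NIA_pre_bit b); rewrite sat_iff /= => ->.
split=> -[|e]; [by left|by right; exact: strict|by left|right; rewrite e].
exact: s_refl.
Qed.

Lemma snoc_inj x y b c : x ^^ s_bit b = y ^^ s_bit c -> x = y /\ b = c.
Proof.
have neq u v : u ^^ s_bit false = v ^^ s_bit true -> False.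
  by move=> e; apply: (NIA_axiom (env2 u v) NIA_bit_neq) => /=; rewrite e; exact: s_refl.
have inj b' : x ^^ s_bit b' = y ^^ s_bit b' -> x = y.
  move=> e; have := NIA_axiom (env2 x y) (NIA_bit_inj b'); rewrite sat_imp => h.
  by apply: strict; apply: h; rewrite /= e; exact: s_refl.
case: b; case: c => e.
- by split=> //; exact: inj e.
- by case: (neq _ _ (esym e)).
- by case: (neq _ _ e).
- by split=> //; exact: inj e.
Qed.

Lemma snoc_eps x b : x ^^ s_bit b <> eps.
Proof.
by move=> e; apply: (NIA_axiom (env1 x) (NIA_bit_eps b)) => /=; rewrite e; exact: s_refl.
Qed.

Lemma eps_cat x : eps ^^ x = x.
Proof.
apply: (NIA_sb_ind (n := 1) (P := fun M r => eps ^^ r 0 = r 0) (r := env0)).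
- by sbdef.
- exact: cat_eps.
- by move=> y b /= h; rewrite cat_snoc h.
Qed.

Lemma scatA x y z : x ^^ (y ^^ z) = x ^^ y ^^ z.
Proof.
apply: (NIA_sb_ind (n := 3) (P := fun M r => r 1 ^^ (r 2 ^^ r 0) = r 1 ^^ r 2 ^^ r 0)
  (r := env2 x y)).
- by sbdef.
- by rewrite /= !cat_eps.
- by move=> u b /= h; rewrite !cat_snoc h.
Qed.

Lemma pre_refl x : x <=p x.
Proof.
apply: (NIA_sb_ind (n := 1) (P := fun M r => r 0 <=p r 0) (r := env0)).
- by sbdef.
- by apply/pre_eps.
- by move=> y b /= h; apply/pre_snoc; right.
Qed.

Lemma eps_pre x : eps <=p x.
Proof.
apply: (NIA_sb_ind (n := 1) (P := fun M r => eps <=p r 0) (r := env0)).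
- by sbdef.
- by apply/pre_eps.
- by move=> y b /= h; apply/pre_snoc; left.
Qed.

Lemma pre_cat x y : x <=p x ^^ y.
Proof.
apply: (NIA_sb_ind (n := 2) (P := fun M r => r 1 <=p r 1 ^^ r 0) (r := env1 x)).
- by sbdef.
- by rewrite /= cat_eps; exact: pre_refl.
- by move=> u b /= h; rewrite cat_snoc; apply/pre_snoc; left.
Qed.

Lemma subword_cat x y z : subword y (x ^^ y ^^ z).
Proof. by exists x; split; last exact: pre_cat; rewrite -scatA; exact: pre_cat. Qed.

Lemma pre_catP x y : x <=p y -> exists z, y = x ^^ z.
Proof.
suff h : x <=p y -> exists z, subword z y /\ y = x ^^ z by move=> /h[z [_ ?]]; exists z.
apply: (NIA_sb_ind (n := 2) (P := fun M r => r 1 <=p r 0 ->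
  exists p, subword p (r 0) /\ r 0 = r 1 ^^ p) (r := env1 x) _ _ _ y).
- by sbdef.
- move=> /= /pre_eps ->; exists eps; rewrite cat_eps; split=> //.
  by have := subword_cat eps eps eps; rewrite !cat_eps.
- move=> u b /= h /pre_snoc[/h[z [_ ->]]|->].
    exists (z ^^ s_bit b); rewrite cat_snoc; split=> //.
    by have := subword_cat x (z ^^ s_bit b) eps; rewrite cat_eps cat_snoc.
  exists eps; rewrite cat_eps; split=> //.
  by have := subword_cat eps eps (u ^^ s_bit b); rewrite !eps_cat.
Qed.

Lemma pre_trans x y z : x <=p y -> y <=p z -> x <=p z.
Proof.
by move=> /pre_catP[u ->] /pre_catP[v ->]; rewrite -scatA; exact: pre_cat.
Qed.

Lemma pre_subword x y : x <=p y -> subword x y.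
Proof. by move=> h; exists eps; rewrite eps_cat; split=> //; exact: eps_pre. Qed.

Lemma subword_pre x y z : x <=p y -> subword y z -> subword x z.
Proof.
move=> /pre_catP[u ->] [w [wz wyz]]; exists w; split=> //.
by apply: pre_trans wyz; rewrite scatA; exact: pre_cat.
Qed.

Lemma subword_trans x y z : subword x y -> subword y z -> subword x z.
Proof.
move=> [w [wy wxy]] [w' [_ w'yz]]; exists (w' ^^ w); split.
  by apply: pre_trans w'yz; case/pre_catP: wy => u ->; rewrite scatA; exact: pre_cat.
apply: pre_trans w'yz; case/pre_catP: wxy => u ->; rewrite !scatA; exact: pre_cat.
Qed.

Lemma word_case x : x = eps \/ exists y b, x = y ^^ s_bit b.
Proof.
suff : x = eps \/ exists y, subword y x /\ (x = y ^^ s_bit false \/ x = y ^^ s_bit true).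
  by case=> [|[y [_ []]]]; [left|right; exists y, false|right; exists y, true].
apply: (NIA_sb_ind (n := 1) (P := fun M r => r 0 = eps \/ exists p, subword p (r 0) /\
  (r 0 = p ^^ s_bit false \/ r 0 = p ^^ s_bit true)) (r := env0) _ _ _ x).
- by sbdef.
- by left.
- move=> y b _; right; exists y => /=; split; last by case: b; [right|left].
  by apply: pre_subword; exact: pre_cat.
Qed.

Lemma len_eps : len eps = eps :> M.
Proof. exact: times_eps. Qed.

Lemma len_snoc x b : len (x ^^ s_bit b) = len x ^^ one.
Proof. exact: times_snoc. Qed.

Lemma len_bit b : len (s_bit b) = one :> M.
Proof. by rewrite -[s_bit b]eps_cat len_snoc len_eps eps_cat. Qed.

Lemma len_cat x y : len (x ^^ y) = len x ^^ len y.
Proof.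
apply: (NIA_sb_ind (n := 2) (P := fun M r => len (r 1 ^^ r 0) = len (r 1) ^^ len (r 0))
  (r := env1 x)).
- by sbdef.
- by rewrite /= len_eps !cat_eps.
- by move=> u b /= h; rewrite cat_snoc !len_snoc h scatA.
Qed.

Lemma one_lenC x : one ^^ len x = len x ^^ one.
Proof.
apply: (NIA_sb_ind (n := 1) (P := fun M r => one ^^ len (r 0) = len (r 0) ^^ one)
  (r := env0)).
- by sbdef.
- by rewrite /= len_eps cat_eps eps_cat.
- by move=> u b /= h; rewrite len_snoc scatA h.
Qed.

Lemma len_catC x y : len x ^^ len y = len y ^^ len x.
Proof.
apply: (NIA_sb_ind (n := 2) (P := fun M r => len (r 1) ^^ len (r 0) = len (r 0) ^^ len (r 1))
  (r := env1 x)).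
- by sbdef.
- by rewrite /= len_eps cat_eps eps_cat.
- by move=> u b /= h; rewrite len_snoc scatA h -!scatA one_lenC.
Qed.

Lemma len_len x : len (len x) = len x.
Proof.
apply: (NIA_sb_ind (n := 1) (P := fun M r => len (len (r 0)) = len (r 0))
  (r := env0)).
- by sbdef.
- by rewrite /= !len_eps.
- by move=> u b /= h; rewrite len_snoc len_snoc h.
Qed.

Lemma len_eq_eps x : len x = eps -> x = eps.
Proof. by case: (word_case x) => // -[y [b ->]]; rewrite len_snoc => /snoc_eps. Qed.

Lemma cat_injr x y z : x ^^ z = y ^^ z -> x = y.
Proof.
apply: (NIA_sb_ind (n := 3) (P := fun M r => r 1 ^^ r 0 = r 2 ^^ r 0 -> r 1 = r 2)
  (r := env2 x y)).
- by sbdef.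
- by rewrite /= !cat_eps.
- by move=> u b /= h; rewrite !cat_snoc => /snoc_inj[/h].
Qed.

Lemma cat_snoc_neq x y b : x ^^ (y ^^ s_bit b) <> x.
Proof.
suff h : len x ^^ (len y ^^ one) <> len x.
  by move=> e; apply: h; rewrite -[in RHS]e len_cat len_snoc.
apply: (NIA_sb_ind (n := 2) (P := fun M r => len (r 0) ^^ (len (r 1) ^^ one) <> len (r 0))
  (r := env1 y)).
- by sbdef.
- by rewrite /= len_eps eps_cat => /snoc_eps.
- move=> u c /= h; rewrite len_snoc scatA => /snoc_inj[e _]; apply: h.
  by rewrite -one_lenC scatA.
Qed.

Lemma cat_injl z x y : z ^^ x = z ^^ y -> x = y.
Proof.
suff h : forall y', subword y' y -> z ^^ x = z ^^ y' -> x = y'.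
  by apply: h; apply: pre_subword; exact: pre_refl.
apply: (NIA_sb_ind (n := 3) (P := fun M r => forall p, subword p (r 1) ->
   r 2 ^^ r 0 = r 2 ^^ p -> r 0 = p) (r := env2 y z) _ _ _ x).
- by sbdef.
- move=> /= y' _; rewrite cat_eps; case: (word_case y') => // -[u [b ->]] e.
  by case: (@cat_snoc_neq z u b).
- move=> u b /= h y' hy'; case: (word_case y') => [->|[u' [b' e]]].
    by rewrite cat_eps => /cat_snoc_neq.
  rewrite e !cat_snoc => /snoc_inj[e1 ->]; rewrite (h u') //.
  by apply: subword_pre hy'; rewrite e; exact: pre_cat.
Qed.

Lemma cat_eps_l x y : x ^^ y = x -> y = eps.
Proof. by move=> e; apply: (@cat_injl x); rewrite cat_eps. Qed.

Lemma cat_eq_eps x y : x ^^ y = eps -> x = eps /\ y = eps.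
Proof.
case: (word_case y) => [->|[u [b ->]]]; first by rewrite cat_eps.
by rewrite cat_snoc => /snoc_eps.
Qed.

Lemma pre_anti x y : x <=p y -> y <=p x -> x = y.
Proof.
move=> /pre_catP[u ->] /pre_catP[v]; rewrite -scatA => /esym/cat_eps_l/cat_eq_eps[-> _].
by rewrite cat_eps.
Qed.

Lemma pre_len x y : x <=p y -> len x <=p len y.
Proof. by move=> /pre_catP[u ->]; rewrite len_cat; exact: pre_cat. Qed.

Lemma pre_total x y z : x <=p z -> y <=p z -> x <=p y \/ y <=p x.
Proof.
apply: (NIA_sb_ind (n := 3) (P := fun M r => r 1 <=p r 0 -> r 2 <=p r 0 ->
   r 1 <=p r 2 \/ r 2 <=p r 1) (r := env2 x y)).
- by sbdef.
- by move=> /= /pre_eps -> _; left; exact: eps_pre.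
- move=> u b /= h /pre_snoc[hx|hx] /pre_snoc[hy|hy]; first exact: h.
  + by left; rewrite hy; apply/pre_snoc; left.
  + by right; rewrite hx; apply/pre_snoc; left.
  + by left; rewrite hx hy; exact: pre_refl.
Qed.

Lemma pre_of_len x y z : x <=p z -> y <=p z -> len x <=p len y -> x <=p y.
Proof.
move=> hx hy hl; case: (pre_total hx hy) => // yx.
have /pre_catP[u eu] := yx; have e := pre_anti hl (pre_len yx).
move: e; rewrite eu len_cat => /cat_eps_l/len_eq_eps ->.
by rewrite cat_eps; exact: pre_refl.
Qed.

Lemma pre_eq_len x y z : x <=p z -> y <=p z -> len x = len y -> x = y.
Proof.
by move=> hx hy e; apply: pre_anti; apply: (@pre_of_len _ _ z) => //; rewrite e;
  exact: pre_refl.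
Qed.

Lemma scat_inj x y x' y' : x ^^ y = x' ^^ y' -> len x = len x' -> x = x' /\ y = y'.
Proof.
move=> e el; have ex : x = x'.
  apply: (@pre_eq_len _ _ (x ^^ y)) => //; first exact: pre_cat.
  by rewrite e; exact: pre_cat.
by split=> //; move: e; rewrite ex => /cat_injl.
Qed.

Lemma prefix_of_len x u : u <=p len x -> exists2 v, v <=p x & len v = u.
Proof.
suff h : u <=p len x -> exists v, subword v x /\ (v <=p x /\ len v = u).
  by move=> /h[v [_ []]]; exists v.
apply: (NIA_sb_ind (n := 2) (P := fun M r => r 1 <=p len (r 0) ->
  exists p, subword p (r 0) /\ (p <=p r 0 /\ len p = r 1)) (r := env1 u) _ _ _ x).
- by sbdef.
- move=> /=; rewrite len_eps => /pre_eps ->; exists eps; rewrite len_eps.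
  by split; [apply: pre_subword|split=> //]; exact: pre_refl.
- move=> y b /= h; rewrite len_snoc => /pre_snoc[/h[v [_ [hv <-]]]|->].
    have hv' : v <=p y ^^ s_bit b by apply: pre_trans hv _; exact: pre_cat.
    by exists v; split=> //; exact: pre_subword.
  exists (y ^^ s_bit b); rewrite len_snoc.
  by split; [apply: pre_subword|split=> //]; exact: pre_refl.
Qed.

Lemma scat_split u x y : len u = len x ^^ len y ->
  exists v w, [/\ u = v ^^ w, len v = len x & len w = len y].
Proof.
move=> e; have : len x <=p len u by rewrite e; exact: pre_cat.
move=> /prefix_of_len[v /pre_catP[w ew] ev]; exists v, w; split=> //.
by move: e; rewrite ew len_cat ev => /cat_injl.
Qed.

Lemma pre_tally x u : u <=p len x -> len u = u.
Proof. by move=> /prefix_of_len[v _ <-]; exact: len_len. Qed.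

Lemma times_cat l x y : l ** (x ^^ y) = l ** x ^^ l ** y.
Proof.
apply: (NIA_sb_ind (n := 3) (P := fun M r => r 1 ** (r 2 ^^ r 0) = r 1 ** r 2 ^^ r 1 ** r 0)
  (r := env2 l x)).
- by sbdef.
- by rewrite /= times_eps !cat_eps.
- by move=> u b /= h; rewrite cat_snoc !times_snoc h scatA.
Qed.

Lemma len_times l x : len (l ** x) = len l ** x.
Proof.
apply: (NIA_sb_ind (n := 2) (P := fun M r => len (r 1 ** r 0) = len (r 1) ** r 0)
  (r := env1 l)).
- by sbdef.
- by rewrite /= !times_eps.
- by move=> u b /= h; rewrite !times_snoc len_cat h.
Qed.

Lemma times_pre l x y : x <=p y -> l ** x <=p l ** y.
Proof. by move=> /pre_catP[u ->]; rewrite times_cat; exact: pre_cat. Qed.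

Lemma times_bit l b : l ** s_bit b = l.
Proof. by rewrite -[s_bit b]eps_cat times_snoc times_eps eps_cat. Qed.

Lemma embed_cat s s' : embed M (s ++ s') = embed M s ^^ embed M s'.
Proof.
rewrite /embed foldl_cat; elim/last_ind: s' => [|s' b IH] /=; first by rewrite cat_eps.
by rewrite !foldl_rcons IH cat_snoc.
Qed.

Lemma embed_bit b : embed M [:: b] = s_bit b.
Proof. exact: eps_cat. Qed.

Lemma len_embed s : len (embed M s) = embed M (nseq (size s) true).
Proof.
elim: s => [|b s IH]; first exact: len_eps.
by rewrite -cat1s embed_cat len_cat embed_bit len_bit IH -embed_bit -embed_cat.
Qed.

Lemma embed_of_len x s : len x = len (embed M s) -> exists2 s', size s' = size s & x = embed M s'.
Proof.
elim/last_ind: s x => [|s b IH] x.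
  by rewrite len_eps => /len_eq_eps ->; exists [::].
rewrite -cats1 embed_cat embed_bit len_snoc.
case: (word_case x) => [->|[y [c ->]]]; first by rewrite len_eps => /esym/snoc_eps.
rewrite len_snoc => /snoc_inj[/IH[s' e ->] _]; exists (s' ++ [:: c]).
  by rewrite !size_cat e.
by rewrite embed_cat embed_bit.
Qed.

Lemma ones_prefix x : exists v, [/\ len v = v, v <=p x & ~ v ^^ one <=p x].
Proof.
suff : exists v, subword v x /\ (v <=p x /\ (len v = v /\ ~ v ^^ one <=p x)).
  by move=> [v [_ [vx [lv v_max]]]]; exists v.
apply: (NIA_sb_ind (n := 1) (P := fun M r => exists p, subword p (r 0) /\
  (p <=p r 0 /\ (len p = p /\ ~ p ^^ one <=p r 0))) (r := env0) _ _ _ x).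
- by sbdef.
- exists eps => /=; rewrite len_eps; split; first by apply: pre_subword; exact: pre_refl.
  split; first exact: pre_refl.
  by split=> // /pre_eps/snoc_eps.
- move=> y b /= [v [_ [vy [lv v_max]]]].
  have vyb : v <=p y ^^ s_bit b by apply: pre_trans vy _; exact: pre_cat.
  have [/[dup] e|ne] := pselect (v ^^ one = y ^^ s_bit b); last first.
    exists v; split; first exact: pre_subword.
    by split=> //; split=> // /pre_snoc[].
  move=> <-; exists (v ^^ one); split; first by apply: pre_subword; exact: pre_refl.
  split; first exact: pre_refl; split; first by rewrite len_snoc lv.
  move=> /pre_catP[u] /esym; rewrite -!scatA => /cat_injl.
  by move=> /cat_eps_l/cat_eq_eps[]; rewrite -[one]eps_cat => /snoc_eps.
Qed.

End Arithmetic.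

(** * The standard model *)

Definition std (w : word -> bool) : structure :=
  strict_structure ([::] : word) (fun b => [:: b]) (fun x y => x ++ y)
    (fun x y => flatten (nseq (size y) x)) (fun x y => prefix x y) (fun x => w x = true).

Lemma teval_std w (r : nat -> word) t : teval r t = seval (M := std w) r t.
Proof. by elim: t => //= [t -> s ->|t -> s ->]. Qed.

Lemma holds_std w (r : nat -> word) F : holds w r F <-> sat (M := std w) r F.
Proof.
elim: F r => [t|t s|t s|A IA|A IA B IB|A IA B IB|A IA|A IA] r /=;
  rewrite -?teval_std ?IA ?IB //.
- by split=> -[s hs]; exists s; exact/(IA (scons s r)).
- by split=> h s; exact/(IA (scons s r)).
Qed.

Lemma prefix_rconsE (x y : word) b : prefix x (rcons y b) = prefix x y || (x == rcons y b).
Proof.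
by elim: y x => [|c y IH] [|a x] //=; rewrite eqseq_cons IH; case: eqP.
Qed.

Lemma std_NIA w : model NIA (std w).
Proof.
split=> [x y|A r]; first exact.
case=> {A} [x|b x y|x|b x y|x|b x y|b x y|x y|b x|B x _].
- exact: cats0.
- by move=> /=; rewrite catA.
- by [].
- by move=> /=; rewrite size_cat nseqD flatten_cat /= cats0.
- by rewrite sat_iff /=; case: (r 0).
- rewrite sat_iff /= cats1 prefix_rconsE.
  by split=> [/orP[->|/eqP ->]|[->|->]]; [left|right|by []|rewrite eqxx orbT].
- by rewrite sat_imp /= !cats1 => /rcons_inj[].
- by rewrite /= !cats1 => /rcons_inj[].
- by rewrite /=; case: (r 0).
- rewrite sat_induction => h0 hS; elim/last_ind => // s b.
  by rewrite -cats1; exact: hS.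
Qed.

Canonical std_NIA_model w := NIAModel (std_NIA w).

Lemma embed_std w s : embed (std w) s = s.
Proof. by elim/last_ind: s => // s b IH; rewrite /embed foldl_rcons -/(embed _ _) IH /= cats1. Qed.

Lemma numeral_std w (r : nat -> word) s : seval (M := std w) r (numeral s) = s.
Proof.
by elim/last_ind: s => // s b IH; rewrite /numeral foldl_rcons /= -/(numeral s) IH cats1.
Qed.

(** * Histories of a block machine inside a model *)

(* A plane lists one bit field of all cells of a cyclic tape, beginning with the scanned cell
   [a] and ending with its left neighbour [b]. *)
Definition rotate_plane (M : structure) (mv : move) (a Y b : M) : M :=
  match mv with
  | MoveN => a ^^ Y ^^ b
  | MoveR => Y ^^ b ^^ a
  | MoveL => b ^^ a ^^ Y
  end.

Lemma tdef_rotate_plane n mv f g h :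
  term_definable n f -> term_definable n g -> term_definable n h ->
  term_definable n (fun M r => rotate_plane mv (f M r) (g M r) (h M r)).
Proof. by move=> hf hg hh; case: mv; do 2 apply: tdef_cat => //. Qed.

Ltac tdef_extension ::= apply: tdef_rotate_plane; tdef.

Lemma In_enum (T : finType) (x : T) : List.In x (enum T).
Proof.
have : x \in enum T by rewrite mem_enum.
by elim: (enum T) => // y s IH; rewrite inE => /orP[/eqP->|/IH]; [left|right].
Qed.

Section BlockMachine.
Variables nq nw : nat.

(* Two one-bit fields (is the symbol a bit, and its value) and [nw] bits for a working symbol. *)
Definition block_cell : Type := (1.-tuple bool * 1.-tuple bool * nw.-tuple bool)%type.

Variable trans : bool -> nq.-tuple bool -> block_cell -> nq.-tuple bool * block_cell * move.

(* State, scanned cell, left neighbour *)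
Definition window : Type := (nq.-tuple bool * block_cell * block_cell)%type.

Definition state_len (M : structure) : M := embed M (nseq nq true).
Definition work_len (M : structure) : M := embed M (nseq nw true).

Definition block_len (M : structure) (n1 n3 : M) : M :=
  state_len M ^^ (one ^^ n1 ^^ one) ^^ (one ^^ n1 ^^ one) ^^ (work_len M ^^ n3 ^^ work_len M).

Definition block_of (M : structure) (u : nq.-tuple bool) (mv : move) (a b : block_cell)
    (Y1 Y2 Y3 : M) : M :=
  embed M u ^^ rotate_plane mv (embed M a.1.1) Y1 (embed M b.1.1) ^^
               rotate_plane mv (embed M a.1.2) Y2 (embed M b.1.2) ^^
               rotate_plane mv (embed M a.2) Y3 (embed M b.2).

Definition next_block (M : structure) c (d : window) (Y1 Y2 Y3 : M) : M :=
  let: (u, a, mv) := trans c d.1.1 d.1.2 in block_of u mv a d.2 Y1 Y2 Y3.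

Definition block_step (M : structure) (n1 n3 i B B' : M) : Prop :=
  exists2 d : window, List.In d (enum {: window}) &
  exists Y1, subword Y1 B /\ exists Y2, subword Y2 B /\ exists Y3, subword Y3 B /\
   (len Y1 = n1 /\ (len Y2 = n1 /\ (len Y3 = n3 /\
    (B = block_of d.1.1 MoveN d.1.2 d.2 Y1 Y2 Y3 /\
     ((s_flip i /\ B' = next_block true d Y1 Y2 Y3) \/
      (~ s_flip i /\ B' = next_block false d Y1 Y2 Y3)))))).

Definition history (M : structure) (n1 n3 B0 i z : M) : Prop :=
  len z = block_len n1 n3 ** (i ^^ one) /\ (B0 <=p z /\
  forall j, subword j i -> j ^^ one <=p i -> forall w, subword w z ->
  forall B, subword B z -> forall B', subword B' z -> w ^^ B ^^ B' <=p z ->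
  len w = block_len n1 n3 ** j -> len B = block_len n1 n3 -> len B' = block_len n1 n3 ->
  block_step n1 n3 j B B').

Definition history_output (M : structure) (n1 n3 z y : M) : Prop :=
  exists w, subword w z /\ exists U, subword U z /\ exists P1, subword P1 z /\
  exists P2, subword P2 z /\ exists P3, subword P3 z /\
   (z = w ^^ (U ^^ P1 ^^ P2 ^^ P3) /\ (len U = state_len M /\ (len P1 = one ^^ n1 ^^ one /\
   (len P2 = one ^^ n1 ^^ one /\ (len P3 = work_len M ^^ n3 ^^ work_len M /\
   (y <=p P2 /\ (len y <=p P1 /\ ~ len y ^^ one <=p P1))))))).

Lemma sbdef_block_step n f1 f3 fi fB fB' : term_definable n f1 -> term_definable n f3 ->
  term_definable n fi -> term_definable n fB -> term_definable n fB' ->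
  sb_definable n (fun M r => block_step (f1 M r) (f3 M r) (fi M r) (fB M r) (fB' M r)).
Proof.
move=> *; apply: sbdef_in => d; rewrite /next_block.
by case: (trans true _ _) (trans false _ _) => [[u a] mv] [[u' a'] mv']; rewrite /block_of; sbdef.
Qed.

Lemma tdef_block_len n f1 f3 : term_definable n f1 -> term_definable n f3 ->
  term_definable n (fun M r => block_len (f1 M r) (f3 M r)).
Proof. by move=> *; rewrite /block_len /state_len /work_len; tdef. Qed.

Lemma sbdef_history n f1 f3 f0 fi fz : term_definable n f1 -> term_definable n f3 ->
  term_definable n f0 -> term_definable n fi -> term_definable n fz ->
  sb_definable n (fun M r => history (f1 M r) (f3 M r) (f0 M r) (fi M r) (fz M r)).
Proof.
by move=> *; rewrite /history /block_len /state_len /work_len; sbdef; apply: sbdef_block_step; tdef.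
Qed.

Lemma sbdef_history_output n f1 f3 fz fy : term_definable n f1 -> term_definable n f3 ->
  term_definable n fz -> term_definable n fy ->
  sb_definable n (fun M r => history_output (f1 M r) (f3 M r) (fz M r) (fy M r)).
Proof. by move=> *; rewrite /history_output /state_len /work_len; sbdef. Qed.

Section InModel.
Variable M : NIA_model.
Variables n1 n3 : M.
Hypotheses (n1_tally : len n1 = n1) (n3_tally : len n3 = n3).
Notation L := (block_len n1 n3).

Lemma embed_inj s s' : embed M s = embed M s' -> s = s'.
Proof.
elim/last_ind: s s' => [|s b IH] s'; case/lastP: s' => [|s' b'] //;
  rewrite /embed !foldl_rcons -!/(embed M _).
- by move=> /esym/snoc_eps.
- by move=> /snoc_eps.
- by move=> /snoc_inj[/IH -> ->].
Qed.

Lemma len_embed_tuple k (t : k.-tuple bool) : len (embed M t) = embed M (nseq k true).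
Proof. by rewrite len_embed size_tuple. Qed.

Lemma len_embed_nseq k b : len (embed M (nseq k b)) = embed M (nseq k true).
Proof. by rewrite len_embed size_nseq. Qed.

Lemma embed_nseq1 : embed M (nseq 1 true) = one.
Proof. exact: embed_bit. Qed.

Lemma tally_split (u x y : M) : len u = x ^^ y -> len x = x -> len y = y ->
  exists v w : M, [/\ u = v ^^ w, len v = x & len w = y].
Proof.
move=> e ex ey; move: e; rewrite -{1}ex -{1}ey => /scat_split[v [w [-> ev ew]]].
by exists v, w; rewrite ev ew.
Qed.

Lemma len_work_plane : len (work_len M ^^ n3 ^^ work_len M) = work_len M ^^ n3 ^^ work_len M.
Proof. by rewrite !len_cat !len_embed_nseq n3_tally. Qed.

Lemma len_bit_plane : len (one ^^ n1 ^^ one) = one ^^ n1 ^^ one.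
Proof. by rewrite !len_cat !len_bit n1_tally. Qed.

Lemma len_state_len : len (state_len M) = state_len M.
Proof. exact: len_embed_nseq. Qed.

Lemma len_block_len : len L = L.
Proof.
by rewrite /block_len len_cat len_work_plane !(len_cat _ (one ^^ n1 ^^ one)) len_state_len
  !len_bit_plane.
Qed.

Lemma plane_split k n P : len n = n ->
  len P = embed M (nseq k true) ^^ n ^^ embed M (nseq k true) ->
  exists (a b : k.-tuple bool) (Y : M), P = embed M a ^^ Y ^^ embed M b /\ len Y = n.
Proof.
move=> hn /tally_split[].
- by rewrite len_cat len_embed_nseq hn.
- exact: len_embed_nseq.
move=> v [w [-> /tally_split[]//]]; first exact: len_embed_nseq.
have to_tuple x : len x = embed M (nseq k true) -> exists t : k.-tuple bool, x = embed M t.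
  rewrite -(len_embed_nseq k true) => /embed_of_len[s]; rewrite size_nseq => es ->.
  by exists (tcast es (in_tuple s)); rewrite val_tcast.
move=> a [Y [-> /to_tuple[ta ->] hY]] /to_tuple[tb ->].
by exists ta, tb, Y.
Qed.

Lemma plane_inj k (a b a' b' : k.-tuple bool) (Y Y' : M) :
  embed M a ^^ Y ^^ embed M b = embed M a' ^^ Y' ^^ embed M b' -> len Y = len Y' ->
  [/\ a = a', b = b' & Y = Y'].
Proof.
move=> e el; have [|e1 /embed_inj/val_inj ->] := scat_inj e.
  by rewrite !len_cat el !len_embed_tuple.
by have [|/embed_inj/val_inj -> ->] := scat_inj e1; rewrite ?len_embed_tuple.
Qed.

Lemma block_split B : len B = L -> exists U P1 P2 P3 : M, [/\ B = U ^^ P1 ^^ P2 ^^ P3,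
  len U = state_len M, len P1 = one ^^ n1 ^^ one, len P2 = one ^^ n1 ^^ one &
  len P3 = work_len M ^^ n3 ^^ work_len M].
Proof.
have len_cat_tally (x y : M) : len x = x -> len y = y -> len (x ^^ y) = x ^^ y.
  by move=> ex ey; rewrite len_cat ex ey.
move=> /tally_split[]; rewrite ?len_work_plane //.
  by do 2 rewrite len_cat_tally ?len_state_len ?len_bit_plane //.
move=> x [P3 [-> /tally_split[]]]; rewrite ?len_bit_plane //.
  by rewrite len_cat_tally ?len_state_len ?len_bit_plane.
move=> y [P2 [-> /tally_split[]]]; rewrite ?len_bit_plane ?len_state_len //.
by move=> U [P1 [-> *]]; exists U, P1, P2, P3.
Qed.

Lemma block_inj (U P1 P2 P3 U' P1' P2' P3' : M) :
  U ^^ P1 ^^ P2 ^^ P3 = U' ^^ P1' ^^ P2' ^^ P3' ->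
  len U = len U' -> len P1 = len P1' -> len P2 = len P2' ->
  [/\ U = U', P1 = P1', P2 = P2' & P3 = P3'].
Proof.
move=> e e0 e1 e2.
have [|{}e ->] := scat_inj e; first by rewrite !len_cat e0 e1 e2.
have [|{}e ->] := scat_inj e; first by rewrite !len_cat e0 e1.
by have [|-> ->] := scat_inj e.
Qed.

Lemma block_stepI i B B' c d Y1 Y2 Y3 : len Y1 = n1 -> len Y2 = n1 -> len Y3 = n3 ->
  B = block_of d.1.1 MoveN d.1.2 d.2 Y1 Y2 Y3 -> (s_flip i <-> c = true) ->
  B' = next_block c d Y1 Y2 Y3 -> block_step n1 n3 i B B'.
Proof.
move=> l1 l2 l3 eB flipE eB'; exists d; first exact: In_enum.
exists Y1; split.
  have := subword_cat (embed M d.1.1 ^^ embed M d.1.2.1.1) Y1 (embed M d.2.1.1 ^^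
    (embed M d.1.2.1.2 ^^ Y2 ^^ embed M d.2.1.2) ^^ (embed M d.1.2.2 ^^ Y3 ^^ embed M d.2.2)).
  by rewrite eB /block_of /= !scatA.
exists Y2; split.
  have := subword_cat (embed M d.1.1 ^^ (embed M d.1.2.1.1 ^^ Y1 ^^ embed M d.2.1.1) ^^
    embed M d.1.2.1.2) Y2 (embed M d.2.1.2 ^^ (embed M d.1.2.2 ^^ Y3 ^^ embed M d.2.2)).
  by rewrite eB /block_of /= !scatA.
exists Y3; split.
  have := subword_cat (embed M d.1.1 ^^ (embed M d.1.2.1.1 ^^ Y1 ^^ embed M d.2.1.1) ^^
    (embed M d.1.2.1.2 ^^ Y2 ^^ embed M d.2.1.2) ^^ embed M d.1.2.2) Y3 (embed M d.2.2).
  by rewrite eB /block_of /= !scatA.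
do 4 split=> //; case: c flipE eB' => flipE ->; first by left; split=> //; apply/flipE.
by right; split=> // /flipE.
Qed.

Lemma block_step_total i B : len B = L -> exists B', block_step n1 n3 i B B'.
Proof.
move=> /block_split[U [P1 [P2 [P3 [eB hU h1 h2 h3]]]]].
have [u eU] : exists u : nq.-tuple bool, U = embed M u.
  move: hU; rewrite -len_state_len => /embed_of_len[s]; rewrite size_nseq => es ->.
  by exists (tcast es (in_tuple s)); rewrite val_tcast.
have bit_plane_split P : len P = one ^^ n1 ^^ one -> exists (a b : 1.-tuple bool) (Y : M),
    P = embed M a ^^ Y ^^ embed M b /\ len Y = n1.
  by move=> h; apply: plane_split => //; rewrite embed_nseq1.
have [a1 [b1 [Y1 [e1 l1]]]] := bit_plane_split _ h1.
have [a2 [b2 [Y2 [e2 l2]]]] := bit_plane_split _ h2.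
have [a3 [b3 [Y3 [e3 l3]]]] := plane_split n3_tally h3.
pose d : window := (u, ((a1, a2), a3), ((b1, b2), b3)).
have eB' : B = block_of d.1.1 MoveN d.1.2 d.2 Y1 Y2 Y3 by rewrite eB eU e1 e2 e3.
exists (next_block `[< s_flip i >] d Y1 Y2 Y3).
by apply: (block_stepI l1 l2 l3 eB') => //; split=> /asboolP.
Qed.

Lemma block_step_functional i B B1 B2 :
  block_step n1 n3 i B B1 -> block_step n1 n3 i B B2 -> B1 = B2.
Proof.
move=> [d _ [Y1 [_ [Y2 [_ [Y3 [_ [l1 [l2 [l3 [eB h]]]]]]]]]]].
move=> [d' _ [Y1' [_ [Y2' [_ [Y3' [_ [l1' [l2' [l3' [eB' h']]]]]]]]]]].
have [| | |eu e1 e2 e3] := block_inj (etrans (esym eB) eB').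
- by rewrite !len_embed_tuple.
- by rewrite /= !len_cat !len_embed_tuple l1 l1'.
- by rewrite /= !len_cat !len_embed_tuple l2 l2'.
have [] := plane_inj e1 (etrans l1 (esym l1')).
have [] := plane_inj e2 (etrans l2 (esym l2')).
have [] := plane_inj e3 (etrans l3 (esym l3')).
move: eu => /embed_inj/val_inj.
case: d {eB e1 e2 e3} h => [[u [[a1 a2] a3]] [[b1 b2] b3]].
case: d' {eB'} h' => [[u' [[a1' a2'] a3']] [[b1' b2'] b3']] /= h' h.
move=> eu ea3 eb3 eY3 ea2 eb2 eY2 ea1 eb1 eY1; subst.
by case: h => [[f ->]|[nf ->]]; case: h' => [[f' ->]|[nf' ->]].
Qed.

Lemma len_rotate_plane k mv (a b : k.-tuple bool) (Y : M) :
  len (rotate_plane mv (embed M a) Y (embed M b)) =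
  embed M (nseq k true) ^^ len Y ^^ embed M (nseq k true).
Proof.
case: mv; rewrite /= !len_cat !len_embed_tuple // -(len_embed_nseq k true).
  by rewrite -!scatA (len_catC _ Y).
by rewrite (len_catC Y).
Qed.

Lemma len_block_step i B B' : block_step n1 n3 i B B' -> len B' = L.
Proof.
have len_next c d Y1 Y2 Y3 : len Y1 = n1 -> len Y2 = n1 -> len Y3 = n3 ->
    len (next_block c d Y1 Y2 Y3) = L.
  move=> l1 l2 l3; rewrite /next_block; case: (trans _ _ _) => [[u a] mv].
  by rewrite /block_of !len_cat len_embed_tuple !len_rotate_plane l1 l2 l3 !embed_nseq1.
move=> [d _ [Y1 [_ [Y2 [_ [Y3 [_ [l1 [l2 [l3 [_ h]]]]]]]]]]].
by case: h => -[_ ->]; exact: len_next.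
Qed.

Variable B0 : M.
Hypothesis len_B0 : len B0 = L.
Notation history_of := (history n1 n3 B0).

Lemma tally_snoc_pre (i j : M) : len i = i -> len j = j -> j <=p i -> j ^^ one <=p i ^^ one.
Proof.
move=> hi hj /pre_catP[u eu]; rewrite -hi -hj -!one_lenC hi hj eu scatA.
exact: pre_cat.
Qed.

Lemma subword_catl (t u z : M) : t ^^ u <=p z -> subword u z.
Proof.
move=> h; apply: subword_trans (pre_subword h).
by have := subword_cat t u eps; rewrite cat_eps.
Qed.

Lemma history_step_at i z j : history_of i z -> len i = i -> len j = j -> j ^^ one <=p i ->
  exists w B B', [/\ w ^^ B ^^ B' <=p z, len w = L ** j, len B = L, len B' = L &
                     block_step n1 n3 j B B'].
Proof.
move=> [lz [_ steps]] hi hj ji.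
have [|v vz lv] := prefix_of_len (x := z) (u := L ** (j ^^ one ^^ one)).
  by rewrite lz; apply: times_pre; apply: tally_snoc_pre => //; rewrite len_snoc hj.
have : len v = L ** (j ^^ one) ^^ L by rewrite lv (times_snoc _ (j ^^ one)).
move=> /tally_split[]; rewrite ?len_times ?len_block_len // => w1 [B' [ev lw1 lB']].
have := lw1; rewrite times_snoc => /tally_split[]; rewrite ?len_times ?len_block_len //.
move=> w [B [ew1 lw lB]]; rewrite ev ew1 in vz.
have wBz : w ^^ B <=p z by apply: pre_trans vz; exact: pre_cat.
exists w, B, B'; split=> //; apply: (steps j _ ji w) => //.
- by apply: pre_subword; apply: pre_trans ji; exact: pre_cat.
- by apply: pre_subword; apply: pre_trans wBz; exact: pre_cat.
- exact: subword_catl wBz.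
- exact: subword_catl vz.
Qed.

Lemma history_eps : history_of eps B0.
Proof.
split; first by rewrite eps_cat times_bit.
split; first exact: pre_refl.
by move=> j _ /pre_eps/snoc_eps.
Qed.

Lemma history_snoc i w B B' : len i = i -> len w = L ** i -> len B = L ->
  history_of i (w ^^ B) -> block_step n1 n3 i B B' -> history_of (i ^^ one) (w ^^ B ^^ B').
Proof.
move=> hi lw lB hz hB'; have lB' := len_block_step hB'; have [lz [B0z _]] := hz.
split; first by rewrite len_cat lz lB' (times_snoc _ (i ^^ one)).
split; first by apply: pre_trans B0z _; exact: pre_cat.
move=> j hj ji w1 _ B1 _ B1' _ hpre lw1 lB1 lB1'.
have lp : len (w1 ^^ B1 ^^ B1') = L ** (j ^^ one ^^ one).
  by rewrite !len_cat lw1 lB1 lB1' !times_snoc.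
case/pre_snoc : ji => [ji|/snoc_inj[ej _]].
  have lj : len j = j.
    by apply: (pre_tally (x := i)); rewrite hi; apply: pre_trans ji; exact: pre_cat.
  have [w2 [B2 [B2' [hpre2 lw2 lB2 lB2' st]]]] := history_step_at hz hi lj ji.
  have e : w1 ^^ B1 ^^ B1' = w2 ^^ B2 ^^ B2'.
    apply: (pre_eq_len hpre); first by apply: pre_trans hpre2 _; exact: pre_cat.
    by rewrite lp !len_cat lw2 lB2 lB2' !times_snoc.
  have [|{}e ->] := scat_inj e; first by rewrite !len_cat lw1 lw2 lB1 lB2.
  by have [|_ ->] := scat_inj e; rewrite ?lw1 ?lw2.
have e : w1 ^^ B1 ^^ B1' = w ^^ B ^^ B'.
  apply: (pre_eq_len hpre); first exact: pre_refl.
  by rewrite lp ej len_cat lz lB' (times_snoc _ (i ^^ one)).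
have [|{}e ->] := scat_inj e; first by rewrite !len_cat lw1 lw lB1 lB ej.
by have [|_ ->] := scat_inj e; rewrite ?lw1 ?lw ej.
Qed.

Lemma history_bound i z : history_of i z -> len z <=p L ** (i ^^ one).
Proof. by move=> [-> _]; exact: pre_refl. Qed.

Lemma history_exists x : exists z, history_of (len x) z.
Proof.
suff [z [_ h]] : exists z, len z <=p len (L ** (len x ^^ one)) /\ history_of (len x) z by exists z.
have S1def_bounded_history : definable Sigma1b 4 (fun M r => exists z,
    len z <=p len (block_len (r 1) (r 2) ** (len (r 0) ^^ one)) /\
    history (r 1) (r 2) (r 3) (len (r 0)) z).
  apply: S1def_ex; first by apply: tdef_times; [apply: tdef_block_len; tdef|tdef].
  by apply: S1def_sbdef; apply: sbdef_history; tdef.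
apply: (NIA_ind (r := econs n1 (econs n3 (econs B0 (fun _ => eps)))) S1def_bounded_history _ _ x).
  exists B0; rewrite /= len_times len_block_len len_eps.
  by split; [apply: history_bound|]; exact: history_eps.
move=> y b /= [z [_ hz]]; rewrite len_snoc; have ly : len (len y) = len y := len_len y.
have := hz.1; rewrite times_snoc => /tally_split[]; rewrite ?len_times ?len_block_len //.
move=> w [B [ez lw lB]]; have [B' hB'] := block_step_total (len y) lB.
have hz' : history_of (len y ^^ one) (z ^^ B') by rewrite ez in hz *; exact: history_snoc.
by exists (z ^^ B'); split=> //; exact: history_bound.
Qed.

Lemma history_unique x z z' : history_of (len x) z -> history_of (len x) z' -> z = z'.
Proof.
set i := len x => hz hz'; have [lz [B0z _]] := hz; have [lz' [B0z' _]] := hz'.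
have hi : len i = i by exact: len_len.
suff prefixes_agree y : len y <=p i -> forall w, subword w z -> w <=p z ->
    len w = L ** (len y ^^ one) -> w <=p z'.
  apply: (pre_eq_len (z := z')); [|exact: pre_refl|by rewrite lz lz'].
  apply: (prefixes_agree i); rewrite ?hi //; try exact: pre_refl.
  by apply: pre_subword; exact: pre_refl.
apply: (NIA_sb_ind (n := 6) (P := fun M r => len (r 0) <=p (r 1) ->
    forall w, subword w (r 2) -> w <=p (r 2) ->
    len w = block_len (r 4) (r 5) ** (len (r 0) ^^ one) -> w <=p (r 3))
  (r := econs i (econs z (econs z' (econs n1 (econs n3 (fun _ => eps)))))) _ _ _ y).
- by rewrite /block_len /state_len /work_len; sbdef.
- move=> /= _ w _ wz; rewrite len_eps eps_cat times_bit -len_B0 => lw.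
  by rewrite (pre_eq_len wz B0z lw).
move=> {}y b /= IH; rewrite len_snoc => ji w1 _ w1z lw1.
have lj : len (len y) = len y := len_len y.
have [w [B [B' [wz lw lB lB' st]]]] := history_step_at hz hi lj ji.
have [v [C [C' [vz lv lC lC' st']]]] := history_step_at hz' hi lj ji.
have wBz : w ^^ B <=p z by apply: pre_trans wz; exact: pre_cat.
have wB : w ^^ B = v ^^ C.
  apply: (pre_eq_len (z := z')); last by rewrite !len_cat lw lv lB lC.
    apply: IH => //; [by apply: pre_trans ji; exact: pre_cat|exact: pre_subword|].
    by rewrite len_cat lw lB times_snoc.
  by apply: pre_trans vz; exact: pre_cat.
have eB : B = C by have [] := scat_inj wB; rewrite ?lw ?lv.
rewrite -eB in st'; have e : w1 = w ^^ B ^^ B'.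
  apply: (pre_eq_len w1z wz).
  by rewrite lw1 !len_cat lw lB lB' !times_snoc.
by rewrite e wB (block_step_functional st st').
Qed.

Lemma history_outputI z y w U P1 P2 P3 : z = w ^^ (U ^^ P1 ^^ P2 ^^ P3) -> len U = state_len M ->
  len P1 = one ^^ n1 ^^ one -> len P2 = one ^^ n1 ^^ one ->
  len P3 = work_len M ^^ n3 ^^ work_len M ->
  y <=p P2 -> len y <=p P1 -> ~ len y ^^ one <=p P1 -> history_output n1 n3 z y.
Proof.
move=> ez lU l1 l2 l3 yP2 yP1 yP1_max.
exists w; split; first by rewrite ez; apply: pre_subword; exact: pre_cat.
exists U; split.
  by have := subword_cat w U (P1 ^^ P2 ^^ P3); rewrite ez !scatA.
exists P1; split.
  by have := subword_cat (w ^^ U) P1 (P2 ^^ P3); rewrite ez !scatA.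
exists P2; split.
  by have := subword_cat (w ^^ U ^^ P1) P2 P3; rewrite ez !scatA.
exists P3; split=> //.
by have := subword_cat (w ^^ U ^^ P1 ^^ P2) P3 eps; rewrite ez !scatA cat_eps.
Qed.

Lemma history_output_exists x z : len z = L ** (x ^^ one) -> exists y, history_output n1 n3 z y.
Proof.
move=> lz; have : len z = L ** x ^^ L by rewrite lz times_snoc.
move=> /tally_split[]; rewrite ?len_times ?len_block_len // => w [B [ez _]].
move=> /block_split[U [P1 [P2 [P3 [eB lU l1 l2 l3]]]]].
have [v [lv vP1 v_max]] := ones_prefix P1.
have [|y yP2 ly] := prefix_of_len (x := P2) (u := v).
  by rewrite l2 -l1 -lv; exact: pre_len.
by exists y; apply: (history_outputI (w := w) _ lU l1 l2 l3 yP2); rewrite ?ly // -eB.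
Qed.

Lemma maximal_tally_unique (u v P : M) : len u <=p P -> ~ len u ^^ one <=p P ->
  len v <=p P -> ~ len v ^^ one <=p P -> len u = len v.
Proof.
have longest (a b : M) : len b <=p P -> ~ len a ^^ one <=p P -> len a <=p len b -> len a = len b.
  move=> hb na /pre_catP[t et]; case: (word_case t) => [te|[t' [c te]]].
    by rewrite et te cat_eps.
  have lt : len t = t.
    by apply: (cat_injl (z := len a)); rewrite -{1}[len a]len_len -len_cat -et len_len.
  case: na; apply: pre_trans hb.
  by rewrite et -lt te len_snoc -(one_lenC t') scatA; exact: pre_cat.
move=> hu nu hv nv; case: (pre_total hu hv) => h; first exact: longest h.
by apply: esym; exact: longest h.
Qed.

Lemma history_outputE z y : history_output n1 n3 z y -> exists w U P1 P2 P3, [/\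
  z = w ^^ (U ^^ P1 ^^ P2 ^^ P3), len U = state_len M, len P1 = one ^^ n1 ^^ one,
  len P2 = one ^^ n1 ^^ one & len P3 = work_len M ^^ n3 ^^ work_len M] /\
  [/\ y <=p P2, len y <=p P1 & ~ len y ^^ one <=p P1].
Proof.
move=> [w [_ [U [_ [P1 [_ [P2 [_ [P3 [_ [ez [lU [l1 [l2 [l3 [yP2 [yP1 yP1_max]]]]]]]]]]]]]]]]].
by exists w, U, P1, P2, P3.
Qed.

Lemma history_output_unique z y y' :
  history_output n1 n3 z y -> history_output n1 n3 z y' -> y = y'.
Proof.
move=> /history_outputE[w [U [P1 [P2 [P3 [[ez lU l1 l2 l3] [yP2 yP1 yP1_max]]]]]]].
move=> /history_outputE[w' [U' [P1' [P2' [P3' [[ez' lU' l1' l2' l3'] [yP2' yP1' yP1_max']]]]]]].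
have eB : len (U ^^ P1 ^^ P2 ^^ P3) = len (U' ^^ P1' ^^ P2' ^^ P3').
  by rewrite !len_cat lU l1 l2 l3 lU' l1' l2' l3'.
have ew : len w = len w'.
  apply: (cat_injr (z := len (U ^^ P1 ^^ P2 ^^ P3))).
  by rewrite {2}eB -!(len_cat w) -ez -(len_cat w') -ez'.
have [_ e] := scat_inj (etrans (esym ez) ez') ew.
have [| | |eU e1 e2 e3] := block_inj e; rewrite ?lU ?l1 ?l2 ?lU' ?l1' ?l2' //.
subst P1' P2'; apply: (pre_eq_len yP2 yP2').
exact: maximal_tally_unique yP1 yP1_max yP1' yP1_max'.
Qed.

End InModel.
End BlockMachine.

(** * Representing a probabilistic Turing machine *)

Lemma nseq_rcons (T : Type) n (x : T) : nseq n.+1 x = rcons (nseq n x) x.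
Proof. by elim: n => //= n ->. Qed.

Lemma flatten_nseq_nseq (T : Type) i j (x : T) :
  flatten (nseq j (nseq i x)) = nseq (j * i) x.
Proof. by elim: j => //= j ->; rewrite mulSn nseqD. Qed.

Lemma flatten_nseq1 (T : Type) j (x : T) : flatten (nseq j [:: x]) = nseq j x.
Proof. by rewrite (flatten_nseq_nseq 1) muln1. Qed.

Lemma size_flatten_nseq (T : Type) n (x : seq T) : size (flatten (nseq n x)) = (size x * n)%N.
Proof. by rewrite size_flatten /shape map_nseq sumn_nseq. Qed.

Lemma prefix_nseq (T : eqType) (s : seq T) j (x : T) :
  prefix s (nseq j x) -> s = nseq (size s) x /\ (size s <= j)%N.
Proof.
move=> /prefixP[t e]; split; last by rewrite -(size_nseq j x) e size_cat leq_addr.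
by apply/all_pred1P; have := all_pred1_nseq x j; rewrite e all_cat => /andP[].
Qed.

Lemma size_cat_inj (T : eqType) (x y x' y' : seq T) :
  size x = size x' -> x ++ y = x' ++ y' -> x = x' /\ y = y'.
Proof. by move=> h /eqP; rewrite eqseq_cat // => /andP[/eqP -> /eqP ->]. Qed.

Section OneHot.
Variable T : finType.

Definition onehot (x : T) : #|T|.-tuple bool := map_tuple (fun y => y == x) (enum_tuple T).
Definition onehot_inv (t : #|T|.-tuple bool) : option T := [pick x | onehot x == t].

Lemma onehot_inj : injective onehot.
Proof.
move=> x y /(congr1 val) /= /eq_in_map /(_ x); rewrite mem_enum eqxx => /(_ isT)/esym/eqP.
by [].
Qed.

Lemma onehotK : pcancel onehot onehot_inv.
Proof.
move=> x; rewrite /onehot_inv; case: pickP => [y /eqP/onehot_inj -> //|/(_ x)].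
by rewrite eqxx.
Qed.

Lemma onehot_inv_zero : onehot_inv (nseq_tuple #|T| false) = None.
Proof.
rewrite /onehot_inv; case: pickP => // x /eqP/(congr1 val) /= e.
have : nth false (nseq #|T| false) (index x (enum T)) = true.
  by rewrite -e (nth_map x) ?index_mem ?mem_enum // nth_index ?mem_enum // eqxx.
by rewrite nth_nseq; case: ifP.
Qed.

End OneHot.

Section Representation.
Variables (M0 : ptm).
Notation Q := (state M0).
Notation W := (work M0).
Notation nq := #|Q|.
Notation nw := #|W|.
Notation sym := (symbol W).
Notation cell := (block_cell nw).

Definition zero_field : nw.-tuple bool := nseq_tuple nw false.

Definition encode_symbol (a : sym) : cell :=
  match a with
  | Blank => ([tuple false], [tuple false], zero_field)
  | Bit b => ([tuple true], [tuple b], zero_field)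
  | Sharp => ([tuple false], [tuple true], zero_field)
  | Work w => ([tuple false], [tuple false], onehot w)
  end.

Definition decode_symbol (c : cell) : sym :=
  if thead c.1.1 then Bit (thead c.1.2)
  else if onehot_inv c.2 is Some w then Work w
  else if thead c.1.2 then Sharp else Blank.

Lemma encode_symbolK : cancel encode_symbol decode_symbol.
Proof.
by case=> [|[]| |w]; rewrite /decode_symbol /= ?onehot_inv_zero ?onehotK.
Qed.

Definition block_trans (c : bool) (u : nq.-tuple bool) (a : cell) :
    nq.-tuple bool * cell * move :=
  let q := odflt (start M0) (onehot_inv u) in
  if final q then (u, a, MoveN) else
  let: (q', a', mv) := delta c q (decode_symbol a) in (onehot q', encode_symbol a', mv).

Section Tape.
Variable K : nat.

Definition cyclic_tape (l r : seq sym) : seq sym :=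
  r ++ nseq (K - (size r + size l)) Blank ++ rev l.

Definition inner_tape (l r : seq sym) : seq sym :=
  behead r ++ nseq (K - 2 - (size (behead r) + size (behead l))) Blank ++ rev (behead l).

Definition rotate_tape (mv : move) (a : sym) (Y : seq sym) (b : sym) : seq sym :=
  match mv with
  | MoveN => a :: rcons Y b
  | MoveR => rcons (rcons Y b) a
  | MoveL => b :: a :: Y
  end.

Lemma size_cyclic_tape l r : (size r + size l <= K)%N -> size (cyclic_tape l r) = K.
Proof. rewrite /cyclic_tape !size_cat size_nseq size_rev; lia. Qed.

Lemma cyclic_tape_split l r : (size r + size l + 2 <= K)%N ->
  cyclic_tape l r = rotate_tape MoveN (head Blank r) (inner_tape l r) (head Blank l).
Proof.
rewrite /cyclic_tape /inner_tape; case: r => [|a r]; case: l => [|b l] /= h.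
- have -> : (K - 0 = (K - 2 - 0).+2)%N by lia.
  by rewrite !cats0 nseq_rcons.
- have -> : (K - (0 + (size l).+1) = (K - 2 - (0 + size l)).+1)%N by lia.
  by rewrite rev_cons rcons_cat.
- have -> : (K - ((size r).+1 + 0) = (K - 2 - (size r + 0)).+1)%N by lia.
  by rewrite !cats0 nseq_rcons rcons_cat.
- have -> : (K - ((size r).+1 + (size l).+1) = K - 2 - (size r + size l))%N by lia.
  by rewrite rev_cons !rcons_cat.
Qed.

Lemma cyclic_tape_move l r a mv : (size r + size l + 2 <= K)%N ->
  let: (l', r') := match mv with
    | MoveL => (behead l, head Blank l :: a :: behead r)
    | MoveN => (l, a :: behead r)
    | MoveR => (a :: l, behead r)
    end in
  cyclic_tape l' r' = rotate_tape mv a (inner_tape l r) (head Blank l) /\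
  (size r' + size l' <= (size r + size l).+2)%N.
Proof.
move=> h; rewrite /cyclic_tape /inner_tape.
case: mv => /=; (split; last by rewrite !size_behead; lia).
- do 2 congr cons; congr (_ ++ (nseq _ _ ++ _)); rewrite !size_behead; lia.
- congr cons; rewrite rcons_cat; congr cat; case: l h => [|b l] /= h.
    by rewrite !cats0 -nseq_rcons; congr nseq; rewrite !size_behead; lia.
  by rewrite rev_cons -rcons_cat; congr (rcons (cat (nseq _ _) _) _); rewrite !size_behead; lia.
- rewrite !rcons_cat rev_cons; congr cat; case: l h => [|b l] /= h.
    rewrite (_ : (K - (size (behead r) + 1) = (K - 2 - (size (behead r) + 0)).+1)%N).
      by rewrite nseq_rcons cat_rcons.
    rewrite !size_behead; lia.
  rewrite rev_cons; congr (cat (nseq _ _) _); rewrite !size_behead; lia.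
Qed.

End Tape.

Definition kind_field (c : cell) : word := c.1.1.
Definition value_field (c : cell) : word := c.1.2.
Definition work_field (c : cell) : word := c.2.
Definition plane (f : cell -> word) (s : seq sym) : word := flatten (map (f \o encode_symbol) s).

Definition block (q : Q) (s : seq sym) : word :=
  onehot q ++ plane kind_field s ++ plane value_field s ++ plane work_field s.

Lemma plane_cons f a s : plane f (a :: s) = f (encode_symbol a) ++ plane f s.
Proof. by []. Qed.

Lemma plane_cat f s s' : plane f (s ++ s') = plane f s ++ plane f s'.
Proof. by rewrite /plane map_cat flatten_cat. Qed.

Lemma size_plane f k s : (forall c, size (f c) = k) -> size (plane f s) = (size s * k)%N.
Proof. by move=> h; elim: s => //= a s IH; rewrite plane_cons size_cat h IH mulSn. Qed.

Lemma size_kind_plane s : size (plane kind_field s) = size s.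
Proof. by rewrite (@size_plane _ 1) ?muln1 // => c; rewrite size_tuple. Qed.

Lemma size_value_plane s : size (plane value_field s) = size s.
Proof. by rewrite (@size_plane _ 1) ?muln1 // => c; rewrite size_tuple. Qed.

Lemma size_work_plane s : size (plane work_field s) = (size s * nw)%N.
Proof. by rewrite (@size_plane _ nw) // => c; rewrite size_tuple. Qed.

Lemma plane_rotate w f mv a Y b : plane f (rotate_tape mv a Y b) =
  rotate_plane (M := std w) mv (f (encode_symbol a)) (plane f Y) (f (encode_symbol b)).
Proof.
have plane_rcons s x : plane f (rcons s x) = plane f s ++ f (encode_symbol x).
  by rewrite -cats1 plane_cat /plane /= cats0.
by case: mv; rewrite /= ?plane_rcons ?plane_cons ?plane_rcons ?catA.
Qed.

Lemma block_rotate w q mv a Y b : block q (rotate_tape mv a Y b) =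
  block_of (M := std w) (onehot q) mv (encode_symbol a) (encode_symbol b)
    (plane kind_field Y) (plane value_field Y) (plane work_field Y).
Proof. by rewrite /block !(plane_rotate w) /block_of !embed_std /= !catA. Qed.

Definition config_block (K : nat) (x : config M0) : word :=
  block x.1.1 (cyclic_tape K x.1.2 x.2).

Definition tape_size (x : config M0) : nat := (size x.2 + size x.1.2)%N.

Lemma config_block_step (w : word -> bool) K c x : (tape_size x + 2 <= K)%N ->
  exists (d : window nq nw) (Y : seq sym),
  [/\ size Y = (K - 2)%N,
      config_block K x = block_of (M := std w) d.1.1 MoveN d.1.2 d.2
        (plane kind_field Y) (plane value_field Y) (plane work_field Y),
      config_block K (step c x) = next_block block_trans (M := std w) c d
        (plane kind_field Y) (plane value_field Y) (plane work_field Y) &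
      (tape_size (step c x) <= (tape_size x).+2)%N].
Proof.
case: x => [[q l] r]; rewrite /tape_size /= => h.
exists (onehot q, encode_symbol (head Blank r), encode_symbol (head Blank l)), (inner_tape K l r).
split.
- rewrite /inner_tape !size_cat size_nseq size_rev !size_behead; lia.
- by rewrite /config_block /= cyclic_tape_split // (block_rotate w).
- rewrite /next_block /block_trans /= onehotK /= encode_symbolK; case: ifP => fq /=.
    by rewrite /config_block /= cyclic_tape_split // (block_rotate w).
  case: (delta c q (head Blank r)) => [[q' a'] mv] /=.
  have := cyclic_tape_move a' mv h; case: mv => -[e _];
    by rewrite /config_block [LHS]/= e; exact: (block_rotate w).
- case: ifP => fq /=; first by lia.
  case: (delta c q (head Blank r)) => [[q' a'] mv] /=.
  by have := cyclic_tape_move a' mv h; case: mv => -[_].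
Qed.

Fixpoint input_values (M : structure) (xs : seq M) : M :=
  match xs with
  | [::] => eps
  | [:: x] => x
  | x :: xs' => x ^^ one ^^ input_values xs'
  end.

Fixpoint input_kinds (M : structure) (xs : seq M) : M :=
  match xs with
  | [::] => eps
  | [:: x] => len x
  | x :: xs' => len x ^^ s_bit false ^^ input_kinds xs'
  end.

(* Horner's scheme, on tallies *)
Fixpoint poly_tally (M : structure) (s : seq nat) (x : M) : M :=
  if s is a :: s' then poly_tally s' x ** x ^^ embed M (nseq a true) else eps.

Definition work_width (M : structure) (n1 : M) : M := work_len nw M ** n1.

Definition initial_block (M : structure) (xs : seq M) (T : M) : M :=
  embed M (onehot (start M0)) ^^ (input_kinds xs ^^ s_bit false ** (T ^^ one ^^ one)) ^^
  (input_values xs ^^ s_bit false ** (T ^^ one ^^ one)) ^^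
  embed M zero_field ** (len (input_values xs) ^^ T ^^ one ^^ one).

Section TermsInModel.
Variable M : NIA_model.

Lemma len_input_kinds (xs : seq M) : len (input_kinds xs) = len (input_values xs).
Proof.
elim: xs => // x xs IH; case: xs IH => [|y xs] IH; first exact: len_len.
rewrite [input_kinds _]/= [input_values _]/= -/(input_kinds (y :: xs)) -/(input_values (y :: xs)).
by rewrite !len_cat IH len_len !len_bit.
Qed.

Lemma len_poly_tally s (x : M) : len x = x -> len (poly_tally s x) = poly_tally s x.
Proof.
move=> hx; elim: s => [|a s IH] /=; first exact: len_eps.
by rewrite len_cat len_times IH len_embed_nseq.
Qed.

Lemma len_initial_block (xs : seq M) (T : M) : len T = T ->
  let n1 := len (input_values xs) ^^ T in
  len (initial_block xs T) = block_len nq nw n1 (work_width n1).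
Proof.
move=> hT n1.
have hn1 : len n1 = n1 by rewrite len_cat len_len hT.
have padE : one ^^ n1 ^^ one = n1 ^^ one ^^ one by rewrite -hn1 one_lenC.
have len_pad b : len (s_bit b ** (T ^^ one ^^ one)) = T ^^ one ^^ one.
  by rewrite len_times len_bit !len_snoc hT.
rewrite /initial_block !len_cat len_input_kinds !len_pad len_embed_tuple len_times len_embed_nseq.
rewrite /block_len padE /work_width -/(state_len nq M) -/(work_len nw M).
congr (_ ^^ _ ^^ _ ^^ _); try by rewrite !scatA.
by rewrite -[len (input_values xs) ^^ T]/n1 -padE !times_cat !times_bit.
Qed.

End TermsInModel.

Lemma tdef_input_values n (js : seq nat) : all (fun j => j < n)%N js ->
  term_definable n (fun M r => input_values [seq r j | j <- js]).
Proof.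
elim: js => [|j [|j' js] IH] /=; first by move=> _; exact: tdef_eps.
  by move=> /andP[h _]; exact: tdef_var.
by move=> /andP[h /IH {}IH]; apply: tdef_cat IH; apply: tdef_cat; [exact: tdef_var|exact: tdef_bit].
Qed.

Lemma tdef_input_kinds n (js : seq nat) : all (fun j => j < n)%N js ->
  term_definable n (fun M r => input_kinds [seq r j | j <- js]).
Proof.
elim: js => [|j [|j' js] IH] /=; first by move=> _; exact: tdef_eps.
  by move=> /andP[h _]; tdef.
by move=> /andP[h /IH {}IH]; apply: tdef_cat IH; tdef.
Qed.

Lemma tdef_poly_tally n s f :
  term_definable n f -> term_definable n (fun M r => poly_tally s (f M r)).
Proof. by move=> h; elim: s => [|a s IH] /=; tdef. Qed.

Section Formula.
Variables (s : seq nat) (k : nat).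

Definition args (M : structure) (r : nat -> M) : seq M := [seq r j | j <- iota 1 k].
Definition time_tally (M : structure) (r : nat -> M) : M :=
  poly_tally s (len (input_values (args r))).
Definition tape_tally (M : structure) (r : nat -> M) : M :=
  len (input_values (args r)) ^^ (time_tally r ^^ time_tally r).
Definition start_block (M : structure) (r : nat -> M) : M :=
  initial_block (args r) (time_tally r ^^ time_tally r).

Definition machine_outputs (M : structure) (r : nat -> M) : Prop :=
  exists z, len z <=p len (block_len nq nw (tape_tally r) (work_width (tape_tally r)) **
                           (time_tally r ^^ one)) /\
   (history block_trans (tape_tally r) (work_width (tape_tally r)) (start_block r)
      (time_tally r) z /\
    history_output nq nw (tape_tally r) (work_width (tape_tally r)) z (r 0)).

Lemma S1def_machine_outputs : definable Sigma1b k.+1 (fun M r => machine_outputs r).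
Proof.
have js_lt : all (fun j => j < k.+1)%N (iota 1 k) by apply/allP => j; rewrite mem_iota; lia.
have values_def : term_definable k.+1 (fun M r => input_values (args r)) := tdef_input_values js_lt.
have kinds_def : term_definable k.+1 (fun M r => input_kinds (args r)) := tdef_input_kinds js_lt.
have time_def : term_definable k.+1 (@time_tally) by apply: tdef_poly_tally; tdef.
have tape_def : term_definable k.+1 (@tape_tally) by rewrite /tape_tally; tdef.
have width_def : term_definable k.+1 (fun M r => work_width (tape_tally r)).
  by rewrite /work_width /work_len; tdef.
have start_def : term_definable k.+1 (@start_block) by rewrite /start_block /initial_block; tdef.
apply: S1def_ex; first by apply: tdef_times; [exact: tdef_block_len|tdef].
have output_def : term_definable k.+2 (fun M r => etl r 0) by exact: tdef_var.
have history_def : term_definable k.+2 (fun M r => r 0) by exact: tdef_var.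
apply: S1def_sbdef; apply: sbdef_and.
  apply: sbdef_history => //; [exact: (tdef_weaken 1 tape_def)|exact: (tdef_weaken 1 width_def)
    |exact: (tdef_weaken 1 start_def)|exact: (tdef_weaken 1 time_def)].
apply: sbdef_history_output => //.
  exact: (tdef_weaken 1 tape_def).
exact: (tdef_weaken 1 width_def).
Qed.

Section Unique.
Variable M : NIA_model.
Implicit Type r : nat -> M.

Lemma len_time_tally r : len (time_tally r) = time_tally r.
Proof. by apply: len_poly_tally; exact: len_len. Qed.

Lemma len_tape_tally r : len (tape_tally r) = tape_tally r.
Proof. by rewrite !len_cat len_len len_time_tally. Qed.

Lemma len_work_width r : len (work_width (tape_tally r)) = work_width (tape_tally r).
Proof. by rewrite /work_width len_times len_embed_nseq. Qed.

Lemma len_start_block r :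
  len (start_block r) = block_len nq nw (tape_tally r) (work_width (tape_tally r)).
Proof. by apply: len_initial_block; rewrite len_cat len_time_tally. Qed.

Lemma args_econs x y r : args (econs x r) = args (econs y r).
Proof. by apply/eq_in_map => -[|j] //; rewrite mem_iota. Qed.

Lemma machine_outputs_exists r : exists y, machine_outputs (econs y r).
Proof.
pose r0 := econs eps r.
have [z hz] := history_exists block_trans (len_tape_tally r0) (len_work_width r0)
  (len_start_block r0) (time_tally r0).
rewrite len_time_tally in hz.
have [y hy] := history_output_exists (len_tape_tally _) (len_work_width _) hz.1.
exists y, z; rewrite /start_block /tape_tally /time_tally (args_econs y eps).
split; last by split.
rewrite hz.1 len_times (len_block_len nq nw (len_tape_tally _) (len_work_width _)).
exact: pre_refl.
Qed.

Lemma machine_outputs_unique r y y' :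
  machine_outputs (econs y r) -> machine_outputs (econs y' r) -> y = y'.
Proof.
rewrite /machine_outputs /start_block /tape_tally /time_tally (args_econs y eps)
  (args_econs y' eps) => -[z [_ [hz hy]]] [z' [_ [hz' hy']]].
have e : z = z'.
  apply: (history_unique (len_tape_tally _) (len_work_width _) (len_start_block (econs eps r))
    (x := time_tally (econs eps r)) (trans := block_trans)).
    by rewrite len_time_tally; exact: hz.
  by rewrite len_time_tally; exact: hz'.
by rewrite e in hy; exact: history_output_unique hy hy'.
Qed.

End Unique.

Section Standard.
Variables (w : word -> bool) (xs : k.-tuple word).
Notation SM := (std w).
Notation n := (size (encode W xs)).
Notation T := (horner_rec s n).
Notation K := (n + (T + T) + 2)%N.
Notation conf i := (run (fun j => w (nseq j true)) i (init M0 xs)).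
Notation L := (nq + K + K + K * nw)%N.

Definition std_env (y : word) : nat -> SM := econs (y : SM) (fun i => nth [::] xs i).

Lemma std_len (x : SM) : len x = nseq (size (x : word)) true.
Proof. exact: flatten_nseq1. Qed.

Lemma args_std_env y : args (std_env y) = xs :> seq word.
Proof.
rewrite /args (iotaDl 1 0) -map_comp; apply: (@eq_from_nth _ [::]).
  by rewrite size_map size_iota size_tuple.
move=> i; rewrite size_map size_iota => ik.
by rewrite (nth_map 0) ?size_iota // nth_iota.
Qed.

Lemma plane_bits (x : word) : [/\ plane kind_field (map Bit x) = nseq (size x) true,
  plane value_field (map Bit x) = x &
  plane work_field (map Bit x) = nseq (size x * nw) false].
Proof.
elim: x => // b x [IH1 IH2 IH3]; rewrite map_cons !plane_cons IH1 IH2 IH3; split=> //.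
by rewrite [size _]/= mulSn nseqD.
Qed.

Lemma plane_blanks j : [/\ plane kind_field (nseq j Blank) = nseq j false,
  plane value_field (nseq j Blank) = nseq j false &
  plane work_field (nseq j Blank) = nseq (j * nw) false].
Proof.
elim: j => // j [IH1 IH2 IH3]; rewrite -[nseq j.+1 Blank]/(Blank :: _) !plane_cons IH1 IH2 IH3.
by split=> //; rewrite mulSn nseqD.
Qed.

Lemma plane_encode zs : [/\ plane kind_field (encode W zs) = input_kinds (M := SM) zs,
  plane value_field (encode W zs) = input_values (M := SM) zs &
  plane work_field (encode W zs) = nseq (size (encode W zs) * nw) false].
Proof.
elim: zs => // x zs IH; have [kind_x value_x work_x] := plane_bits x.
case: zs IH => [_|y zs [IH1 IH2 IH3]].
  by rewrite [encode _ _]/= kind_x value_x work_x size_map -std_len.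
rewrite -[encode W _]/(map Bit x ++ Sharp :: encode W (y :: zs)) !plane_cat !plane_cons.
rewrite kind_x value_x work_x IH1 IH2 IH3 size_cat size_map [size (_ :: _)]/= mulnDl mulSn !nseqD.
split=> //.
  by rewrite -[RHS]/(((len (x : SM) : word) ++ [:: false]) ++ input_kinds (y :: zs : seq SM))
    std_len -catA.
by rewrite -[RHS]/((x ++ [:: true]) ++ input_values (y :: zs : seq SM)) -catA.
Qed.

Lemma size_input_values : size (input_values (M := SM) xs : word) = n.
Proof. by have [_ <- _] := plane_encode xs; rewrite size_value_plane. Qed.

Lemma size_poly_tally (x : SM) : size (poly_tally s x : word) = horner_rec s (size (x : word)).
Proof.
by elim: (s) => //= a s' IH; rewrite size_cat embed_std size_nseq -IH size_flatten_nseq.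
Qed.

Lemma time_tally_std y : time_tally (std_env y) = nseq T true :> word.
Proof.
rewrite -len_time_tally std_len; congr nseq.
by rewrite /time_tally size_poly_tally args_std_env std_len size_nseq size_input_values.
Qed.

Lemma tape_tally_std y : tape_tally (std_env y) = nseq (n + (T + T)) true :> word.
Proof.
by rewrite /tape_tally time_tally_std args_std_env std_len size_input_values /= -!nseqD.
Qed.

Lemma work_width_std j : work_width (M := SM) (nseq j true) = nseq (j * nw) true.
Proof. by rewrite /work_width /work_len embed_std /= size_nseq flatten_nseq_nseq. Qed.

Lemma block_len_std : block_len (M := SM) nq nw (nseq (n + (T + T)) true)
  (work_width (M := SM) (nseq (n + (T + T)) true)) = nseq L true.
Proof.
rewrite work_width_std /block_len /state_len /work_len !embed_std /= -!nseqD.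
rewrite -[_ :: _]/(nseq 1 true ++ _) -[[:: true]]/(nseq 1 true) -!nseqD; congr nseq; lia.
Qed.

Lemma tape_size_run i : (tape_size (conf i) <= n + (i + i))%N.
Proof.
elim: i => [|i IH]; first by rewrite /tape_size /= !addn0.
have [d [Y [_ _ _ h]]] := config_block_step w (w (nseq i true)) (leqnn (tape_size (conf i) + 2)%N).
by apply: leq_trans h _; lia.
Qed.

Lemma size_config_block i : (i <= T)%N -> size (config_block K (conf i)) = L.
Proof.
move=> iT; rewrite /config_block /block; have := tape_size_run i; rewrite /tape_size.
case: (conf i) => [[q l] r] /= h.
have hs : size (cyclic_tape K l r) = K by apply: size_cyclic_tape; lia.
by rewrite !size_cat size_kind_plane size_value_plane size_work_plane hs size_map -cardE !addnA.
Qed.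

Definition std_history i0 j : word := flatten [seq config_block K (conf i) | i <- iota i0 j].

Lemma std_history1 i : std_history i 1 = config_block K (conf i).
Proof. exact: cats0. Qed.

Lemma size_std_history i0 j : (i0 + j <= T.+1)%N -> size (std_history i0 j) = (j * L)%N.
Proof.
elim: j i0 => // j IH i0 h; rewrite /std_history /= size_cat -/(std_history i0.+1 j) IH.
  by rewrite size_config_block ?mulSn //; lia.
by lia.
Qed.

Lemma std_history_cat i0 j j' :
  std_history i0 (j + j') = std_history i0 j ++ std_history (i0 + j) j'.
Proof. by rewrite /std_history iotaD map_cat flatten_cat. Qed.

Lemma start_block_std y : start_block (std_env y) = config_block K (conf 0) :> word.
Proof.
rewrite /start_block /initial_block args_std_env time_tally_std.
have padE : (s_bit false : SM) ** ((nseq T true : SM) ^^ nseq T true ^^ one ^^ one) =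
    nseq (T + T + 2) false :> word.
  rewrite /= flatten_nseq1; congr nseq; rewrite !size_cat !size_nseq /=; lia.
have work_padE : embed SM zero_field ** (len (input_values (M := SM) xs) ^^
    ((nseq T true : SM) ^^ nseq T true) ^^ one ^^ one) =
    nseq ((n + (T + T + 2)) * nw) false :> word.
  rewrite embed_std std_len size_input_values /= flatten_nseq_nseq; congr (nseq (_ * _) _).
  rewrite !size_cat !size_nseq /=; lia.
rewrite padE work_padE embed_std /config_block /block /= /cyclic_tape /= cats0 !plane_cat addn0.
have -> : (K - n = T + T + 2)%N by lia.
have [-> -> ->] := plane_blanks (T + T + 2); have [-> -> ->] := plane_encode xs.
by rewrite -nseqD -mulnDl !catA.
Qed.

Lemma std_history_window i (u B B' : word) : (i < T)%N -> size u = (i * L)%N ->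
  size B = L -> size B' = L -> prefix (u ++ B ++ B') (std_history 0 T.+1) ->
  B = config_block K (conf i) /\ B' = config_block K (conf i.+1).
Proof.
move=> iT su sB sB' /prefixP[t]; rewrite -(catA u) -(catA B).
rewrite (_ : T.+1 = i + (1 + (1 + (T - i.+1))))%N; last by lia.
rewrite !std_history_cat !std_history1 add0n => ht.
have [|_ {}ht] := size_cat_inj _ ht; first by rewrite size_std_history ?su //; lia.
have [|eB {}ht] := size_cat_inj _ ht; first by rewrite size_config_block ?sB //; lia.
have [|eB' _] := size_cat_inj _ ht; first by rewrite size_config_block ?sB' //; lia.
by rewrite -eB -eB' addn1.
Qed.

Notation tape_word := (nseq (n + (T + T)) true).
Notation work_word := (work_width (M := SM) tape_word).

Lemma std_block_step i : (i < T)%N -> block_step block_trans (M := SM) tape_word work_word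
  (nseq i true) (config_block K (conf i)) (config_block K (conf i.+1)).
Proof.
move=> iT.
have [|d [Y [sY e1 e2 _]]] := config_block_step w (w (nseq i true)) (K := K) (x := conf i).
  by apply: leq_trans (leq_add (tape_size_run i) (leqnn 2)) _; lia.
have {}sY : size Y = (n + (T + T))%N by rewrite sY; lia.
apply: (block_stepI (M := std_NIA_model w) (c := w (nseq i true)) (d := d)
  (Y1 := plane kind_field Y)
  (Y2 := plane value_field Y) (Y3 := plane work_field Y)) => //.
- by rewrite std_len size_kind_plane sY.
- by rewrite std_len size_value_plane sY.
- by rewrite work_width_std std_len size_work_plane sY.
Qed.

Lemma history_std : history block_trans (M := SM) tape_word work_word (config_block K (conf 0))
  (nseq T true) (std_history 0 T.+1).
Proof.
rewrite /history block_len_std; split; [|split].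
- by rewrite std_len size_std_history //= size_cat size_nseq addn1 flatten_nseq_nseq.
- by apply/prefixP; exists (std_history 1 T).
move=> j _ /prefix_nseq[ej jT] u _ B _ B' _ window lu lB lB'.
move: jT; rewrite size_cat addn1 => jT.
have {}ej : j = nseq (size (j : word)) true.
  by move: ej; rewrite size_cat addn1 nseq_rcons /= cats1 => /rcons_inj[].
have size_len (x : SM) j' : len x = nseq j' true -> size (x : word) = j'.
  by rewrite std_len => /(congr1 size); rewrite !size_nseq.
have [|||||-> ->] := @std_history_window (size (j : word)) u B B' => //.
- by apply: size_len; rewrite lu /= flatten_nseq_nseq.
- exact: size_len.
- exact: size_len.
- by rewrite catA.
by rewrite {1}ej; exact: std_block_step.
Qed.

Lemma leading_bits_split (r : seq sym) : exists2 r', r = map Bit (leading_bits r) ++ r' &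
  if r' is Bit b :: _ then False else True.
Proof.
elim: r => [|[|b| |a] r [r' e h]] /=.
- by exists [::].
- by exists (Blank :: r).
- by exists r' => //; congr cons.
- by exists (Sharp :: r).
- by exists (Work a :: r).
Qed.

Lemma cyclic_tape_output l r : (size r + size l < K)%N -> exists a t,
  cyclic_tape K l r = map Bit (leading_bits r) ++ a :: t /\
  kind_field (encode_symbol a) = [:: false].
Proof.
move=> h; have [r' er hr'] := leading_bits_split r.
have -> : cyclic_tape K l r = map Bit (leading_bits r) ++ r' ++
    nseq (K - (size r + size l)).-1.+1 Blank ++ rev l.
  by rewrite /cyclic_tape {1}er -!catA prednK //; lia.
case: r' hr' {er} => [_|[|b| |a] r' hr'] //=; by do 2 eexists; split.
Qed.

Lemma history_output_std : history_output (M := SM) nq nw tape_word work_word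
  (std_history 0 T.+1) (output (conf T)).
Proof.
rewrite -addn1 std_history_cat add0n std_history1 /config_block /output.
have := tape_size_run T; rewrite /tape_size; case: (conf T) => [[q l] r] /= hs.
have sK : size (cyclic_tape K l r) = K by apply: size_cyclic_tape; lia.
have [|a [t [et ha]]] := @cyclic_tape_output l r; first by lia.
set y := leading_bits r in et *; have [kind_y value_y _] := plane_bits y.
have pad1 : tape_word ++ [:: true] = nseq (n + (T + T)).+1 true by rewrite cats1 -nseq_rcons.
apply: (history_outputI (M := std_NIA_model w) (w := std_history 0 T) (U := onehot q)
  (P1 := plane kind_field (cyclic_tape K l r)) (P2 := plane value_field (cyclic_tape K l r))
  (P3 := plane work_field (cyclic_tape K l r))).
- by rewrite /block /= !catA.
- by rewrite /state_len embed_std std_len size_tuple.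
- by rewrite std_len size_kind_plane sK /= pad1 addn2.
- by rewrite std_len size_value_plane sK /= pad1 addn2.
- rewrite /work_len embed_std std_len size_work_plane sK size_nseq
    flatten_nseq_nseq /= -!nseqD.
  by congr nseq; lia.
- by rewrite et plane_cat value_y; apply/prefixP; exists (plane value_field (a :: t)).
- by rewrite std_len et plane_cat kind_y; apply/prefixP; exists (plane kind_field (a :: t)).
rewrite std_len et plane_cat kind_y => /prefixP[v]; rewrite -catA => /(size_cat_inj erefl)[_].
by rewrite plane_cons ha.
Qed.

Lemma machine_outputs_std y : machine_outputs (std_env y) <-> y = output (conf T).
Proof.
have h : machine_outputs (std_env (output (conf T))).
  exists (std_history 0 T.+1); rewrite start_block_std time_tally_std tape_tally_std.
  split; last by split; [exact: history_std|exact: history_output_std].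
  have [-> _] := history_std; rewrite len_times block_len_std std_len size_nseq.
  exact: pre_refl.
by split=> [hy|->//]; exact: machine_outputs_unique hy h.
Qed.

End Standard.

Lemma machine_formula : exists G, [/\ Sigma1b G, fscoped k.+1 G,
  proves NIA [::] (iter k FAll (ex_unique G)) &
  forall (w : word -> bool) (xs : k.-tuple word) (y : word),
    holds w (fun=> [::]) (instance G xs y) <->
    output (run (fun i => w (nseq i true)) (horner_rec s (size (encode W xs)))
      (init M0 xs)) = y].
Proof.
have [G [hS hG GP]] := S1def_machine_outputs; exists G; split=> //.
  apply: completeness => M hM; pose N := NIAModel hM.
  apply/(sat_iterAll N) => r; rewrite sat_ex_unique.
  have [y hy] := machine_outputs_exists r; exists y; first by rewrite GP.
  by move=> y' /GP hy'; rewrite (machine_outputs_unique hy' hy); exact: s_refl.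
move=> w xs y; rewrite holds_std /instance sat_fsubst.
rewrite (sat_ext _ (r' := std_env w xs y)); last by case=> [|i]; exact: numeral_std.
by rewrite GP machine_outputs_std; split=> ->.
Qed.

End Formula.

End Representation.

Local Close Scope nia_scope.

(** * Decision trees over independent fair coins *)

Inductive dtree (I T : Type) : Type :=
| DLeaf of T
| DNode of I & (bool -> dtree I T).
Arguments DLeaf {I T} _.
Arguments DNode {I T} _ _.

Fixpoint dtree_run (I T : Type) (w : I -> bool) (t : dtree I T) : T :=
  match t with DLeaf x => x | DNode i k => dtree_run w (k (w i)) end.

Fixpoint dtree_fresh (I : eqType) (T : Type) (s : seq I) (t : dtree I T) : Prop :=
  if t is DNode i k then i \notin s /\ forall b, dtree_fresh (i :: s) (k b) else True.

Section Weight.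
Local Open Scope ring_scope.
Local Open Scope classical_set_scope.
Variable R : realType.

Fixpoint dtree_weight (I : Type) (T : eqType) (y : T) (t : dtree I T) : R :=
  match t with
  | DLeaf x => (x == y)%:R
  | DNode i k => 2^-1 * dtree_weight y (k true) + 2^-1 * dtree_weight y (k false)
  end.

Definition cylinder (I : eqType) (s : seq I) (b : I -> bool) : set (coin_space I) :=
  [set w | forall i, i \in s -> w i = b i].

Definition run_event (I T : eqType) (t : dtree I T) (y : T) : set (coin_space I) :=
  [set w | dtree_run w t = y].

Section Fair.
Variables (I T : eqType) (P : probability (coin_space I) R).
Hypothesis fairP : fair P.
Implicit Types (t : dtree I T) (s : seq I) (b : I -> bool).

Lemma run_event_node s b i k (y : T)
    (set_i := fun c j => if j == i then c else b j) : i \notin s ->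
  cylinder s b `&` run_event (DNode i k) y =
  (cylinder (i :: s) (set_i true) `&` run_event (k true) y) `|`
  (cylinder (i :: s) (set_i false) `&` run_event (k false) y).
Proof.
move=> is_fresh; have split_i c w : (cylinder (i :: s) (set_i c) `&` run_event (k c) y) w <->
    [/\ w i = c, cylinder s b w & dtree_run w (k c) = y].
  split=> [[agree run]|[wi agree run]]; split=> //.
  - by rewrite agree ?mem_head // /set_i eqxx.
  - move=> j js; rewrite agree ?inE ?js ?orbT // /set_i.
    by case: eqP => // e; move: is_fresh; rewrite -e js.
  - by move=> j; rewrite inE /set_i; case: eqP => [->//|_] /=; exact: agree.
apply/seteqP; split=> w.
  by move=> [agree run]; case wi: (w i); [left|right]; apply/split_i; rewrite -{2}wi.
by case=> /split_i[wi agree run]; split; rewrite // /run_event /= wi.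
Qed.

Lemma fair_cylinder_run t (y : T) s b : uniq s -> dtree_fresh s t ->
  measurable (cylinder s b `&` run_event t y) /\
  P (cylinder s b `&` run_event t y) = (2^-1 ^+ size s * dtree_weight y t)%:E.
Proof.
elim: t s b => [x|i k IH] s b us /=.
  move=> _; case: eqP => [->|ne].
    rewrite mulr1 -(fairP b us) (_ : _ `&` _ = cylinder s b); last exact: setIidl.
    by split=> //; exact: measurable_coins.
  rewrite mulr0 (_ : _ `&` _ = set0); last by apply/seteqP; split=> w //= [].
  by split=> //; rewrite measure0.
move=> [is_fresh k_fresh]; rewrite run_event_node //.
have us' : uniq (i :: s) by rewrite /= is_fresh us.
pose set_i c j := if j == i then c else b j.
have [m_true P_true] := IH true (i :: s) (set_i true) us' (k_fresh true).
have [m_false P_false] := IH false (i :: s) (set_i false) us' (k_fresh false).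
split; first exact: measurableU.
rewrite measureU //; last first.
  apply/seteqP; split=> w //= [[agree_true _] [agree_false _]].
  have := agree_true i (mem_head _ _); have := agree_false i (mem_head _ _).
  by rewrite /set_i eqxx => ->.
transitivity (((2^-1 ^+ (size s).+1 * dtree_weight y (k true))%:E +
   (2^-1 ^+ (size s).+1 * dtree_weight y (k false))%:E) : \bar R)%E.
  by rewrite -P_true -P_false.
by rewrite -EFinD; congr EFin; rewrite exprSr mulrDr !mulrA.
Qed.

Lemma fair_dtree_run t (y : T) :
  dtree_fresh [::] t -> P [set w | dtree_run w t = y] = (dtree_weight y t)%:E.
Proof.
move=> ft; have [_] := fair_cylinder_run y (fun=> true) (isT : uniq [::]) ft.
rewrite expr0 mul1r => <-; congr (P _).
by apply/seteqP; split=> w //= [].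
Qed.

End Fair.

Fixpoint coin_tree (I T : Type) (lab : nat -> I) (n i : nat) (p : word) (F : word -> T) :
    dtree I T :=
  if n is n'.+1 then DNode (lab i) (fun b => coin_tree lab n' i.+1 (rcons p b) F)
  else DLeaf (F p).

Fixpoint word_weight (T : eqType) (y : T) (n : nat) (p : word) (F : word -> T) : R :=
  if n is n'.+1 then 2^-1 * word_weight y n' (rcons p true) F +
                     2^-1 * word_weight y n' (rcons p false) F
  else (F p == y)%:R.

Lemma coin_tree_weight (I : Type) (T : eqType) (lab : nat -> I) n i p F (y : T) :
  dtree_weight y (coin_tree lab n i p F) = word_weight y n p F.
Proof. by elim: n i p => //= n IH i p; rewrite !IH. Qed.

Lemma coin_tree_run (I T : Type) (lab : nat -> I) n i p (F : word -> T) (w : I -> bool) :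
  dtree_run w (coin_tree lab n i p F) = F (p ++ [seq w (lab j) | j <- iota i n]).
Proof.
elim: n i p => [|n IH] i p /=; first by rewrite cats0.
by rewrite IH -cats1 -catA.
Qed.

Lemma coin_tree_fresh (I : eqType) (T : Type) (lab : nat -> I) n i p (F : word -> T) s :
  injective lab -> (forall j, lab j \in s -> (j < i)%N) ->
  dtree_fresh s (coin_tree lab n i p F).
Proof.
move=> lab_inj; elim: n i p s => //= n IH i p s s_lt; split.
  by apply/negP => /s_lt; rewrite ltnn.
move=> b; apply: IH => j; rewrite inE => /orP[/eqP/lab_inj ->//|/s_lt h].
exact: ltnW.
Qed.

Lemma fair_word (I T : eqType) (P : probability (coin_space I) R) (lab : nat -> I) n
    (F : word -> T) (y : T) : fair P -> injective lab ->
  P [set w | F [seq w (lab j) | j <- iota 0 n] = y] = (word_weight y n [::] F)%:E.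
Proof.
move=> fairP lab_inj; rewrite -(coin_tree_weight lab n 0) -(fair_dtree_run fairP).
  by congr (P _); apply/seteqP; split=> w /=; rewrite coin_tree_run.
exact: coin_tree_fresh.
Qed.

End Weight.

(** * Machines are representable *)

Section Runs.
Variable M0 : ptm.
Implicit Type x : config M0.

Lemma eq_in_run c c' n x : (forall i, (i < n)%N -> c i = c' i) -> run c n x = run c' n x.
Proof.
elim: n => //= n IH h; rewrite [LHS]/(step (c n) (run c n x)).
by rewrite IH ?h // => i /ltnW; exact: h.
Qed.

Lemma run_halted c m n x : halted (run c m x) -> (m <= n)%N -> run c n x = run c m x.
Proof.
move=> h /subnK <-; elim: (n - m)%N => //= j IH.
rewrite [LHS]/(step (c (j + m)) (run c (j + m) x)) IH.
by move: h; rewrite /halted; case: (run c m x) => [[q l] r] /= ->.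
Qed.

Lemma outputs_halted xs y (F : (nat -> bool) -> word) :
  (forall c, exists2 n, halted (run c n (init M0 xs)) & output (run c n (init M0 xs)) = F c) ->
  outputs M0 xs y = [set c | F c = y]%classic.
Proof.
move=> halts; apply/seteqP; split=> c /=; have [m hm <-] := halts c; last by exists m.
move=> [n [hn <-]]; congr output.
by case: (leqP n m) => [/(run_halted hn)|/ltnW/(run_halted hm)].
Qed.

End Runs.

Section MachineRepresentable.
Local Open Scope classical_set_scope.

Theorem RFP_representable (R : realType) (k : nat) (f : random_function R k) :
  RFP f -> representable f.
Proof.
move=> [M0 [[p halts] fE]].
have [G [hS hG hpr GP]] := machine_formula M0 p k; exists G; split=> // xs y.
pose T := p.[size (encode (work M0) xs)]%R.
pose F (u : word) := output (run (fun i => nth false u i) T (init M0 xs)).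
have FE I (lab : nat -> I) (w : I -> bool) :
    F [seq w (lab j) | j <- iota 0 T] = output (run (fun i => w (lab i)) T (init M0 xs)).
  congr output; apply: eq_in_run => i iT.
  by rewrite (nth_map 0) ?size_iota // nth_iota.
have outputsE : outputs M0 xs y = [set c | F [seq c j | j <- iota 0 T] = y].
  by apply: outputs_halted => c; exists T; [exact: halts|rewrite (FE _ id)].
have interpE : interp (instance G xs y) = [set w | F [seq w (nseq j true) | j <- iota 0 T] = y].
  by apply/seteqP; split=> w; rewrite /interp /= GP FE.
have nseq_inj : injective (fun i => nseq i true).
  by move=> i j /(congr1 size); rewrite !size_nseq.
rewrite fE outputsE interpE (fair_word (lab := id)) //; last exact: coin_measure_fair.
by rewrite (fair_word _ _ _ _ nseq_inj) //; exact: coin_measure_fair.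
Qed.

End MachineRepresentable.

(** * Feasible functions with an oracle *)

Inductive expr : Type :=
| EVar of nat
| EEps
| EBit of bool
| ECat of expr & expr
| ETimes of expr & expr
| EFlip of expr
| ERec of expr & expr & expr & expr & expr.

Notation oracle := (word -> bool).
Notation env := (nat -> word).

(* The first component accumulates the part of [x] already read. *)
Fixpoint rec_pair (b : nat) (h : bool -> word -> word -> word) (a : word * word) (x : word) :
    word * word :=
  if x is c :: x' then rec_pair b h (rcons a.1 c, take b (h c a.1 a.2)) x' else a.

(* Cobham's bounded recursion on notation, with truncation to enforce the bound *)
Definition bounded_rec (b : nat) (h : bool -> word -> word -> word) (z x : word) : word :=
  (rec_pair b h ([::], take b z) x).2.

Fixpoint eeval (w : oracle) (v : env) (e : expr) : word :=
  match e with
  | EVar i => v i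
  | EEps => [::]
  | EBit b => [:: b]
  | ECat e1 e2 => eeval w v e1 ++ eeval w v e2
  | ETimes e1 e2 => flatten (nseq (size (eeval w v e2)) (eeval w v e1))
  | EFlip e1 => if w (eeval w v e1) then [:: true] else [::]
  | ERec x z s0 s1 B => bounded_rec (size (eeval w v B))
      (fun c p a => eeval w (econs p (econs a v)) (if c then s1 else s0))
      (eeval w v z) (eeval w v x)
  end.

Lemma rec_pair_rcons b h a x c : rec_pair b h a (rcons x c) =
  (rcons (rec_pair b h a x).1 c,
   take b (h c (rec_pair b h a x).1 (rec_pair b h a x).2)).
Proof. by elim: x a => //= d x IH a. Qed.

Lemma rec_pair1 b h a x : (rec_pair b h a x).1 = a.1 ++ x.
Proof.
elim/last_ind: x => [|x c IH]; first by rewrite cats0.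
by rewrite rec_pair_rcons /= IH rcons_cat.
Qed.

Lemma bounded_rec_nil b h z : bounded_rec b h z [::] = take b z.
Proof. by []. Qed.

Lemma bounded_rec_rcons b h z x c :
  bounded_rec b h z (rcons x c) = take b (h c x (bounded_rec b h z x)).
Proof. by rewrite /bounded_rec rec_pair_rcons /= rec_pair1. Qed.

Lemma eq_bounded_rec b h h' z x :
  (forall c p a, h c p a = h' c p a) -> bounded_rec b h z x = bounded_rec b h' z x.
Proof. by move=> e; elim/last_ind: x => // x c IH; rewrite !bounded_rec_rcons IH e. Qed.

Definition lift_renaming (f : nat -> nat) (i : nat) : nat :=
  match i with 0 => 0 | 1 => 1 | j.+2 => (f j).+2 end.

Fixpoint erename (f : nat -> nat) (e : expr) : expr :=
  match e with
  | EVar i => EVar (f i)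
  | EEps => EEps
  | EBit b => EBit b
  | ECat e1 e2 => ECat (erename f e1) (erename f e2)
  | ETimes e1 e2 => ETimes (erename f e1) (erename f e2)
  | EFlip e1 => EFlip (erename f e1)
  | ERec x z s0 s1 B => ERec (erename f x) (erename f z) (erename (lift_renaming f) s0)
      (erename (lift_renaming f) s1) (erename f B)
  end.

Lemma eeval_rename w v f e : eeval w v (erename f e) = eeval w (fun i => v (f i)) e.
Proof.
elim: e v f => //= [e1 IH1 e2 IH2|e1 IH1 e2 IH2|e1 IH1|x IHx z IHz s0 IH0 s1 IH1 B IHB] v f;
  rewrite ?IH1 ?IH2 // IHx IHz IHB; apply: eq_bounded_rec => c p a.
by case: c; rewrite ?IH0 ?IH1; congr eeval; apply/funext => -[|[|i]].
Qed.

Definition lift_substitution (f : nat -> expr) (i : nat) : expr :=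
  match i with 0 => EVar 0 | 1 => EVar 1 | j.+2 => erename (fun i => i.+2) (f j) end.

Fixpoint esubst (f : nat -> expr) (e : expr) : expr :=
  match e with
  | EVar i => f i
  | EEps => EEps
  | EBit b => EBit b
  | ECat e1 e2 => ECat (esubst f e1) (esubst f e2)
  | ETimes e1 e2 => ETimes (esubst f e1) (esubst f e2)
  | EFlip e1 => EFlip (esubst f e1)
  | ERec x z s0 s1 B => ERec (esubst f x) (esubst f z) (esubst (lift_substitution f) s0)
      (esubst (lift_substitution f) s1) (esubst f B)
  end.

Lemma eeval_subst w v f e : eeval w v (esubst f e) = eeval w (fun i => eeval w v (f i)) e.
Proof.
elim: e v f => //= [e1 IH1 e2 IH2|e1 IH1 e2 IH2|e1 IH1|x IHx z IHz s0 IH0 s1 IH1 B IHB] v f;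
  rewrite ?IH1 ?IH2 // IHx IHz IHB; apply: eq_bounded_rec => c p a.
by case: c; rewrite ?IH0 ?IH1; congr eeval; apply/funext => -[|[|i]] //=; rewrite eeval_rename.
Qed.

Fixpoint ebound (e : expr) : nat :=
  match e with
  | EVar i => i.+1
  | EEps | EBit _ => 0
  | ECat e1 e2 | ETimes e1 e2 => maxn (ebound e1) (ebound e2)
  | EFlip e1 => ebound e1
  | ERec x z s0 s1 B => maxn (maxn (ebound x) (ebound z))
      (maxn (maxn (ebound s0) (ebound s1)) (ebound B))
  end.

Lemma eq_in_eeval w v v' e n : (ebound e <= n)%N -> (forall i, (i < n)%N -> v i = v' i) ->
  eeval w v e = eeval w v' e.
Proof.
elim: e v v' n => //= [i|e1 IH1 e2 IH2|e1 IH1 e2 IH2|e1 IH1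
  |x IHx z IHz s0 IH0 s1 IH1 B IHB] v v' n; rewrite ?geq_max.
- by move=> h e; exact: e.
- by move=> /andP[h h'] e; rewrite (IH1 _ _ _ h e) (IH2 _ _ _ h' e).
- by move=> /andP[h h'] e; rewrite (IH1 _ _ _ h e) (IH2 _ _ _ h' e).
- by move=> h e; rewrite (IH1 _ _ _ h e).
- move=> /andP[/andP[hx hz] /andP[/andP[h0 h1] hB]] e.
  rewrite (IHx _ _ _ hx e) (IHz _ _ _ hz e) (IHB _ _ _ hB e); apply: eq_bounded_rec => c p a.
  have e' i : (i < n.+2)%N -> econs p (econs a v) i = econs p (econs a v') i.
    by case: i => [|[|i]] //=; exact: e.
  have weaken m : (m <= n)%N -> (m <= n.+2)%N by lia.
  by case: c; [exact: IH1 (weaken _ h1) e'|exact: IH0 (weaken _ h0) e'].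
Qed.

Definition feasible (f : oracle -> env -> word) : Prop := exists e, forall w v, eeval w v e = f w v.

Definition feasible_pred (p : oracle -> env -> bool) : Prop :=
  exists e, forall w v, (eeval w v e != [::]) = p w v.

Definition feasible_env (E : oracle -> env -> env) : Prop :=
  forall i, feasible (fun w v => E w v i).

Lemma feasible_ext f g : feasible f -> (forall w v, f w v = g w v) -> feasible g.
Proof. by move=> [e he] h; exists e => w v; rewrite he h. Qed.

Lemma feasible_pred_ext p q : feasible_pred p -> (forall w v, p w v = q w v) -> feasible_pred q.
Proof. by move=> [e he] h; exists e => w v; rewrite he h. Qed.

Lemma feasible_var i : feasible (fun w v => v i).
Proof. by exists (EVar i). Qed.

Lemma feasible_eval e E : feasible_env E -> feasible (fun w v => eeval w (E w v) e).
Proof.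
move=> hE; exists (esubst (fun i => projT1 (cid (hE i))) e) => w v.
by rewrite eeval_subst; congr eeval; apply/funext => i; case: cid.
Qed.

Lemma feasible_comp f E : feasible f -> feasible_env E -> feasible (fun w v => f w (E w v)).
Proof. by move=> [e he] hE; apply: feasible_ext (feasible_eval e hE) _ => w v. Qed.

Lemma feasible_pred_nonempty f : feasible f -> feasible_pred (fun w v => f w v != [::]).
Proof. by move=> [e he]; exists e => w v; rewrite he. Qed.

Lemma feasible_pred_comp p E :
  feasible_pred p -> feasible_env E -> feasible_pred (fun w v => p w (E w v)).
Proof.
move=> [e he] hE; apply: feasible_pred_ext (feasible_pred_nonempty (feasible_eval e hE)) _ => w v.
exact: he.
Qed.

Lemma feasible_env_econs f E :
  feasible f -> feasible_env E -> feasible_env (fun w v => econs (f w v) (E w v)).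
Proof. by move=> hf hE [|i] //; exact: hE. Qed.

Lemma feasible_cat f g : feasible f -> feasible g -> feasible (fun w v => f w v ++ g w v).
Proof. by move=> [e he] [e' he']; exists (ECat e e') => w v /=; rewrite he he'. Qed.

Lemma feasible_times f g :
  feasible f -> feasible g -> feasible (fun w v => flatten (nseq (size (g w v)) (f w v))).
Proof. by move=> [e he] [e' he']; exists (ETimes e e') => w v /=; rewrite he he'. Qed.

Lemma feasible_const s : feasible (fun w v => s).
Proof.
elim: s => [|b s [e he]]; first by exists EEps.
by exists (ECat (EBit b) e) => w v /=; rewrite he.
Qed.

Lemma feasible_cons b f : feasible f -> feasible (fun w v => b :: f w v).
Proof. exact: feasible_cat (feasible_const [:: b]). Qed.

Lemma feasible_rcons f b : feasible f -> feasible (fun w v => rcons (f w v) b).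
Proof.
by move=> hf; apply: feasible_ext (feasible_cat hf (feasible_const [:: b])) _ => w v; rewrite cats1.
Qed.

Lemma feasible_pred_flip f : feasible f -> feasible_pred (fun w v => w (f w v)).
Proof. by move=> [e he]; exists (EFlip e) => w v /=; rewrite he; case: ifP. Qed.

Lemma feasible_bounded_rec x z h B : feasible x -> feasible z ->
  (forall c, feasible (fun w v => h c w (v 0) (v 1) (etl (etl v)))) -> feasible B ->
  feasible (fun w v => bounded_rec (size (B w v)) (fun c p a => h c w p a v) (z w v) (x w v)).
Proof.
move=> [ex hx] [ez hz] hh [eB hB]; have [s0 h0] := hh false; have [s1 h1] := hh true.
exists (ERec ex ez s0 s1 eB) => w v /=; rewrite hx hz hB; apply: eq_bounded_rec => c p a.
by case: c; rewrite ?h0 ?h1.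
Qed.

Lemma feasible_rec (g : oracle -> env -> word -> word) x z h B : feasible x -> feasible z ->
  (forall c, feasible (fun w v => h c w (v 0) (v 1) (etl (etl v)))) -> feasible B ->
  (forall w v, g w v [::] = z w v) ->
  (forall w v p c, g w v (rcons p c) = h c w p (g w v p) v) ->
  (forall w v p, prefix p (x w v) -> (size (g w v p) <= size (B w v))%N) ->
  feasible (fun w v => g w v (x w v)).
Proof.
move=> hx hz hh hB g_nil g_rcons g_bound.
apply: feasible_ext (feasible_bounded_rec hx hz hh hB) _ => w v.
have : prefix (x w v) (x w v) by exact: prefix_refl.
move: {1 3 4}(x w v) => t; elim/last_ind: t => [|t c IH] ht.
  by rewrite bounded_rec_nil -g_nil take_oversize //; exact: g_bound.
have ht' : prefix t (x w v) by apply: prefix_trans ht; exact: prefix_rcons.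
by rewrite bounded_rec_rcons IH // -g_rcons take_oversize //; exact: g_bound.
Qed.

Lemma feasible_env_shift k : feasible_env (fun w v i => v (k + i)).
Proof. by move=> i; exact: feasible_var. Qed.

Lemma feasible_if p g h : feasible_pred p -> feasible g -> feasible h ->
  feasible (fun w v => if p w v then g w v else h w v).
Proof.
move=> [e he] hg hh.
suff select : feasible (fun w v => if eeval w v e != [::] then g w v else h w v).
  by apply: feasible_ext select _ => w v; rewrite he.
apply: (@feasible_rec (fun w v x => if x != [::] then g w v else h w v) (fun w v => eeval w v e) h
  (fun c w p a v => g w v) (fun w v => g w v ++ h w v)) => //.
- by exists e.
- by move=> c; exact: feasible_comp hg (feasible_env_shift 2).
- exact: feasible_cat.
- by move=> w v x c; case: x.
- by move=> w v x _; rewrite size_cat; case: ifP => _; [exact: leq_addr|exact: leq_addl].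
Qed.

Lemma feasible_pred_if p q r : feasible_pred p -> feasible_pred q -> feasible_pred r ->
  feasible_pred (fun w v => if p w v then q w v else r w v).
Proof.
move=> hp [eq hq] [er hr].
have hif : feasible (fun w v => if p w v then eeval w v eq else eeval w v er).
  by apply: feasible_if => //; [exists eq|exists er].
apply: feasible_pred_ext (feasible_pred_nonempty hif) _ => w v.
by case: (p w v); rewrite ?hq ?hr.
Qed.

Lemma feasible_pred_const b : feasible_pred (fun w v => b).
Proof. by case: b; [exists (EBit true)|exists EEps]. Qed.

Lemma feasible_pred_not p : feasible_pred p -> feasible_pred (fun w v => ~~ p w v).
Proof.
move=> hp; apply: feasible_pred_ext
  (feasible_pred_if hp (feasible_pred_const false) (feasible_pred_const true)) _ => w v.
by case: (p w v).
Qed.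

Lemma feasible_pred_and p q :
  feasible_pred p -> feasible_pred q -> feasible_pred (fun w v => p w v && q w v).
Proof.
move=> hp hq.
apply: feasible_pred_ext (feasible_pred_if hp hq (feasible_pred_const false)) _ => w v.
by case: (p w v).
Qed.

Lemma feasible_pred_or p q :
  feasible_pred p -> feasible_pred q -> feasible_pred (fun w v => p w v || q w v).
Proof.
move=> hp hq.
apply: feasible_pred_ext (feasible_pred_if hp (feasible_pred_const true) hq) _ => w v.
by case: (p w v).
Qed.

Lemma feasible_take f g :
  feasible f -> feasible g -> feasible (fun w v => take (size (g w v)) (f w v)).
Proof.
move=> hf hg.
apply: (feasible_bounded_rec (h := fun c w p a v => p) (feasible_const [::]) hf _ hg).
by move=> c; exact: feasible_var.
Qed.

Lemma feasible_behead f : feasible f -> feasible (fun w v => behead (f w v)).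
Proof.
move=> hf; apply: (@feasible_rec (fun w v x => behead x) f (fun w v => [::])
  (fun c w p a v => if p != [::] then rcons a c else [::]) f) => //.
- exact: feasible_const.
- move=> c; apply: feasible_if; last exact: feasible_const.
    by apply: feasible_pred_nonempty; exact: feasible_var.
  by apply: feasible_rcons; exact: feasible_var.
- by move=> w v [].
- by move=> w v p /size_prefix; rewrite size_behead; exact/leq_trans/leq_pred.
Qed.

Lemma feasible_drop f g :
  feasible f -> feasible g -> feasible (fun w v => drop (size (g w v)) (f w v)).
Proof.
move=> hf hg; apply: (@feasible_rec (fun w v x => drop (size x) (f w v)) g f
  (fun c w p a v => behead a) f) => //.
- by move=> c; apply: feasible_behead; exact: feasible_var.
- by move=> w v; rewrite drop0.
- by move=> w v p c; rewrite size_rcons -addn1 addnC -drop_drop drop1.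
- by move=> w v p _; rewrite size_drop leq_subr.
Qed.

Lemma feasible_pred_leq f g :
  feasible f -> feasible g -> feasible_pred (fun w v => size (f w v) <= size (g w v))%N.
Proof.
move=> hf hg; apply: feasible_pred_ext
  (feasible_pred_not (feasible_pred_nonempty (feasible_drop hf hg))) _ => w v.
by rewrite negbK -size_eq0 size_drop subn_eq0.
Qed.

Lemma feasible_pred_rec (p : oracle -> env -> word -> bool) x z h : feasible x ->
  feasible_pred z ->
  (forall c, feasible_pred (fun w v => h c w (v 0) (v 1 != [::]) (etl (etl v)))) ->
  (forall w v, p w v [::] = z w v) ->
  (forall w v y c, p w v (rcons y c) = h c w y (p w v y) v) ->
  feasible_pred (fun w v => p w v (x w v)).
Proof.
move=> hx hz hh p_nil p_rcons; pose bit (b : bool) : word := if b then [:: true] else [::].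
have bit_nonempty b : (bit b != [::]) = b by case: b.
have hbit q : feasible_pred q -> feasible (fun w v => bit (q w v)).
  by move=> hq; apply: feasible_if => //; exact: feasible_const.
suff hp : feasible (fun w v => bit (p w v (x w v))).
  by apply: feasible_pred_ext (feasible_pred_nonempty hp) _ => w v; exact: bit_nonempty.
apply: (@feasible_rec (fun w v y => bit (p w v y)) x (fun w v => bit (z w v))
  (fun c w y a v => bit (h c w y (a != [::]) v)) (fun w v => [:: true])) => //.
- exact: hbit.
- by move=> c; exact: hbit (hh c).
- exact: feasible_const.
- by move=> w v; rewrite p_nil.
- by move=> w v y c; rewrite p_rcons bit_nonempty.
- by move=> w v y _; case: (p w v y).
Qed.

Lemma feasible_pred_head f : feasible f -> feasible_pred (fun w v => head false (f w v)).
Proof.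
move=> hf; apply: (@feasible_pred_rec (fun w v x => head false x) f (fun w v => false)
  (fun c w p a v => if p != [::] then a else c)) => //.
- exact: feasible_pred_const.
- move=> c; apply: feasible_pred_if; last exact: feasible_pred_const.
    by apply: feasible_pred_nonempty; exact: feasible_var.
  by apply: feasible_pred_nonempty; exact: feasible_var.
- by move=> w v [].
Qed.

Lemma feasible_pred_eqb p b : feasible_pred p -> feasible_pred (fun w v => p w v == b).
Proof.
move=> hp; case: b; first by apply: feasible_pred_ext hp _ => w v; rewrite eqb_id.
by apply: feasible_pred_ext (feasible_pred_not hp) _ => w v; rewrite eqbF_neg.
Qed.

Lemma prefix_rcons_nth (x y : word) c : prefix (rcons x c) y =
  prefix x y && (~~ (size y <= size x)%N && (head false (drop (size x) y) == c)).
Proof.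
elim: x y => [|d x IH] [|b y] //=; last by rewrite IH andbA.
by rewrite prefix0s andbT eq_sym.
Qed.

Lemma feasible_pred_prefix f g :
  feasible f -> feasible g -> feasible_pred (fun w v => prefix (f w v) (g w v)).
Proof.
move=> hf hg; have hg2 := feasible_comp hg (feasible_env_shift 2).
apply: (@feasible_pred_rec (fun w v x => prefix x (g w v)) f (fun w v => true)
  (fun c w p a v => a && (~~ (size (g w v) <= size p)%N &&
                          (head false (drop (size p) (g w v)) == c)))) => //.
- exact: feasible_pred_const.
- move=> c; apply: feasible_pred_and; first by apply: feasible_pred_nonempty; exact: feasible_var.
  apply: feasible_pred_and.
    by apply: feasible_pred_not; apply: feasible_pred_leq; [exact: hg2|exact: feasible_var].
  by apply/feasible_pred_eqb/feasible_pred_head/feasible_drop; [exact: hg2|exact: feasible_var].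
- by move=> w v; rewrite prefix0s.
- by move=> w v p c; exact: prefix_rcons_nth.
Qed.

Lemma feasible_pred_eq f g :
  feasible f -> feasible g -> feasible_pred (fun w v => f w v == g w v).
Proof.
move=> hf hg; apply: feasible_pred_ext
  (feasible_pred_and (feasible_pred_prefix hf hg) (feasible_pred_leq hg hf)) _ => w v.
apply/andP/eqP => [[/prefixP[t ->]]|->]; last by rewrite prefix_refl.
by rewrite size_cat -[X in (_ <= X)%N]addn0 leq_add2l leqn0 => /nilP ->; rewrite cats0.
Qed.

Ltac feas_extension := fail.
Ltac feas := lazy beta delta [etl];
  match goal with
  | |- _ => assumption
  | |- feasible (fun w v => v _) => exact: feasible_var
  | |- feasible (fun w v => ?s) => exact: feasible_const
  | |- feasible (fun w v => _ ++ _) => apply: feasible_cat; feas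
  | |- feasible (fun w v => ?b :: _) => apply: feasible_cons; feas
  | |- feasible (fun w v => rcons _ ?b) => apply: feasible_rcons; feas
  | |- feasible (fun w v => flatten (nseq (size _) _)) => apply: feasible_times; feas
  | |- feasible (fun w v => take (size _) _) => apply: feasible_take; feas
  | |- feasible (fun w v => drop (size _) _) => apply: feasible_drop; feas
  | |- feasible (fun w v => if _ then _ else _) => apply: feasible_if; feas
  | |- feasible (fun w v => eeval w _ ?e) => apply: feasible_eval; feas
  | |- feasible_pred (fun w v => ?b) => exact: feasible_pred_const
  | |- feasible_pred (fun w v => _ && _) => apply: feasible_pred_and; feas
  | |- feasible_pred (fun w v => _ || _) => apply: feasible_pred_or; feas
  | |- feasible_pred (fun w v => (_ != [::])) => apply: feasible_pred_nonempty; feas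
  | |- feasible_pred (fun w v => ~~ _) => apply: feasible_pred_not; feas
  | |- feasible_pred (fun w v => if _ then _ else _) => apply: feasible_pred_if; feas
  | |- feasible_pred (fun w v => (size _ <= size _)%N) => apply: feasible_pred_leq; feas
  | |- feasible_pred (fun w v => prefix _ _) => apply: feasible_pred_prefix; feas
  | |- feasible_pred (fun w v => _ == _) => apply: feasible_pred_eq; feas
  | |- feasible_env (fun w v => econs _ _) => apply: feasible_env_econs; feas
  | |- feasible_env (fun w v n => v _) => by move=> ?; exact: feasible_var
  | |- feasible_env (fun w v => v) => exact: feasible_var
  | |- _ => feas_extension
  | H : feasible ?f |- feasible (fun w v => ?f w _) => apply: (feasible_comp H); feas
  | H : feasible_pred ?p |- feasible_pred (fun w v => ?p w _) => apply: (feasible_pred_comp H); feas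
  | |- _ => idtac
  end.

Lemma feasible_search_prefix t (q : oracle -> word -> env -> bool) :
  feasible t -> feasible_pred (fun w v => q w (v 0) (etl v)) ->
  exists g, [/\ feasible g, forall w v, prefix (g w v) (t w v) &
    forall w v p, prefix p (t w v) -> q w p v -> q w (g w v) v].
Proof.
move=> ht hq.
pose G w v (x : word) := (foldl (fun a c =>
  (rcons a.1 c, if q w a.2 v then a.2 else rcons a.1 c)) ([::], [::]) x).2.
have G_rcons w v x c : G w v (rcons x c) = if q w (G w v x) v then G w v x else rcons x c.
  rewrite /G foldl_rcons /=; set a := foldl _ _ _; suff -> : a.1 = x by [].
  by rewrite /a; elim/last_ind: x {a} => // x d IH; rewrite foldl_rcons /= IH.
have G_prefix w v x : prefix (G w v x) x.
  elim/last_ind: x => // x c IH; rewrite G_rcons; case: ifP => _; last exact: prefix_refl.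
  by apply: prefix_trans IH _; exact: prefix_rcons.
exists (fun w v => G w v (t w v)); split=> // [|w v].
  apply: (@feasible_rec G t (fun w v => [::])
    (fun c w p a v => if q w a v then a else rcons p c) t) => //; try by feas.
    move=> c; apply: feasible_if; try by feas.
    by apply: (feasible_pred_comp (E := fun w v => econs (v 1) (etl (etl v))) hq); feas.
  by move=> w v p /size_prefix; exact/leq_trans/size_prefix.
elim/last_ind: (t w v) => [|x c IH] p; first by rewrite prefixs0 => /eqP ->.
rewrite prefix_rconsE G_rcons => /orP[/IH h /h qG|/eqP -> h].
  by rewrite qG.
by case: ifP.
Qed.

Definition is_infix (x t : word) : Prop := exists a b, t = a ++ x ++ b.

(* An infix is a suffix of a prefix, hence two nested searches for a prefix. *)
Lemma feasible_search t (q : oracle -> word -> env -> bool) :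
  feasible t -> feasible_pred (fun w v => q w (v 0) (etl v)) ->
  exists g, [/\ feasible g, forall w v, is_infix (g w v) (t w v) &
    forall w v x, is_infix x (t w v) -> q w x v -> q w (g w v) v].
Proof.
move=> ht hq.
have hq_drop : feasible_pred (fun w v => q w (drop (size (v 0)) (etl v 0)) (etl (etl v))).
  by apply: (feasible_pred_comp
    (E := fun w v => econs (drop (size (v 0)) (v 1)) (etl (etl v))) hq); feas.
have [cut [hcut cut_prefix cutP]] := @feasible_search_prefix (fun w v => v 0)
  (fun w a v => q w (drop (size a) (v 0)) (etl v)) (feasible_var 0) hq_drop.
pose suffix w u v := drop (size (cut w (econs u v))) u.
have hsuffix g : feasible g -> feasible (fun w v => suffix w (g w v) v).
  by move=> hg; rewrite /suffix; feas.
have hq_suffix : feasible_pred (fun w v => q w (suffix w (v 0) (etl v)) (etl v)).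
  have hs : feasible (fun w v => suffix w (v 0) (etl v)) by rewrite /suffix; feas.
  exact: (feasible_pred_comp (E := fun w v => econs (suffix w (v 0) (etl v)) (etl v)) hq
    (feasible_env_econs hs (feasible_env_shift 1))).
have [top [htop top_prefix topP]] := feasible_search_prefix (q := fun w u v => q w (suffix w u v) v)
  ht hq_suffix.
exists (fun w v => suffix w (top w v) v); split=> [|w v|w v x [a [b tE]] hx].
- exact: hsuffix.
- have /prefixP[b ->] := top_prefix w v.
  exists (take (size (cut w (econs (top w v) v))) (top w v)), b.
  by rewrite catA cat_take_drop.
apply: (topP w v (a ++ _) _ _); first by rewrite tE catA; exact: prefix_prefix.
apply: (cutP w (econs (a ++ _) v) a); first exact: prefix_prefix.
by rewrite /= drop_size_cat //; exact: hx.
Qed.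

Definition leading_ones (x : word) : word := take (find negb x) x.

Lemma leading_ones_rcons x c : leading_ones (rcons x c) =
  if c && (leading_ones x == x) then rcons x c else leading_ones x.
Proof.
elim: x => [|b x IH]; first by case: c.
case: b; rewrite /leading_ones /=; last by rewrite andbF.
by rewrite -!/(leading_ones _) IH eqseq_cons /=; case: ifP.
Qed.

Lemma leading_ones_cat n x : leading_ones (nseq n true ++ false :: x) = nseq n true.
Proof. by elim: n => //= n IH; rewrite /leading_ones /= -/(leading_ones _) IH. Qed.

Lemma leading_ones_nseq n : leading_ones (nseq n true) = nseq n true.
Proof. by elim: n => //= n IH; rewrite /leading_ones /= -/(leading_ones _) IH. Qed.

Lemma feasible_leading_ones f : feasible f -> feasible (fun w v => leading_ones (f w v)).
Proof.
move=> hf; apply: (@feasible_rec (fun w v x => leading_ones x) f (fun w v => [::])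
  (fun c w p a v => if c && (a == p) then rcons p c else a) f) => //.
- exact: feasible_const.
- by move=> c; feas.
- by move=> w v p c; exact: leading_ones_rcons.
- by move=> w v p /size_prefix; apply: leq_trans; rewrite size_take_min geq_minr.
Qed.

Definition pair_word (x y : word) : word := nseq (size x) true ++ false :: x ++ y.
Definition pair_tail (p : word) : word := drop (size (true :: leading_ones p)) p.
Definition pair_fst (p : word) : word := take (size (leading_ones p)) (pair_tail p).
Definition pair_snd (p : word) : word := drop (size (leading_ones p)) (pair_tail p).

Lemma pair_tailK x y : pair_tail (pair_word x y) = x ++ y.
Proof.
rewrite /pair_tail /pair_word leading_ones_cat /= -cat_rcons drop_size_cat //.
by rewrite size_rcons.
Qed.

Lemma pair_fstK x y : pair_fst (pair_word x y) = x.
Proof. by rewrite /pair_fst pair_tailK leading_ones_cat size_nseq take_size_cat. Qed.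

Lemma pair_sndK x y : pair_snd (pair_word x y) = y.
Proof. by rewrite /pair_snd pair_tailK leading_ones_cat size_nseq drop_size_cat. Qed.

Lemma size_pair_word x y : size (pair_word x y) = ((size x).*2 + size y).+1.
Proof. by rewrite /pair_word size_cat size_nseq /= size_cat; lia. Qed.

Lemma feasible_pair_word f g :
  feasible f -> feasible g -> feasible (fun w v => pair_word (f w v) (g w v)).
Proof.
move=> hf hg; have h : feasible (fun w v =>
    flatten (nseq (size (f w v)) [:: true]) ++ false :: f w v ++ g w v) by feas.
by apply: feasible_ext h _ => w v; rewrite flatten_nseq1.
Qed.

Lemma feasible_pair_fst f : feasible f -> feasible (fun w v => pair_fst (f w v)).
Proof.
by move=> hf; have hl := feasible_leading_ones hf; rewrite /pair_fst /pair_tail; feas.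
Qed.

Lemma feasible_pair_snd f : feasible f -> feasible (fun w v => pair_snd (f w v)).
Proof.
by move=> hf; have hl := feasible_leading_ones hf; rewrite /pair_snd /pair_tail; feas.
Qed.

Ltac feas_extension ::=
  match goal with
  | |- feasible (fun w v => pair_word _ _) => apply: feasible_pair_word; feas
  | |- feasible (fun w v => pair_fst _) => apply: feasible_pair_fst; feas
  | |- feasible (fun w v => pair_snd _) => apply: feasible_pair_snd; feas
  | |- feasible (fun w v => leading_ones _) => apply: feasible_leading_ones; feas
  end.

(** * Bounded formulas are feasible *)

Lemma feasible_teval t E : feasible_env E -> feasible (fun w v => teval (E w v) t).
Proof. by move=> hE; elim: t => //= *; feas. Qed.

Definition holdsb w (v : env) F : bool := `[< holds w v F >].

Lemma holdsP w v F : reflect (holds w v F) (holdsb w v F).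
Proof. exact: asboolP. Qed.

Lemma subword_std w (x t : std w) : subword x t <-> is_infix x t.
Proof.
split=> [[u [_ /prefixP[b ->]]]|[a [b ->]]]; first by exists u, b; rewrite -catA.
by exists a; split; apply/prefixP; [exists (x ++ b)|exists b; rewrite -catA].
Qed.

Lemma holds_ex_subword w v t A :
  holds w v (ex_subword t A) <-> exists x, is_infix x (teval v t) /\ holds w (scons x v) A.
Proof.
rewrite holds_std sat_ex_subword -teval_std.
by split=> -[x [/(@subword_std w) hx /holds_std hA]]; exists x.
Qed.

Lemma feasible_subword_witness t A : feasible_pred (fun w v => holdsb w v A) ->
  exists g, [/\ feasible g, forall w v, is_infix (g w v) (teval v t) &
    forall w v, holds w v (ex_subword t A) -> holds w (scons (g w v) v) A].
Proof.
move=> hA; have hA' : feasible_pred (fun w v => holdsb w (scons (v 0) (etl v)) A).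
  by apply: feasible_pred_ext hA _ => w v; rewrite -[in LHS](econs_etl v).
have [g [hg g_infix gP]] := feasible_search (q := fun w x v => holdsb w (scons x v) A)
  (feasible_teval t (feasible_env_shift 0)) hA'.
exists g; split=> // w v /holds_ex_subword[x [hx /holdsP hxA]].
by apply/holdsP; exact: gP hx hxA.
Qed.

Lemma holds_all_subword_not w v t A :
  holds w v (all_subword t A) <-> ~ holds w v (ex_subword t (FNot A)).
Proof. by rewrite !holds_std sat_all_subword_not. Qed.

Lemma feasible_pred_ex_subword t A : feasible_pred (fun w v => holdsb w v A) ->
  feasible_pred (fun w v => holdsb w v (ex_subword t A)).
Proof.
move=> hA; have [g [hg g_infix gP]] := feasible_subword_witness t hA.
have h : feasible_pred (fun w v => holdsb w (econs (g w v) v) A).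
  by apply: (feasible_pred_comp (E := fun w v => econs (g w v) v) hA); feas.
apply: feasible_pred_ext h _ => w v; apply: asbool_equiv_eq; split=> [hgA|]; last exact: gP.
by apply/holds_ex_subword; exists (g w v).
Qed.

Lemma feasible_pred_holds F : subword_bounded F -> feasible_pred (fun w v => holdsb w v F).
Proof.
have hT t : feasible (fun w v => teval v t) := feasible_teval t (feasible_env_shift 0).
elim=> {F} [t|t s|t s|A _ IA|A B _ IA _ IB|A B _ IA _ IB|t A _ IA|t A _ IA].
- by apply: feasible_pred_ext (feasible_pred_flip (hT t)) _ => w v; rewrite /holdsb asboolb.
- apply: feasible_pred_ext (feasible_pred_eq (hT t) (hT s)) _ => w v.
  by apply/eqP/(holdsP w v (FEq t s)).
- apply: feasible_pred_ext (feasible_pred_prefix (hT t) (hT s)) _ => w v.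
  by rewrite /holdsb asboolb.
- by apply: feasible_pred_ext (feasible_pred_not IA) _ => w v; rewrite /holdsb /= asbool_neg.
- by apply: feasible_pred_ext (feasible_pred_and IA IB) _ => w v; rewrite /holdsb /= asbool_and.
- by apply: feasible_pred_ext (feasible_pred_or IA IB) _ => w v; rewrite /holdsb /= asbool_or.
- exact: feasible_pred_ex_subword.
have hN : feasible_pred (fun w v => holdsb w v (FNot A)).
  by apply: feasible_pred_ext (feasible_pred_not IA) _ => w v; rewrite /holdsb /= asbool_neg.
apply: feasible_pred_ext (feasible_pred_not (feasible_pred_ex_subword t hN)) _ => w v.
by rewrite /holdsb -asbool_neg; apply: asbool_equiv_eq; rewrite holds_all_subword_not.
Qed.

Lemma leq_size_teval v v' t : (forall i, (size (v i) <= size (v' i))%N) ->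
  (size (teval v t) <= size (teval v' t))%N.
Proof.
move=> h; elim: t => //= t IHt s IHs; first by rewrite !size_cat leq_add.
by rewrite !size_flatten_nseq leq_mul.
Qed.

Lemma teval_tsubst v f t : teval v (tsubst f t) = teval (fun n => teval v (f n)) t.
Proof. by elim: t => //= [t -> s ->|t -> s ->]. Qed.

Lemma Sigma1b_prenex B : Sigma1b B ->
  exists2 G, subword_bounded G & exists ts, B = foldr ex_le G ts.
Proof.
elim=> {B} [A hA|t A _ [G hG [ts ->]]]; first by exists A => //; exists [::].
by exists G => //; exists (t :: ts).
Qed.

(* The witnesses of all the bounded quantifiers are coded by a single word; it is required
   to be a code in normal form so that its length is bounded by a term. *)
Fixpoint witness (ts : seq term) (G : formula) (w : oracle) (z : word) (v : env) : bool :=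
  if ts is t :: ts' then
    [&& pair_word (pair_fst z) (pair_snd z) == z, (size (pair_fst z) <= size (teval v t))%N &
        witness ts' G w (pair_snd z) (econs (pair_fst z) v)]
  else (z == [::]) && holdsb w v G.

Fixpoint witness_bound (ts : seq term) : term :=
  if ts is t :: ts' then
    TCat (TCat t t) (TCat (TBit true) (tsubst (subst0 t) (witness_bound ts')))
  else TEps.

Lemma feasible_pred_witness ts G z E : subword_bounded G -> feasible z -> feasible_env E ->
  feasible_pred (fun w v => witness ts G w (z w v) (E w v)).
Proof.
move=> hG; elim: ts z E => [|t ts IH] z E hz hE /=.
  by have hGE := feasible_pred_comp (feasible_pred_holds hG) hE; feas.
have htail : feasible_pred (fun w v =>
    witness ts G w (pair_snd (z w v)) (econs (pair_fst (z w v)) (E w v))) by apply: IH; feas.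
by have hbound := feasible_teval t hE; feas.
Qed.

Lemma size_witness ts G w z v :
  witness ts G w z v -> (size z <= size (teval v (witness_bound ts)))%N.
Proof.
elim: ts z v => [|t ts IH] z v /=; first by move=> /andP[/eqP->].
move=> /and3P[/eqP zE h_fst /IH h_snd]; rewrite -{1}zE size_pair_word !size_cat /=.
suff : (size (teval (econs (pair_fst z) v) (witness_bound ts)) <=
        size (teval v (tsubst (subst0 t) (witness_bound ts))))%N by lia.
by rewrite teval_tsubst; apply: leq_size_teval; case.
Qed.

Lemma prefix_ones_leq (x y : word) :
  prefix (flatten (nseq (size x) [:: true])) (flatten (nseq (size y) [:: true])) =
  (size x <= size y)%N.
Proof.
rewrite !flatten_nseq1; apply/prefixP/idP => [[t h]|h].
  by rewrite -(size_nseq (size y) true) h size_cat size_nseq leq_addr.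
by exists (nseq (size y - size x) true); rewrite -nseqD subnKC.
Qed.

Lemma holds_ex_le w v t A : holds w v (ex_le t A) <->
  exists2 x, (size x <= size (teval v t))%N & holds w (scons x v) A.
Proof.
rewrite holds_std sat_ex_le -teval_std.
split=> [[x [/= hx /holds_std]]|[x hx /holds_std hA]]; exists x => //.
  by rewrite -prefix_ones_leq.
by rewrite /= prefix_ones_leq.
Qed.

Lemma witness_pair ts t G w x z v : witness (t :: ts) G w (pair_word x z) v =
  (size x <= size (teval v t))%N && witness ts G w z (econs x v).
Proof. by rewrite /= pair_fstK pair_sndK eqxx. Qed.

Lemma holds_witness ts G w v :
  holds w v (foldr ex_le G ts) <-> exists z, witness ts G w z v.
Proof.
elim: ts v => [|t ts IH] v.
  split=> [h|[z /andP[_ /holdsP]]] //; exists [::] => /=; exact/holdsP.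
rewrite [foldr _ _ _]/= holds_ex_le; split=> [[x hx /IH[z hz]]|[z /and3P[_ hx hz]]].
  by exists (pair_word x z); rewrite witness_pair hx.
by exists (pair_fst z) => //; apply/IH; exists (pair_snd z).
Qed.

(** * Witnessing, by a saturated restricted ultrapower *)

Fixpoint expr_tree (e : expr) : GenTree.tree nat :=
  match e with
  | EVar n => GenTree.Leaf n
  | EEps => GenTree.Node 0 [::]
  | EBit b => GenTree.Node (1 + b) [::]
  | ECat e1 e2 => GenTree.Node 3 [:: expr_tree e1; expr_tree e2]
  | ETimes e1 e2 => GenTree.Node 4 [:: expr_tree e1; expr_tree e2]
  | EFlip e1 => GenTree.Node 5 [:: expr_tree e1]
  | ERec x z s0 s1 B => GenTree.Node 6
      [:: expr_tree x; expr_tree z; expr_tree s0; expr_tree s1; expr_tree B]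
  end.

Fixpoint tree_expr (x : GenTree.tree nat) : expr :=
  match x with
  | GenTree.Leaf n => EVar n
  | GenTree.Node 1 _ => EBit false
  | GenTree.Node 2 _ => EBit true
  | GenTree.Node 3 [:: t; s] => ECat (tree_expr t) (tree_expr s)
  | GenTree.Node 4 [:: t; s] => ETimes (tree_expr t) (tree_expr s)
  | GenTree.Node 5 [:: t] => EFlip (tree_expr t)
  | GenTree.Node 6 [:: x; z; s; t; B] =>
      ERec (tree_expr x) (tree_expr z) (tree_expr s) (tree_expr t) (tree_expr B)
  | _ => EEps
  end.

Lemma expr_treeK : cancel expr_tree tree_expr.
Proof. by elim=> //= [[]//|e1 -> e2 ->|e1 -> e2 ->|e ->|x -> z -> s0 -> s1 -> B ->]. Qed.

Lemma feasible_pick (q : oracle -> word -> env -> bool) (es : seq expr) :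
  feasible_pred (fun w v => q w (v 0) (etl v)) ->
  exists h, forall w v, (exists2 e, List.In e es & q w (eeval w v e) v) -> q w (eeval w v h) v.
Proof.
move=> hq; elim: es => [|e es [h hP]]; first by exists EEps => w v [].
have he : feasible_pred (fun w v => q w (eeval w v e) v).
  by apply: (feasible_pred_comp (E := fun w v => econs (eeval w v e) v) hq); feas.
have [h' h'E] : feasible (fun w v => if q w (eeval w v e) v then eeval w v e else eeval w v h).
  by feas.
exists h' => w v [f hf qf]; rewrite h'E; case: ifP => // nqe.
by case: hf => [ef|hf]; [rewrite ef qf in nqe|apply: hP; exists f].
Qed.

Definition upd (v : env) (j : nat) (x : word) (i : nat) : word := if i == j then x else v i.

Lemma updE v j x : upd v j x j = x.
Proof. by rewrite /upd eqxx. Qed.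

Lemma updN v j x i : i != j -> upd v j x i = v i.
Proof. by rewrite /upd => /negbTE ->. Qed.

Lemma eeval_upd w v j x e : eeval w (upd v j (eeval w v x)) e =
  eeval w v (esubst (fun i => if i == j then x else EVar i) e).
Proof. by rewrite eeval_subst; congr eeval; apply/funext => i; rewrite /upd; case: eqP. Qed.

Lemma eeval_upd_fresh w v j x a b p : (ebound p <= j)%N ->
  eeval w (econs a (econs b (upd v j x))) p = eeval w (econs a (econs b v)) p.
Proof.
move=> pj; apply: (@eq_in_eeval _ _ _ _ j.+2); first by lia.
by case=> [|[|i]] //= ij; rewrite updN //; lia.
Qed.

Section Saturation.
Local Open Scope classical_set_scope.

Definition point : Type := (oracle * env)%type.

Definition inst_at (p c e : expr) (x : point) : Prop :=
  eeval x.1 (econs (eeval x.1 x.2 e) (econs (eeval x.1 x.2 c) x.2)) p <> [::].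

(* In the constraint [p(u, c, v)] on [c], universal in [u], a Skolem function for [u] is the
   only obstruction to the existence of [c]. *)
Definition saturated (U : set_system point) : Prop := forall p,
  (exists c, forall e, U (inst_at p c e)) \/
  (exists h, forall a, U (fun x => eeval x.1
     (econs (eeval x.1 (econs (eeval x.1 x.2 a) x.2) h) (econs (eeval x.1 x.2 a) x.2)) p = [::])).

(* The pair [(p, j)] stands for the constraint [p] on the variable [j]. *)
Definition constraint : Type := (expr * nat)%type.

Definition satisfies (x : point) (l : seq (constraint * expr)) : Prop :=
  forall q, List.In q l -> inst_at q.1.1 (EVar q.1.2) q.2 x.

Definition instances_of (G : seq constraint) (l : seq (constraint * expr)) : Prop :=
  forall q, List.In q l -> List.In q.1 G.

Definition finitely_satisfiable (G : seq constraint) : Prop :=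
  forall l, instances_of G l -> exists x, satisfies x l.

Definition fresh_constraint_var (p : expr) (G : seq constraint) : nat :=
  foldr (fun q n => maxn (maxn (ebound q.1) q.2.+1) n) (ebound p) G.

Lemma ebound_fresh_constraint_var p G : (ebound p <= fresh_constraint_var p G)%N.
Proof. by elim: G => //= q G IH; exact: leq_trans IH (leq_maxr _ _). Qed.

Lemma fresh_constraint_var_In p G q : List.In q G ->
  (ebound q.1 <= fresh_constraint_var p G)%N /\ (q.2 < fresh_constraint_var p G)%N.
Proof.
elim: G => //= q' G IH [->|/IH[hq1 hq2]].
  by split; apply: leq_trans (leq_maxl _ _); [exact: leq_maxl|exact: leq_maxr].
by split; [apply: leq_trans hq1 _|apply: leq_trans hq2 _]; exact: leq_maxr.
Qed.

Lemma inst_at_upd q e j a w v : (ebound q.1 <= j)%N -> (q.2 < j)%N ->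
  inst_at q.1 (EVar q.2) (esubst (fun i => if i == j then a else EVar i) e) (w, v) ->
  inst_at q.1 (EVar q.2) e (w, upd v j (eeval w v a)).
Proof.
move=> q1j q2j; rewrite /inst_at /= -eeval_upd eeval_upd_fresh // updN //; lia.
Qed.

(* If adding [p] on a fresh variable is inconsistent with finitely many instances of [G], then
   one of the finitely many terms occurring in them falsifies [p]. *)
Lemma unsatisfiable_skolem p G (j := fresh_constraint_var p G) :
  ~ finitely_satisfiable ((p, j) :: G) -> exists2 l, instances_of G l &
  exists h, forall a w v, satisfies (w, upd v j (eeval w v a)) l ->
    eeval w (econs (eeval w (econs (eeval w v a) v) h) (econs (eeval w v a) v)) p = [::].
Proof.
move=> unsat; have [l hl no_point] : exists2 l, instances_of ((p, j) :: G) l &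
    forall x, ~ satisfies x l.
  by move: unsat => /existsNP[l /not_implyP[hl /forallNP no_point]]; exists l.
pose in_G (q : constraint * expr) : bool := `[< List.In q.1 G >].
exists [seq q <- l | in_G q] => [q /List.filter_In[_ /asboolP]//|].
pose renaming i := if i == j then 0 else i.+1.
have hq : feasible_pred (fun w v => ~~ (eeval w (econs (v 0) (etl v)) p != [::])) by feas.
have [h hP] := feasible_pick (q := fun w u v => ~~ (eeval w (econs u v) p != [::]))
  [seq erename renaming q.2 | q <- l] hq.
exists h => a w v sat_G; set u := eeval w v a in sat_G *.
have [q lq nq] : exists2 q, List.In q l & ~ inst_at q.1.1 (EVar q.1.2) q.2 (w, upd v j u).
  apply: contrapT => h_all; apply: (no_point (w, upd v j u)) => q lq.
  by apply: contrapT => nq; apply: h_all; exists q.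
have qE : q.1 = (p, j).
  case: (hl _ lq) => // Gq; case: nq; apply: sat_G; apply/List.filter_In; split=> //.
  exact/asboolP.
have := hP w (econs u v); rewrite negbK => h_falsifies; apply/eqP/h_falsifies.
exists (erename renaming q.2); first by apply/List.in_map_iff; exists q.
move: nq; rewrite qE /inst_at /= updE eeval_upd_fresh ?ebound_fresh_constraint_var //.
move=> /contrapT qp; rewrite negbK eeval_rename -[X in _ == X]qp; apply/eqP.
by congr (eeval w (econs (eeval w _ _) _) p); apply/funext => i; rewrite /upd /renaming; case: eqP.
Qed.

Variable c0 : constraint.
Hypothesis c0_satisfiable : finitely_satisfiable [:: c0].

Fixpoint chain (n : nat) : seq constraint :=
  if n is m.+1 then
    let p := enumerate EEps tree_expr m in
    let c := (p, fresh_constraint_var p (chain m)) in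
    if `[< finitely_satisfiable (c :: chain m) >] then c :: chain m else chain m
  else [:: c0].

Lemma chain_satisfiable n : finitely_satisfiable (chain n).
Proof. by elim: n => //= n IH; case: asboolP. Qed.

Lemma chain_leq m n c : (m <= n)%N -> List.In c (chain m) -> List.In c (chain n).
Proof.
move=> /subnK <-; elim: (n - m)%N => //= k IH /IH h.
by case: asboolP => // _; right.
Qed.

Definition chain_filter : set_system point :=
  [set A | exists2 l, (exists n, instances_of (chain n) l) & forall x, satisfies x l -> A x].

Lemma chain_filter_proper : ProperFilter chain_filter.
Proof.
split; first by move=> [l [n /chain_satisfiable[x hx]]]; apply; exact: hx.
split.
- by exists [::] => //; exists 0.
- move=> A B [l [n hn] hA] [l' [n' hn'] hB]; exists (l ++ l').
    exists (maxn n n') => q /List.in_app_iff[/hn|/hn']; apply: chain_leq.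
      exact: leq_maxl.
    exact: leq_maxr.
  by move=> x hx; split; [apply: hA|apply: hB] => q hq; apply: hx; apply/List.in_app_iff; tauto.
- by move=> A B sAB [l hl hA]; exists l => // x /hA /sAB.
Qed.

Lemma saturated_ultrafilter : exists U : set_system point,
  [/\ UltraFilter U, forall e, U (inst_at c0.1 (EVar c0.2) e) & saturated U].
Proof.
have [U [hU sU]] := ultraFilterLemma chain_filter_proper.
have chainU c n e : List.In c (chain n) -> U (inst_at c.1 (EVar c.2) e).
  move=> hc; apply: sU; exists [:: (c, e)]; first by exists n => q [<-|].
  by move=> x h; exact: (h (c, e) (or_introl erefl)).
exists U; split=> // [e|p]; first by apply: (chainU c0 0); left.
have [n en] := enumerate_surj EEps expr_treeK p; pose j := fresh_constraint_var p (chain n).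
have [sat|unsat] := pselect (finitely_satisfiable ((p, j) :: chain n)); [left|right].
  exists (EVar j) => e; apply: (chainU (p, j) n.+1 e).
  by rewrite /= en -/j; case: asboolP => // _; left.
have [l hl [h hP]] := unsatisfiable_skolem unsat; exists h => a.
suff satU : U (fun x => satisfies (x.1, upd x.2 j (eeval x.1 x.2 a)) l).
  by apply: filterS satU => -[w v]; exact: hP.
elim: l hl {hP} => [|q l IH] hl; first by apply: filterE => x q [].
have hq : List.In q.1 (chain n) by apply: hl; left.
have [q1j q2j] := fresh_constraint_var_In p hq.
have satUl := IH (fun q' hq' => hl q' (or_intror hq')).
have := chainU _ _ (esubst (fun i => if i == j then a else EVar i) q.2) hq.
move=> /(filterI satUl); apply: filterS => -[w v] [sat_l sat_q] q' [<-|]; last exact: sat_l.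
exact: inst_at_upd sat_q.
Qed.

End Saturation.

Section GuardedRecursion.
Variables (D : oracle -> word -> word -> env -> bool) (z0 x B : oracle -> env -> word).
Variable s : bool -> oracle -> word -> word -> env -> word.
Hypotheses (hz0 : feasible z0) (hx : feasible x) (hB : feasible B).
Hypothesis hD : feasible_pred (fun w v => D w (v 0) (v 1) (etl (etl v))).
Hypothesis hs : forall b, feasible (fun w v => s b w (v 0) (v 1) (etl (etl v))).
Hypothesis D_bound : forall w v z y,
  prefix y (x w v) -> D w z y v -> (size z <= size (B w v))%N.

Definition guard w z y v : word := if D w z y v then z else [::].

Definition guarded_rec w v y : word := (foldl (fun a b =>
  (rcons a.1 b, guard w (s b w a.1 a.2 v) (rcons a.1 b) v)) ([::], guard w (z0 w v) [::] v) y).2.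

Lemma guarded_rec_rcons w v y b : guarded_rec w v (rcons y b) =
  guard w (s b w y (guarded_rec w v y) v) (rcons y b) v.
Proof.
rewrite /guarded_rec foldl_rcons /=; set a := foldl _ _ _; suff -> : a.1 = y by [].
by rewrite /a; elim/last_ind: y {a} => // y c IH; rewrite foldl_rcons /= IH.
Qed.

Lemma feasible_pred_guard z y E : feasible z -> feasible y -> feasible_env E ->
  feasible_pred (fun w v => D w (z w v) (y w v) (E w v)).
Proof.
by move=> hz hy hE; apply: (feasible_pred_comp
  (E := fun w v => econs (z w v) (econs (y w v) (E w v))) hD); feas.
Qed.

Lemma feasible_guard_step b y z E : feasible y -> feasible z -> feasible_env E ->
  feasible (fun w v => s b w (y w v) (z w v) (E w v)).
Proof.
by move=> hy hz hE; apply: (feasible_comp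
  (E := fun w v => econs (y w v) (econs (z w v) (E w v))) (hs b)); feas.
Qed.

Lemma feasible_guarded_rec y E : feasible y -> feasible_env E ->
  (forall w v, prefix (y w v) (x w (E w v))) ->
  feasible (fun w v => guarded_rec w (E w v) (y w v)).
Proof.
move=> hy hE y_prefix; have guardE z p F : feasible z -> feasible p -> feasible_env F ->
    feasible (fun w v => guard w (z w v) (p w v) (F w v)).
  by move=> hz hp hF; apply: feasible_if; [exact: feasible_pred_guard|by []|exact: feasible_const].
apply: (@feasible_rec (fun w v p => guarded_rec w (E w v) p) y
  (fun w v => guard w (z0 w (E w v)) [::] (E w v))
  (fun b w p a v => guard w (s b w p a (E w v)) (rcons p b) (E w v))
  (fun w v => B w (E w v))) => //.
- by apply: guardE; [exact: feasible_comp|exact: feasible_const|].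
- have hE2 : feasible_env (fun w v => E w (etl (etl v))).
    by move=> i; exact: (feasible_comp (hE i) (feasible_env_shift 2)).
  by move=> b; apply: guardE => //; [apply: feasible_guard_step|]; feas.
- exact: feasible_comp.
- by move=> w v p b; rewrite guarded_rec_rcons.
- move=> w v p hp; have p_prefix := prefix_trans hp (y_prefix w v).
  by case/lastP: p p_prefix {hp} => [|p b] p_prefix;
    rewrite ?guarded_rec_rcons /guarded_rec /= /guard; case: ifP => // hDp;
    exact: D_bound p_prefix hDp.
Qed.

Definition step_fails w v y : bool := D w (guarded_rec w v y) y v &&
  [exists b, ~~ D w (s b w y (guarded_rec w v y) v) (rcons y b) v].

Lemma guarded_rec_or_step_fails w v y : D w (z0 w v) [::] v ->
  D w (guarded_rec w v y) y v \/ exists2 p, prefix p y & step_fails w v p.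
Proof.
move=> hD0; elim/last_ind: y => [|y b [hDy|[p py hp]]].
- by left; rewrite /guarded_rec /= /guard hD0.
- have [hDb|nDb] := boolP (D w (s b w y (guarded_rec w v y) v) (rcons y b) v).
    by left; rewrite guarded_rec_rcons /guard hDb.
  right; exists y; first exact: prefix_rcons.
  by rewrite /step_fails hDy; apply/existsP; exists b.
- by right; exists p => //; exact: prefix_trans py (prefix_rcons _ _).
Qed.

(* The first failure along [x], if any, is found by a search among its prefixes. *)
Lemma feasible_induction : exists k y z, [/\ feasible k, feasible y, feasible z &
  forall w v, D w (z0 w v) [::] v -> D w (k w v) (x w v) v \/
    exists b, D w (z w v) (y w v) v && ~~ D w (s b w (y w v) (z w v) v) (rcons (y w v) b) v].
Proof.
pose cut w v (p : word) := take (size p) (x w v).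
have hcut p E : feasible p -> feasible_env E -> feasible (fun w v => cut w (E w v) (p w v)).
  by move=> hp hE; apply: feasible_take => //; exact: feasible_comp.
have hrec y E := @feasible_guarded_rec (fun w v => cut w (E w v) (y w v)) E.
have hfails : feasible_pred (fun w v => step_fails w (etl v) (cut w (etl v) (v 0))).
  have hE := feasible_env_shift 1; have hv := hcut _ _ (feasible_var 0) hE.
  have hK : feasible (fun w v => guarded_rec w (etl v) (cut w (etl v) (v 0))).
    by apply: hrec => // w v; exact: prefix_take.
  have hb b : feasible_pred (fun w v => let y := cut w (etl v) (v 0) in
      D w (s b w y (guarded_rec w (etl v) y) (etl v)) (rcons y b) (etl v)).
    by apply: feasible_pred_guard => //; [exact: feasible_guard_step|exact: feasible_rcons].
  apply: feasible_pred_and; first exact: feasible_pred_guard.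
  apply: feasible_pred_ext (feasible_pred_or (feasible_pred_not (hb false))
    (feasible_pred_not (hb true))) _ => w v.
  by apply/orP/existsP => [[]h|[[]h]]; [exists false|exists true|right|left].
have [g [hg g_prefix gP]] := @feasible_search_prefix x
  (fun w p v => step_fails w v (cut w v p)) hx hfails.
have cutE w v p : prefix p (x w v) -> cut w v p = p.
  by move=> /prefixP[t pE]; rewrite /cut pE take_size_cat.
have hv := feasible_env_shift 0.
exists (fun w v => guarded_rec w v (x w v)), g, (fun w v => guarded_rec w v (g w v)); split=> //.
- by apply: (feasible_guarded_rec hx hv) => w v; exact: prefix_refl.
- exact: (feasible_guarded_rec hg hv).
move=> w v /(guarded_rec_or_step_fails (x w v))[|[p px hp]]; [by left|right].
have := gP w v p px; rewrite !cutE // => /(_ hp)/andP[hDg /existsP[b nDb]].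
by exists b; rewrite hDg.
Qed.

End GuardedRecursion.

Lemma refuting_ultrafilter (q : oracle -> word -> env -> bool) :
  feasible_pred (fun w v => q w (v 0) (etl v)) ->
  ~ (exists e, forall w v, q w (eeval w v e) v) ->
  exists U : set_system point, [/\ UltraFilter U, saturated U &
    forall e, U (fun x => ~~ q x.1 (eeval x.1 x.2 e) x.2)].
Proof.
move=> hq none.
have [p pE] : feasible_pred (fun w v => ~~ q w (v 0) (etl (etl v))).
  apply: feasible_pred_not.
  by apply: (feasible_pred_comp (E := fun w v => econs (v 0) (etl (etl v))) hq); feas.
have instE e w v : inst_at p (EVar 0) e (w, v) <-> ~~ q w (eeval w v e) v.
  by rewrite /inst_at /= -[~~ _](pE w (econs (eeval w v e) (econs (v 0) v))); split=> /eqP.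
have [|U [hU pU sU]] := @saturated_ultrafilter (p, 0).
  move=> l hl; apply: contrapT => no_point; apply: none.
  have [h hP] := feasible_pick [seq c.2 | c <- l] hq; exists h => w v; apply: hP.
  apply: contrapT => no_e; apply: no_point; exists (w, v) => c lc; case: (hl c lc) => // <-.
  apply/instE/negP => qc; apply: no_e; exists c.2 => //.
  by apply/List.in_map_iff; exists c.
by exists U; split=> // e; apply: filterS (pU e) => -[w v] /instE.
Qed.

Section Ultrapower.
Local Open Scope classical_set_scope.
Variable U : set_system point.
Hypothesis hU : UltraFilter U.

Definition ae (P : oracle -> env -> Prop) : Prop := U (fun x => P x.1 x.2).

Lemma ae_all P : (forall w v, P w v) -> ae P.
Proof. by move=> h; apply: filterE => -[w v]; exact: h. Qed.

Lemma ae_mono P Q : (forall w v, P w v -> Q w v) -> ae P -> ae Q.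
Proof. by move=> h; apply: filterS => -[w v]; exact: h. Qed.

Lemma ae_and P Q : ae (fun w v => P w v /\ Q w v) <-> ae P /\ ae Q.
Proof.
split=> [h|[hP hQ]]; last exact: filterI.
by split; apply: ae_mono h => w v [].
Qed.

Lemma ae_mono2 P Q S : (forall w v, P w v -> Q w v -> S w v) -> ae P -> ae Q -> ae S.
Proof. by move=> h hP hQ; apply: ae_mono ((ae_and P Q).2 (conj hP hQ)) => w v [/h]; exact. Qed.

Lemma ae_not P : ae (fun w v => ~ P w v) <-> ~ ae P.
Proof.
split=> [nP hP|nP].
  by have [x [hx /(_ hx)]] := filter_ex (filterI hP nP).
by have [] := in_ultra_setVsetC (fun x : point => P x.1 x.2) hU.
Qed.

Lemma ae_false : ~ ae (fun _ _ => False).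
Proof. by move=> /filter_ex[]. Qed.

Lemma ae_or P Q : ae (fun w v => P w v \/ Q w v) <-> ae P \/ ae Q.
Proof.
split=> [h|[]]; first last.
- by apply: ae_mono => w v; right.
- by apply: ae_mono => w v; left.
apply: contrapT => /not_orP[/ae_not nP /ae_not nQ]; apply: ae_false.
by apply: ae_mono2 h ((ae_and _ _).2 (conj nP nQ)) => w v [hP|hQ] [].
Qed.

Definition ultrapower : structure.
Proof.
refine (@Structure expr EEps EBit ECat ETimes
  (fun e e' => ae (fun w v => prefix (eeval w v e) (eeval w v e')))
  (fun e => ae (fun w v => w (eeval w v e) = true))
  (fun e e' => ae (fun w v => eeval w v e = eeval w v e')) _ _ _ _ _ _ _).
- by move=> x; exact: ae_all.
- by move=> x y; apply: ae_mono => w v ->.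
- by move=> x y z; apply: ae_mono2 => w v -> ->.
- by move=> x x' y y'; apply: ae_mono2 => w v /= -> ->.
- by move=> x x' y y'; apply: ae_mono2 => w v /= -> ->.
- by move=> x x' y y' ex ey; apply: ae_mono2 ((ae_and _ _).2 (conj ex ey)) => w v [-> ->].
- by move=> x x'; apply: ae_mono2 => w v ->.
Defined.

Definition eval_env (r : nat -> ultrapower) w v : env := fun n => eeval w v (r n).

Lemma feasible_eval_env r E : feasible_env E -> feasible_env (fun w v => eval_env r w (E w v)).
Proof. by move=> hE i; exact: feasible_eval. Qed.

Lemma eeval_seval (r : nat -> ultrapower) w v t : eeval w v (seval r t) = teval (eval_env r w v) t.
Proof. by elim: t => //= [t -> s ->|t -> s ->]. Qed.

Lemma eval_env_econs (x : ultrapower) r w v :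
  eval_env (econs x r) w v = econs (eeval w v x) (eval_env r w v).
Proof. by apply/funext => -[]. Qed.

Lemma subword_ultrapower (x t : ultrapower) :
  subword x t <-> ae (fun w v => is_infix (eeval w v x) (eeval w v t)).
Proof.
split=> [[u [hu hux]]|h].
  by apply: ae_mono2 hu hux => w v hu hux; apply/(@subword_std w); exists (eeval w v u).
have hq : feasible_pred (fun w v => prefix (v 0 ++ v 1) (v 2)) by feas.
have [g [hg g_prefix gP]] := @feasible_search_prefix (fun w v => v 1)
  (fun w u v => prefix (u ++ v 0) (v 1)) (feasible_var 1) hq.
have [u uE] : feasible (fun w v => g w (econs (eeval w v x) (econs (eeval w v t) v))).
  by apply: feasible_comp hg _; apply: feasible_env_econs;
    [exists x|apply: feasible_env_econs; [exists t|exact: (feasible_env_shift 0)]].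
exists u; split; first by apply: ae_all => w v; rewrite uE; exact: g_prefix.
apply: ae_mono h => w v /(@subword_std w)[a [ha hax]] /=; rewrite uE.
exact: gP w (econs _ (econs _ v)) a ha hax.
Qed.

Lemma los_ex_subword t A : subword_bounded A ->
  (forall r, sat r A <-> ae (fun w v => holds w (eval_env r w v) A)) ->
  forall r : nat -> ultrapower,
  sat r (ex_subword t A) <-> ae (fun w v => holds w (eval_env r w v) (ex_subword t A)).
Proof.
move=> hA losA r; rewrite sat_ex_subword; split=> [[x [/subword_ultrapower hx /losA hxA]]|h].
  apply: ae_mono2 hx hxA => w v; rewrite eval_env_econs eeval_seval => hx hxA.
  by apply/holds_ex_subword; exists (eeval w v x).
have [g [hg g_infix gP]] := feasible_subword_witness t (feasible_pred_holds hA).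
have [x xE] := feasible_comp hg (feasible_eval_env r (feasible_env_shift 0)).
exists x; split.
  by apply/subword_ultrapower/ae_all => w v; rewrite xE eeval_seval; exact: g_infix.
by apply/losA; apply: ae_mono h => w v /gP; rewrite eval_env_econs xE.
Qed.

Lemma los F (r : nat -> ultrapower) : subword_bounded F ->
  sat r F <-> ae (fun w v => holds w (eval_env r w v) F).
Proof.
move=> hF; elim: hF r => {F} [t|t s|t s|A _ IA|A B _ IA _ IB|A B _ IA _ IB|t A hA IA|t A hA IA] r.
- by split; apply: ae_mono => w v; rewrite /= eeval_seval.
- by split; apply: ae_mono => w v; rewrite /= !eeval_seval.
- by split; apply: ae_mono => w v; rewrite /= !eeval_seval.
- by rewrite /= IA ae_not.
- by rewrite /= IA IB ae_and.
- by rewrite /= IA IB ae_or.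
- exact: los_ex_subword.
rewrite sat_all_subword_not los_ex_subword; first last.
- by move=> q; rewrite /= IA ae_not.
- exact: SB_Not.
by rewrite -ae_not; split; apply: ae_mono => w v /holds_all_subword_not.
Qed.

Lemma los_witness ts G (r : nat -> ultrapower) : subword_bounded G ->
  sat r (foldr ex_le G ts) <->
  exists e, ae (fun w v => witness ts G w (eeval w v e) (eval_env r w v)).
Proof.
move=> hG; elim: ts r => [|t ts IH] r.
  rewrite [foldr _ _ _]/= (los _ hG); split=> [h|[e]].
    by exists EEps; apply: ae_mono h => w v /holdsP.
  by apply: ae_mono => w v /andP[_ /holdsP].
have ex_leP x : s_pre (s_times (s_bit true) x) (s_times (s_bit true) (seval r t)) <->
    ae (fun w v => (size (eeval w v x) <= size (teval (eval_env r w v) t))%N).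
  by split; apply: ae_mono => w v; rewrite /= prefix_ones_leq eeval_seval.
rewrite [foldr _ _ _]/= sat_ex_le; split=> [[x [/ex_leP hx /IH[e he]]]|[z hz]].
  have [u uE] : feasible (fun w v => pair_word (eeval w v x) (eeval w v e)).
    by apply: feasible_pair_word; [exists x|exists e].
  by exists u; apply: ae_mono2 hx he => w v; rewrite uE witness_pair eval_env_econs => -> ->.
have [x xE] : feasible (fun w v => pair_fst (eeval w v z)) by apply: feasible_pair_fst; exists z.
have [e eE] : feasible (fun w v => pair_snd (eeval w v z)) by apply: feasible_pair_snd; exists z.
exists x; split; last first.
  by apply/IH; exists e; apply: ae_mono hz => w v /and3P[_ _]; rewrite eE eval_env_econs xE.
by apply/ex_leP; apply: ae_mono hz => w v /and3P[_]; rewrite xE.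
Qed.

Hypothesis sU : saturated U.

Lemma saturated_feasible (q : oracle -> word -> word -> env -> bool) :
  feasible_pred (fun w v => q w (v 0) (v 1) (etl (etl v))) ->
  (exists c, forall e, ae (fun w v => q w (eeval w v e) (eeval w v c) v)) \/
  (exists h, forall a, ae (fun w v => ~~ q w (eeval w (econs (eeval w v a) v) h) (eeval w v a) v)).
Proof.
move=> [p pE]; have [[c hc]|[h hh]] := sU p; [left; exists c => e|right; exists h => a].
  by apply: filterS (hc e) => -[w v] /eqP; rewrite pE.
by apply: filterS (hh a) => -[w v] /eqP; rewrite -[_ == _]negbK pE.
Qed.

Section Induction.
Variables (ts : seq term) (G : formula) (r : nat -> ultrapower).
Hypothesis hG : subword_bounded G.

Definition solves w (z y : word) v : bool := witness ts G w z (econs y (eval_env r w v)).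

Lemma feasible_pred_solves z y E : feasible z -> feasible y -> feasible_env E ->
  feasible_pred (fun w v => solves w (z w v) (y w v) (E w v)).
Proof.
move=> hz hy hE; apply: feasible_pred_witness => //.
by apply: feasible_env_econs => //; exact: feasible_eval_env.
Qed.

Lemma sat_solves (x : ultrapower) : sat (econs x r) (foldr ex_le G ts) <->
  exists e, ae (fun w v => solves w (eeval w v e) (eeval w v x) v).
Proof.
by rewrite los_witness //; split=> -[e he]; exists e; apply: ae_mono he => w v;
  rewrite eval_env_econs.
Qed.

Lemma solves_step b :
  (forall x : ultrapower, sat (econs x r) (foldr ex_le G ts) ->
    sat (econs (s_cat x (s_bit b)) r) (foldr ex_le G ts)) ->
  exists h, forall a, ae (fun w v =>
    let: (y, z) := (pair_fst (eeval w v a), pair_snd (eeval w v a)) in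
    solves w z y v ==> solves w (eeval w (econs (eeval w v a) v) h) (rcons y b) v).
Proof.
move=> hstep; have hq : feasible_pred (fun w v =>
    solves w (pair_snd (v 1)) (pair_fst (v 1)) (etl (etl v)) &&
    ~~ solves w (v 0) (rcons (pair_fst (v 1)) b) (etl (etl v))).
  by apply: feasible_pred_and; [|apply: feasible_pred_not]; apply: feasible_pred_solves; feas.
have [[c hc]|[h hh]] := saturated_feasible (q := fun w u a v =>
  solves w (pair_snd a) (pair_fst a) v && ~~ solves w u (rcons (pair_fst a) b) v) hq; last first.
  by exists h => a; apply: ae_mono (hh a) => w v; rewrite negb_and negbK -implybE.
have [y yE] : feasible (fun w v => pair_fst (eeval w v c)) by apply: feasible_pair_fst; exists c.
have [z zE] : feasible (fun w v => pair_snd (eeval w v c)) by apply: feasible_pair_snd; exists c.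
have /hstep/sat_solves[e he] : sat (econs (y : ultrapower) r) (foldr ex_le G ts).
  by apply/sat_solves; exists z; apply: ae_mono (hc EEps) => w v /andP[]; rewrite yE zE.
exfalso; apply: ae_false.
by apply: ae_mono2 he (hc e) => w v; rewrite /= yE cats1 => -> /andP[].
Qed.

Lemma ultrapower_induction :
  sat (econs (s_eps : ultrapower) r) (foldr ex_le G ts) ->
  (forall (x : ultrapower) b, sat (econs x r) (foldr ex_le G ts) ->
    sat (econs (s_cat x (s_bit b)) r) (foldr ex_le G ts)) ->
  forall x : ultrapower, sat (econs x r) (foldr ex_le G ts).
Proof.
move=> /sat_solves[e0 e0_solves] hstep X.
have [h hh] : exists h : bool -> expr, forall b a, ae (fun w v =>
    let: (y, z) := (pair_fst (eeval w v a), pair_snd (eeval w v a)) in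
    solves w z y v ==> solves w (eeval w (econs (eeval w v a) v) (h b)) (rcons y b) v).
  have step b := cid (solves_step (fun x => hstep x b)).
  by exists (fun b => projT1 (step b)) => b; exact: projT2 (step b).
have hX : feasible (fun w v => eeval w v X) by exists X.
pose step b w y z v := eeval w (econs (pair_word y z) v) (h b).
pose bound w v := teval (econs (eeval w v X) (eval_env r w v)) (witness_bound ts).
have hbound : feasible bound.
  apply: feasible_teval; apply: feasible_env_econs => //.
  exact/feasible_eval_env/(feasible_env_shift 0).
have hsolves : feasible_pred (fun w v => solves w (v 0) (v 1) (etl (etl v))).
  by apply: feasible_pred_solves; feas.
have hstep_feasible b : feasible (fun w v => step b w (v 0) (v 1) (etl (etl v))).
  by apply: feasible_eval; feas.
have solves_bound w v z y : prefix y (eeval w v X) -> solves w z y v ->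
    (size z <= size (bound w v))%N.
  move=> /size_prefix hy /size_witness hz; apply: leq_trans hz (leq_size_teval _ _).
  by case.
have he0 : feasible (fun w v => eeval w v e0) by exists e0.
have [k [y [z [[k' kE] hy hz kP]]]] :=
  feasible_induction he0 hX hbound hsolves hstep_feasible solves_bound.
apply/sat_solves; exists k'; apply: contrapT => /ae_not not_k.
have [a aE] := feasible_pair_word hy hz.
have fails b : ~ ae (fun w v => solves w (z w v) (y w v) v &&
    ~~ solves w (step b w (y w v) (z w v) v) (rcons (y w v) b) v).
  move=> hb; exfalso; apply: ae_false.
  by apply: ae_mono2 hb (hh b a) => w v; rewrite aE pair_fstK pair_sndK => /andP[-> /negbTE->].
suff /ae_or[/fails|/fails] : ae (fun w v => (solves w (z w v) (y w v) v &&
      ~~ solves w (step false w (y w v) (z w v) v) (rcons (y w v) false) v) \/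
    (solves w (z w v) (y w v) v &&
      ~~ solves w (step true w (y w v) (z w v) v) (rcons (y w v) true) v)) by [].
apply: ae_mono2 e0_solves not_k => w v /kP[hk|[[] hb]]; rewrite kE //; by [right|left].
Qed.

End Induction.

Lemma sat_ultrapower_NIA A (r : nat -> ultrapower) : NIA A -> sat r A.
Proof.
have sat_bounded F : subword_bounded F -> NIA F -> sat r F.
  move=> hF hN; apply/los => //; apply: ae_all => w v; apply/holds_std.
  exact: (std_NIA w).2.
case=> [x|b x y|x|b x y|x|b x y|b x y|x y|b x|B x hB]; last first.
  have [G hG [ts ->]] := Sigma1b_prenex hB.
  by apply/sat_induction; exact: ultrapower_induction.
all: by apply: sat_bounded; repeat constructor.
Qed.

End Ultrapower.

Theorem witnessing G k : Sigma1b G -> proves NIA [::] (iter k FAll (ex_unique G)) ->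
  exists e, forall w v, holds w (scons (eeval w v e) v) G.
Proof.
move=> /Sigma1b_prenex[F hF [ts ->]] NIA_G.
pose q w u v := witness ts F w (pair_snd u) (econs (pair_fst u) v).
have hq : feasible_pred (fun w v => q w (v 0) (etl v)) by apply: feasible_pred_witness => //; feas.
have [[e he]|none] := pselect (exists e, forall w v, q w (eeval w v e) v).
  have [y yE] : feasible (fun w v => pair_fst (eeval w v e)) by apply: feasible_pair_fst; exists e.
  by exists y => w v; apply/holds_witness; exists (pair_snd (eeval w v e)); rewrite yE; exact: he.
have [U [hU sU nqU]] := refuting_ultrafilter hq none.
have /sat_iterAll/(_ EVar)/sat_ex_unique[y hy _] :
    forall r : nat -> ultrapower hU, sat r (iter k FAll (ex_unique (foldr ex_le F ts))).
  by move=> r; apply: (soundness _ NIA_G) => // B q'; exact: sat_ultrapower_NIA.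
have [e he] := (los_witness _ _ hF).1 hy.
have [u uE] : feasible (fun w v => pair_word (eeval w v y) (eeval w v e)).
  by apply: feasible_pair_word; [exists y|exists e].
exfalso; apply: (ae_false hU).
have nq_u : ae U (fun w v => ~~ q w (eeval w v u) v) := nqU u.
by apply: ae_mono2 he nq_u => // w v; rewrite uE /q pair_fstK pair_sndK eval_env_econs => ->.
Qed.

(** * Lazy sampling of the oracle *)

Fixpoint dtree_bind (I S T : Type) (t : dtree I S) (f : S -> dtree I T) : dtree I T :=
  match t with DLeaf a => f a | DNode i k => DNode i (fun b => dtree_bind (k b) f) end.

Lemma dtree_run_bind (I S T : Type) (w : I -> bool) (t : dtree I S) (f : S -> dtree I T) :
  dtree_run w (dtree_bind t f) = dtree_run w (f (dtree_run w t)).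
Proof. by elim: t => //= i k IH; rewrite IH. Qed.

Fixpoint query_rec (b : nat) (h : bool -> word -> word -> dtree word word) (a : word * word)
    (x : word) : dtree word word :=
  if x is c :: x' then
    dtree_bind (h c a.1 a.2) (fun r => query_rec b h (rcons a.1 c, take b r) x')
  else DLeaf a.2.

Fixpoint query_tree (v : env) (e : expr) : dtree word word :=
  match e with
  | EVar i => DLeaf (v i)
  | EEps => DLeaf [::]
  | EBit b => DLeaf [:: b]
  | ECat e1 e2 => dtree_bind (query_tree v e1) (fun x =>
      dtree_bind (query_tree v e2) (fun y => DLeaf (x ++ y)))
  | ETimes e1 e2 => dtree_bind (query_tree v e1) (fun x =>
      dtree_bind (query_tree v e2) (fun y => DLeaf (flatten (nseq (size y) x))))
  | EFlip e1 => dtree_bind (query_tree v e1) (fun q =>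
      DNode q (fun b => DLeaf (if b then [:: true] else [::])))
  | ERec x z s0 s1 B => dtree_bind (query_tree v x) (fun x' =>
      dtree_bind (query_tree v z) (fun z' => dtree_bind (query_tree v B) (fun B' =>
        query_rec (size B') (fun c p a => query_tree (econs p (econs a v)) (if c then s1 else s0))
          ([::], take (size B') z') x')))
  end.

Lemma dtree_run_query_rec w b h g a x : (forall c p r, dtree_run w (h c p r) = g c p r) ->
  dtree_run w (query_rec b h a x) = (rec_pair b g a x).2.
Proof. by move=> e; elim: x a => //= c x IH a; rewrite dtree_run_bind IH e. Qed.

Lemma dtree_run_query_tree w v e : dtree_run w (query_tree v e) = eeval w v e.
Proof.
elim: e v => //= [e1 IH1 e2 IH2|e1 IH1 e2 IH2|e1 IH1|x IHx z IHz s0 IH0 s1 IH1 B IHB] v;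
  rewrite !dtree_run_bind /= ?dtree_run_bind ?IH1 ?IH2 //=.
by rewrite IHx IHz IHB; apply: dtree_run_query_rec => -[].
Qed.

Fixpoint tree_bounded (l n d : nat) (t : dtree word word) : Prop :=
  match t with
  | DLeaf a => (size a <= l)%N
  | DNode q k => [/\ (size q <= n)%N, (0 < d)%N & forall b, tree_bounded l n d.-1 (k b)]
  end.

Lemma tree_bounded_mono l l' n n' d d' t : (l <= l')%N -> (n <= n')%N -> (d <= d')%N ->
  tree_bounded l n d t -> tree_bounded l' n' d' t.
Proof.
move=> hl hn; elim: t d d' => [a d d' _ ha|q k IH d d' hd [hq d0 hk]] /=.
  exact: leq_trans hl.
split; first exact: leq_trans hn.
  exact: leq_trans hd.
by move=> b; apply: IH (hk b); lia.
Qed.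

Lemma tree_bounded_bind l n d l' n' d' t f : tree_bounded l n d t ->
  (forall a, (size a <= l)%N -> tree_bounded l' n' d' (f a)) ->
  tree_bounded l' (n + n') (d + d') (dtree_bind t f).
Proof.
move=> + hf; elim: t d => [a d ha|q k IH d [hq d0 hk]] /=.
  by apply: tree_bounded_mono (hf a ha) => //; exact: leq_addl.
split; first exact: leq_trans hq (leq_addr _ _).
  by lia.
move=> b.
have -> : (d + d').-1 = (d.-1 + d')%N by lia.
exact: IH (hk b).
Qed.

Lemma tree_bounded_bind_run l n d w (t : dtree word word) f :
  tree_bounded l n d (dtree_bind t f) -> tree_bounded l n d (f (dtree_run w t)).
Proof.
elim: t d => //= q k IH d [_ _ hk]; apply: tree_bounded_mono (IH _ _ (hk (w q))) => //.
exact: leq_pred.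
Qed.

Lemma tree_bounded_run l n d w t : tree_bounded l n d t -> (size (dtree_run w t) <= l)%N.
Proof. by elim: t d => //= q k IH d [_ _ hk]; exact: IH (hk _). Qed.

Lemma tree_bounded_query_rec b m n d h a x :
  (forall c p r, (size p < m)%N -> (size r <= b)%N -> exists l, tree_bounded l n d (h c p r)) ->
  (size a.2 <= b)%N -> (size a.1 + size x <= m)%N ->
  tree_bounded b (n * size x) (d * size x) (query_rec b h a x).
Proof.
move=> hh; elim: x a => [|c x IH] a a2 a1 //=.
have [l hl] : exists l, tree_bounded l n d (h c a.1 a.2) by apply: hh => //; move: a1 => /=; lia.
rewrite !mulnS; apply: (tree_bounded_bind hl) => r _; apply: IH => /=.
  by rewrite size_take_min geq_minl.
by rewrite size_rcons addSnnS.
Qed.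

Definition term_bounded (L N : term) (t : env -> dtree word word) : Prop := forall v,
  tree_bounded (size (teval v L)) (size (teval v N)) (size (teval v N)) (t v).

Lemma term_bounded_bind L N L' N' t f : term_bounded L N t ->
  (forall v a, (size a <= size (teval v L))%N ->
    tree_bounded (size (teval v L')) (size (teval v N')) (size (teval v N')) (f v a)) ->
  term_bounded L' (TCat N N') (fun v => dtree_bind (t v) (f v)).
Proof.
by move=> ht hf v; rewrite [teval v (TCat _ _)]/= size_cat; apply: tree_bounded_bind (ht v) (hf v).
Qed.

Lemma term_bounded_query_tree e : exists L N, term_bounded L N (query_tree ^~ e).
Proof.
elim: e => [i||b|e1 [L1 [N1 h1]] e2 [L2 [N2 h2]]|e1 [L1 [N1 h1]] e2 [L2 [N2 h2]]|e1 [L1 [N1 h1]]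
  |x [Lx [Nx hx]] z [Lz [Nz hz]] s0 [L0 [N0 h0]] s1 [L1 [N1 h1]] B [LB [NB hB]]].
- by exists (TVar i), TEps => v /=.
- by exists TEps, TEps => v /=.
- by exists (TBit b), TEps => v /=.
- exists (TCat L1 L2), (TCat N1 (TCat N2 TEps)).
  apply: (term_bounded_bind h1) => v a ha; rewrite [teval v (TCat N2 _)]/= size_cat.
  apply: (tree_bounded_bind (h2 v)) => a' ha' /=.
  by rewrite !size_cat leq_add.
- exists (TTimes L1 L2), (TCat N1 (TCat N2 TEps)).
  apply: (term_bounded_bind h1) => v a ha; rewrite [teval v (TCat N2 _)]/= size_cat.
  apply: (tree_bounded_bind (h2 v)) => a' ha' /=.
  by rewrite !size_flatten_nseq leq_mul.
- exists (TBit true), (TCat N1 (TCat (TBit true) L1)).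
  apply: (term_bounded_bind h1) => v a ha /=; split=> //; first exact: leqW.
  by case.
pose sb (n : nat) : term := match n with 0 => Lx | 1 => LB | m.+2 => TVar m end.
pose Ns := tsubst sb (TCat N0 N1).
exists LB, (TCat Nx (TCat Nz (TCat NB (TTimes Ns Lx)))).
apply: (term_bounded_bind hx) => v x' hx'; rewrite [teval v (TCat Nz _)]/= size_cat.
apply: (tree_bounded_bind (hz v)) => z' hz'; rewrite size_cat.
apply: (tree_bounded_bind (hB v)) => B' hB'; rewrite size_flatten_nseq.
set n := size (teval v Ns).
pose h c p a := query_tree (econs p (econs a v)) (if c then s1 else s0).
suff hs : tree_bounded (size B') (n * size x') (n * size x')
    (query_rec (size B') h ([::], take (size B') z') x').
  by apply: tree_bounded_mono hs => //; rewrite leq_mul2l hx' orbT.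
apply: (@tree_bounded_query_rec _ (size x')) => [c p a hp ha||]; last 2 first.
- by rewrite size_take_min geq_minl.
- by [].
have mono t : (size (teval (econs p (econs a v)) t) <= size (teval v (tsubst sb t)))%N.
  by rewrite teval_tsubst; apply: leq_size_teval => -[|[|i]] //=; lia.
have nE : n = (size (teval v (tsubst sb N0)) + size (teval v (tsubst sb N1)))%N.
  by rewrite -size_cat.
have := mono N0; have := mono N1; case: c => m1 m0.
  by exists (size (teval (econs p (econs a v)) L1)); apply: tree_bounded_mono (h1 _) => //; lia.
by exists (size (teval (econs p (econs a v)) L0)); apply: tree_bounded_mono (h0 _) => //; lia.
Qed.

Definition table : Type := seq (word * bool).

Definition lookup (l : table) (q : word) : option bool :=
  if (q, true) \in l then Some true else if (q, false) \in l then Some false else None.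

Definition answer (lk : word -> option bool) (q : word) : bool := lk q == Some true.

Fixpoint first_miss (lk : word -> option bool) (t : dtree word word) : option word :=
  if t is DNode q k then
    if lk q is Some b then first_miss lk (k b) else Some q
  else None.

Definition sample (t : dtree word word) (l : table) (b : bool) : table :=
  if first_miss (lookup l) t is Some q then (q, b) :: l else l.

Fixpoint prune (l : table) (t : dtree word word) : dtree word word :=
  if t is DNode q k then
    if lookup l q is Some b then prune l (k b) else DNode q (fun b => prune ((q, b) :: l) (k b))
  else t.

Lemma lookup_unzip1 l q : (lookup l q == None) = (q \notin unzip1 l).
Proof.
rewrite /lookup; have [h|h_true] := boolP ((q, true) \in l).
  by rewrite (map_f fst h : q \in unzip1 l).
have [h|h_false] := boolP ((q, false) \in l); first by rewrite (map_f fst h : q \in unzip1 l).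
by apply/esym/mapP => -[[q' []] hq /= e]; [move: h_true|move: h_false]; rewrite e hq.
Qed.

Lemma lookup_agree l (w : oracle) q b :
  (forall p, p \in l -> w p.1 = p.2) -> lookup l q = Some b -> w q = b.
Proof.
move=> hl; rewrite /lookup; case: ifP => [/hl /= -> [->] //|_].
by case: ifP => [/hl /= -> [->]|].
Qed.

Lemma lookup_cons q b l q' : lookup l q = None -> lookup ((q, b) :: l) q' =
  if q' == q then Some b else lookup l q'.
Proof.
move=> hq; rewrite /lookup !inE !xpair_eqE; case: eqP => [->|_] //=.
move: hq; rewrite /lookup; case: ifP => // h1; case: ifP => // h2 _.
by case: b; rewrite ?h1.
Qed.

Lemma prune_fresh l t : dtree_fresh (unzip1 l) (prune l t).
Proof.
elim: t l => //= q k IH l; case e: (lookup l q) => [b|]; first exact: IH.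
split=> [|b]; first by rewrite -lookup_unzip1 e.
exact: (IH b ((q, b) :: l)).
Qed.

Lemma prune_run l t (w : oracle) : (forall p, p \in l -> w p.1 = p.2) ->
  dtree_run w (prune l t) = dtree_run w t.
Proof.
elim: t l => //= q k IH l hl; case e: (lookup l q) => [b|] /=.
  by rewrite (lookup_agree hl e); exact: IH.
by apply: IH => p; rewrite inE => /orP[/eqP->//|]; exact: hl.
Qed.

Lemma tree_bounded_prune l n d tb t : tree_bounded l n d t -> tree_bounded l n d (prune tb t).
Proof.
elim: t d tb => //= q k IH d tb [hq d0 hk]; case: (lookup tb q) => [b|] /=.
  by apply: tree_bounded_mono (IH b _ tb (hk b)) => //; exact: leq_pred.
by split=> // b; exact: IH.
Qed.

Lemma prune_node l t q k' : prune l t = DNode q k' ->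
  first_miss (lookup l) t = Some q /\ forall b, k' b = prune ((q, b) :: l) t.
Proof.
elim: t => //= q0 k IH; case e: (lookup l q0) => [b0|]; last first.
  by move=> [<- <-]; split=> // b; rewrite lookup_cons // eqxx.
move=> h; have [miss k'E] := IH _ h; split=> // b; rewrite k'E.
have := prune_fresh l (k b0); rewrite h => -[ql _].
rewrite lookup_cons; last by apply/eqP; rewrite lookup_unzip1.
by rewrite ifN ?e //; apply: contraNneq ql => <-; rewrite -[_ \in _]negbK -lookup_unzip1 e.
Qed.

Lemma prune_leaf l t a : prune l t = DLeaf a ->
  first_miss (lookup l) t = None /\ dtree_run (answer (lookup l)) t = a.
Proof.
elim: t => /= [a' [->]//|q k IH]; case e: (lookup l q) => [b|] //.
by rewrite /answer e => /IH; case: b {e}.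
Qed.

Definition sampled_table (t : dtree word word) (r : word) : table := foldl (sample t) [::] r.

Definition lazy_run (t : dtree word word) (r : word) : word :=
  dtree_run (answer (lookup (sampled_table t r))) t.

Section Sampling.
Local Open Scope ring_scope.
Variable R : realType.

Lemma word_weight_lazy_run (t : dtree word word) (y : word) l m n p :
  tree_bounded l m n (prune (sampled_table t p) t) ->
  word_weight R y n p (lazy_run t) = dtree_weight R y (prune (sampled_table t p) t).
Proof.
have sampleE p' b : sampled_table t (rcons p' b) = sample t (sampled_table t p') b.
  exact: foldl_rcons.
elim: n p => [|n IH] p; case e: (prune _ t) => [a|q k'] //=.
- by have [_ <-] := prune_leaf e.
- by case.
- have [miss _] := prune_leaf e.
  have rE b : sampled_table t (rcons p b) = sampled_table t p by rewrite sampleE /sample miss.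
  move=> ha; rewrite !IH ?rE ?e //= -mulrDl (_ : 2^-1 + 2^-1 = 1) ?mul1r //.
  by rewrite -mulr2n -[RHS](@mulVf _ (2 : R)) ?pnatr_eq0 // mulr_natr.
have [miss k'E] := prune_node e.
have rE b : sampled_table t (rcons p b) = (q, b) :: sampled_table t p.
  by rewrite sampleE /sample miss.
by move=> [_ _ hk]; rewrite !IH ?rE -?k'E //=; exact: hk.
Qed.

End Sampling.

(* The empty word stands for the absence of a missing query. *)
Definition miss_word (lk : word -> option bool) (t : dtree word word) : word :=
  if first_miss lk t is Some q then true :: q else [::].

Lemma first_miss_bind lk t f : first_miss lk (dtree_bind t f) =
  if first_miss lk t is Some q then Some q else first_miss lk (f (dtree_run (answer lk) t)).
Proof.
elim: t => //= q k IH; rewrite /answer; case: (lk q) => [b|] //.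
by rewrite IH; case: b.
Qed.

Lemma miss_word_bind lk t f : miss_word lk (dtree_bind t f) =
  if miss_word lk t != [::] then miss_word lk t else miss_word lk (f (dtree_run (answer lk) t)).
Proof. by rewrite /miss_word first_miss_bind; case: (first_miss lk t). Qed.

Lemma miss_word_query_rec_rcons lk b h a x c : miss_word lk (query_rec b h a (rcons x c)) =
  if miss_word lk (query_rec b h a x) != [::] then miss_word lk (query_rec b h a x)
  else miss_word lk (h c (a.1 ++ x) (dtree_run (answer lk) (query_rec b h a x))).
Proof.
elim: x a => [|d x IH] a.
  by rewrite /= miss_word_bind cats0 {3}/miss_word /=; case: (miss_word _ _).
rewrite /= !miss_word_bind; case: (miss_word lk (h d a.1 a.2)) => //=.
by rewrite IH dtree_run_bind /= cat_rcons.
Qed.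

Lemma size_miss_word_query_rec lk b h a p x : prefix p x ->
  (size (miss_word lk (query_rec b h a p)) <= size (miss_word lk (query_rec b h a x)))%N.
Proof.
move=> /prefixP[t ->]; elim/last_ind: t => [|t c IH]; first by rewrite cats0.
rewrite -rcons_cat miss_word_query_rec_rcons; case: eqP => //= e.
by move: IH; rewrite e leqn0 => /nilP ->.
Qed.

Lemma size_miss_word l n d lk t : tree_bounded l n d t -> (size (miss_word lk t) <= n.+1)%N.
Proof.
rewrite /miss_word; elim: t d => //= q k IH d [hq _ hk]; case: (lk q) => [b|] //=.
exact: IH (hk b).
Qed.

Definition table_word (l : table) : word := foldr (fun p a => pair_word (p.2 :: p.1) a) [::] l.

Lemma size_table_word_cons p l :
  size (table_word (p :: l)) = (((size p.1).*2 + size (table_word l)).+3)%N.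
Proof.
by rewrite -[table_word (p :: l)]/(pair_word (p.2 :: p.1) (table_word l)) size_pair_word /=; lia.
Qed.

Definition skip_entry (x a : word) : word :=
  if (a == [::]) || (pair_fst a == x) then a else pair_snd a.

Definition table_mem (a x : word) : bool := iter (size a) (skip_entry x) a != [::].

Lemma iter_skip_entry k l q b : iter k (skip_entry (b :: q)) (table_word l) =
  table_word (drop (minn k (index (q, b) l)) l).
Proof.
elim: l k => [k|[q' b'] l IH [|k]]; first by rewrite iter_fix.
  by rewrite min0n drop0.
rewrite iterSr {2}/skip_entry [table_word _]/= pair_fstK pair_sndK eqseq_cons /= xpair_eqE andbC.
case: ifP => [/andP[/eqP-> /eqP->]|_]; last by rewrite minnSS IH.
by rewrite minn0 drop0 iter_fix // /skip_entry /= pair_fstK eqxx.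
Qed.

Lemma table_mem_word l q b : table_mem (table_word l) (b :: q) = ((q, b) \in l).
Proof.
have size_l : (size l <= size (table_word l))%N.
  by elim: l => // p l IH; rewrite size_table_word_cons /=; lia.
rewrite /table_mem iter_skip_entry (minn_idPr (leq_trans (index_size _ _) size_l)) -index_mem.
case e: (drop _ l) => [|p l']; move/(congr1 size): e; rewrite size_drop /=; lia.
Qed.

Definition table_lookup (a q : word) : option bool :=
  if table_mem a (true :: q) then Some true
  else if table_mem a (false :: q) then Some false else None.

Lemma table_lookup_word l : table_lookup (table_word l) = lookup l.
Proof. by apply/funext => q; rewrite /table_lookup !table_mem_word. Qed.

Lemma feasible_pred_table_mem f g :
  feasible f -> feasible g -> feasible_pred (fun w v => table_mem (f w v) (g w v)).
Proof.
move=> hf hg; apply: feasible_pred_nonempty.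
apply: (@feasible_rec (fun w v p => iter (size p) (skip_entry (g w v)) (f w v)) f f
  (fun c w p a v => skip_entry (g w v) a) f) => //.
- by move=> c; have hg2 := feasible_comp hg (feasible_env_shift 2); rewrite /skip_entry; feas.
- by move=> w v p c; rewrite size_rcons.
- move=> w v p _; elim: (size p) => //= n; apply: leq_trans.
  by rewrite /skip_entry; case: ifP => // _; rewrite !size_drop; lia.
Qed.

Lemma feasible_pred_table_answer f g : feasible f -> feasible g ->
  feasible_pred (fun w v => answer (table_lookup (f w v)) (g w v)).
Proof.
move=> hf hg; have hb b : feasible (fun w v => b :: g w v) by feas.
apply: feasible_pred_ext (feasible_pred_table_mem hf (hb true)) _ => w v.
by rewrite /answer /table_lookup; case: ifP => // _; case: ifP.
Qed.

Lemma feasible_pred_table_miss f g : feasible f -> feasible g ->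
  feasible_pred (fun w v => table_lookup (f w v) (g w v) == None).
Proof.
move=> hf hg; have hb b : feasible (fun w v => b :: g w v) by feas.
have hm b := feasible_pred_not (feasible_pred_table_mem hf (hb b)).
apply: feasible_pred_ext (feasible_pred_and (hm true) (hm false)) _ => w v.
by rewrite /table_lookup; case: ifP => // _; case: ifP.
Qed.

Definition relativizes (e : expr) : Prop := forall tb E, feasible tb -> feasible_env E ->
  feasible (fun w v => eeval (answer (table_lookup (tb w v))) (E w v) e).

Lemma feasible_relative_rec x z B s0 s1 tb E : relativizes s0 -> relativizes s1 ->
  feasible x -> feasible z -> feasible B -> feasible tb -> feasible_env E ->
  feasible (fun w v => bounded_rec (size (B w v)) (fun c p a =>
    eeval (answer (table_lookup (tb w v))) (econs p (econs a (E w v))) (if c then s1 else s0))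
    (z w v) (x w v)).
Proof.
move=> h0 h1 hx hz hB htb hE; pose ans w v := answer (table_lookup (tb w v)).
apply: (feasible_bounded_rec (h := fun c w p a v =>
    eeval (ans w v) (econs p (econs a (E w v))) (if c then s1 else s0))) => // c.
have htb2 := feasible_comp htb (feasible_env_shift 2).
have hE2 : feasible_env (fun w v => econs (v 0) (econs (v 1) (E w (etl (etl v))))).
  have hE2 i := feasible_comp (hE i) (feasible_env_shift 2).
  by case=> [|[|i]]; [exact: feasible_var|exact: feasible_var|exact: hE2].
by case: c; [exact: h1 htb2 hE2|exact: h0 htb2 hE2].
Qed.

Lemma feasible_relative e : relativizes e.
Proof.
elim: e => /= [i||b|e1 IH1 e2 IH2|e1 IH1 e2 IH2|e1 IH1|x IHx z IHz s0 IH0 s1 IH1 B IHB] tb E htb hE.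
- exact: hE.
- exact: feasible_const.
- exact: feasible_const.
- exact: feasible_cat (IH1 _ _ htb hE) (IH2 _ _ htb hE).
- exact: feasible_times (IH1 _ _ htb hE) (IH2 _ _ htb hE).
- have hq := feasible_pred_table_answer htb (IH1 _ _ htb hE).
  by apply: feasible_if => //; exact: feasible_const.
- have hx := IHx _ _ htb hE; have hz := IHz _ _ htb hE; have hB := IHB _ _ htb hE.
  exact: feasible_relative_rec IH0 IH1 hx hz hB htb hE.
Qed.

Lemma feasible_if_nonempty f g : feasible f -> feasible g ->
  feasible (fun w v => if f w v != [::] then f w v else g w v).
Proof. by move=> hf hg; apply: feasible_if => //; exact: feasible_pred_nonempty. Qed.

Definition miss_feasible (e : expr) : Prop := forall tb E, feasible tb -> feasible_env E ->
  feasible (fun w v => miss_word (table_lookup (tb w v)) (query_tree (E w v) e)).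

Lemma feasible_miss_flip e : miss_feasible e -> miss_feasible (EFlip e).
Proof.
move=> IH tb E htb hE; have he := feasible_relative e htb hE.
have hnone := feasible_pred_table_miss htb he.
have hmiss : feasible (fun w v =>
    if table_lookup (tb w v) (eeval (answer (table_lookup (tb w v))) (E w v) e) == None
    then true :: eeval (answer (table_lookup (tb w v))) (E w v) e else [::]) by feas.
apply: feasible_ext (feasible_if_nonempty (IH _ _ htb hE) hmiss) _ => w v.
rewrite /= miss_word_bind dtree_run_query_tree; case: ifP => // _.
by rewrite /miss_word /=; case: (table_lookup _ _) => [[]|].
Qed.

Lemma feasible_miss_rec x z s0 s1 B : miss_feasible x -> miss_feasible z -> miss_feasible s0 ->
  miss_feasible s1 -> miss_feasible B -> miss_feasible (ERec x z s0 s1 B).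
Proof.
move=> IHx IHz IH0 IH1 IHB tb E htb hE; pose lk w v := table_lookup (tb w v).
pose val w v e := eeval (answer (lk w v)) (E w v) e.
have hval e : feasible (fun w v => val w v e) := feasible_relative e htb hE.
pose h w v c p a := query_tree (econs p (econs a (E w v))) (if c then s1 else s0).
pose q w v := query_rec (size (val w v B)) (h w v) ([::], take (size (val w v B)) (val w v z)).
pose miss w v p := miss_word (lk w v) (q w v p).
have q_run w v p : dtree_run (answer (lk w v)) (q w v p) = bounded_rec (size (val w v B))
    (fun c p a => eeval (answer (lk w v)) (econs p (econs a (E w v))) (if c then s1 else s0))
    (val w v z) p.
  by apply: dtree_run_query_rec => c p' a; exact: dtree_run_query_tree.
have hmiss : feasible (fun w v => miss w v (val w v x)).
  have [L [N bounded]] := term_bounded_query_tree (ERec x z s0 s1 B).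
  apply: (@feasible_rec miss _ (fun w v => [::]) (fun c w p a v => if a != [::] then a else
    miss_word (lk w v) (h w v c p (dtree_run (answer (lk w v)) (q w v p))))
    (fun w v => true :: teval (E w v) N)) => //.
  - exact: feasible_const.
  - have hE2 i := feasible_comp (hE i) (feasible_env_shift 2).
    have htb2 := feasible_comp htb (feasible_env_shift 2).
    have hq : feasible (fun w v =>
        dtree_run (answer (lk w (etl (etl v)))) (q w (etl (etl v)) (v 0))).
      have hrec := feasible_relative_rec (feasible_relative s0) (feasible_relative s1)
        (feasible_var 0) (feasible_comp (hval z) (feasible_env_shift 2))
        (feasible_comp (hval B) (feasible_env_shift 2)) htb2 hE2.
      by apply: feasible_ext hrec _ => w v; rewrite q_run.
    move=> c; apply: feasible_if_nonempty; first exact: feasible_var.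
    have hEc := feasible_env_econs (feasible_var 0) (feasible_env_econs hq hE2).
    by case: c; [exact: IH1 htb2 hEc|exact: IH0 htb2 hEc].
  - by have hN := feasible_teval N hE; feas.
  - by move=> w v p c; rewrite /miss /q miss_word_query_rec_rcons.
  move=> w v p /size_miss_word_query_rec hp; apply: leq_trans (hp _ _ _ _) _.
  have := bounded (E w v) => /= /(tree_bounded_bind_run (answer (lk w v))).
  move=> /(tree_bounded_bind_run (answer (lk w v)))/(tree_bounded_bind_run (answer (lk w v))).
  by rewrite !dtree_run_query_tree; exact: size_miss_word.
have hrec := feasible_if_nonempty (IHB _ _ htb hE) hmiss.
apply: feasible_ext (feasible_if_nonempty (IHx _ _ htb hE)
  (feasible_if_nonempty (IHz _ _ htb hE) hrec)) _ => w v.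
by rewrite /= !miss_word_bind !dtree_run_query_tree.
Qed.

Lemma feasible_miss e : miss_feasible e.
Proof.
have miss2 e1 e2 (f : word -> word -> word) (op : expr -> expr -> expr) :
    (forall v, query_tree v (op e1 e2) = dtree_bind (query_tree v e1) (fun x =>
      dtree_bind (query_tree v e2) (fun y => DLeaf (f x y)))) ->
    miss_feasible e1 -> miss_feasible e2 -> miss_feasible (op e1 e2).
  move=> opE IH1 IH2 tb E htb hE.
  apply: feasible_ext (feasible_if_nonempty (IH1 _ _ htb hE) (IH2 _ _ htb hE)) _ => w v.
  rewrite opE !miss_word_bind; case: (miss_word _ (query_tree _ e1)) => //=.
  by case: (miss_word _ _).
elim: e => [i||b|e1 IH1 e2 IH2|e1 IH1 e2 IH2|e1 IH1|x IHx z IHz s0 IH0 s1 IH1 B IHB].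
- by move=> tb E _ _; exact: (feasible_const [::]).
- by move=> tb E _ _; exact: (feasible_const [::]).
- by move=> tb E _ _; exact: (feasible_const [::]).
- exact: (miss2 _ _ _ ECat).
- exact: (miss2 _ _ _ ETimes).
- exact: feasible_miss_flip.
- exact: feasible_miss_rec.
Qed.

Lemma size_sampled_table l n d t r : tree_bounded l n d t ->
  (size (table_word (sampled_table t r)) <= (3 + n + n) * size r)%N.
Proof.
move=> ht; elim/last_ind: r => [|r c IH] //.
rewrite /sampled_table foldl_rcons -/(sampled_table t r) size_rcons mulnS.
have := size_miss_word (lookup (sampled_table t r)) ht; rewrite /sample /miss_word.
by case: (first_miss _ _) => [q|_]; rewrite ?size_table_word_cons /=; lia.
Qed.

Lemma feasible_sampled_table e :
  feasible (fun w v => table_word (sampled_table (query_tree (etl v) e) (v 0))).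
Proof.
have [L [N bounded]] := term_bounded_query_tree e.
pose bound v := flatten (nseq (size (v 0))
  ([:: true; true; true] ++ teval (etl v) N ++ teval (etl v) N)).
apply: (@feasible_rec (fun w v p => table_word (sampled_table (query_tree (etl v) e) p))
  (fun w v => v 0) (fun w v => [::]) (fun c w p a v =>
    let q := miss_word (table_lookup a) (query_tree (etl v) e) in
    if q != [::] then pair_word (c :: behead q) a else a) (fun w v => bound v)) => //.
- exact: feasible_var.
- exact: feasible_const.
- have hm : feasible (fun w v => miss_word (table_lookup (v 1)) (query_tree (etl (etl (etl v))) e)).
    exact: (feasible_miss e (feasible_var 1) (feasible_env_shift 3)).
  by move=> c; lazy zeta; feas; exact: feasible_behead hm.
- by have hN := feasible_teval N (feasible_env_shift 1); rewrite /bound; feas.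
- move=> w v p c; rewrite {1}/sampled_table foldl_rcons -/(sampled_table _ _) table_lookup_word.
  by rewrite /sample /miss_word; case: (first_miss _ _).
- move=> w v p /size_prefix hp; apply: leq_trans (size_sampled_table p (bounded (etl v))) _.
  by rewrite size_flatten_nseq !size_cat addnA leq_mul2l hp orbT.
Qed.

Lemma feasible_lazy_run e : feasible (fun w v => lazy_run (query_tree (etl v) e) (v 0)).
Proof.
have h := feasible_relative e (feasible_sampled_table e) (feasible_env_shift 1).
apply: feasible_ext h _ => w v.
by rewrite table_lookup_word /lazy_run dtree_run_query_tree.
Qed.

(** * Register machines on a multitrack tape *)

Section Tracks.
Variable K : nat.

Notation cell := {ffun 'I_K -> option bool}.
Notation sym := (symbol (option cell)).
Notation Home := (@Work (option cell) None).
Notation Cel c := (@Work (option cell) (Some c)).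
Implicit Types (s : env) (c : cell) (cs : seq cell).

Definition no_cell : cell := [ffun=> None].

Definition track c (d : nat) : option bool := if insub d is Some r then c r else None.

Definition set_track c (d : nat) (b : option bool) : cell :=
  [ffun r => if val r == d then b else c r].

Definition head_cell s : cell := [ffun r => ohead (s (val r))].

Definition behead_regs s : env := fun r => behead (s r).

(* Register [r] is written from left to right on track [r] of the tape. *)
Fixpoint cells (n : nat) s : seq cell :=
  if n is n'.+1 then head_cell s :: cells n' (behead_regs s) else [::].

Definition fits (n : nat) s : Prop := forall r, (r < K)%N -> (size (s r) <= n)%N.

Lemma set_track_id c d : set_track c d (track c d) = c.
Proof. by apply/ffunP => r; rewrite ffunE /track; case: eqP => // <-; rewrite valK. Qed.

Lemma track_head_cell s d : (d < K)%N -> track (head_cell s) d = ohead (s d).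
Proof. by move=> dK; rewrite /track insubT ffunE. Qed.

Lemma head_cell_upd s d u : head_cell (upd s d u) = set_track (head_cell s) d (ohead u).
Proof. by apply/ffunP => r; rewrite !ffunE /upd; case: eqP. Qed.

Lemma behead_regs_upd s d u : behead_regs (upd s d u) = upd (behead_regs s) d (behead u).
Proof. by apply/funext => r; rewrite /behead_regs /upd; case: eqP. Qed.

Lemma fits_behead n s : fits n.+1 s -> fits n (behead_regs s).
Proof. by move=> h r /h; rewrite size_behead; case: (size _). Qed.

Lemma size_cells n s : size (cells n s) = n.
Proof. by elim: n s => //= n IH s; rewrite IH. Qed.

Lemma rcons_cells n s : fits n s -> rcons (cells n s) no_cell = cells n.+1 s.
Proof.
elim: n s => [|n IH] s h; last by rewrite [LHS]/= IH //; exact: fits_behead.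
congr cons; apply/ffunP => r; rewrite !ffunE.
by have := h _ (ltn_ord r); rewrite leqn0 => /nilP ->.
Qed.

Lemma cells_upd n s d (b : cell -> option bool) (F : env -> word) :
  (forall q, ohead (F q) = b (head_cell q)) ->
  (forall q, behead (F q) = F (behead_regs q)) ->
  cells n (upd s d (F s)) = [seq set_track c d (b c) | c <- cells n s].
Proof.
move=> head_F behead_F; elim: n s => //= n IH s.
by rewrite head_cell_upd behead_regs_upd head_F behead_F IH.
Qed.

Definition scanner : Type := option bool -> cell -> option bool * cell.

Fixpoint scan_right (f : scanner) (q : option bool) cs : option bool * seq cell :=
  if cs is c :: cs' then
    let r := scan_right f (f q c).1 cs' in (r.1, (f q c).2 :: r.2)
  else (q, [::]).

Fixpoint scan_left (f : scanner) (q : option bool) cs : option bool * seq cell :=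
  if cs is c :: cs' then
    let r := scan_left f q cs' in ((f r.1 c).1, (f r.1 c).2 :: r.2)
  else (q, [::]).

Lemma scan_right_rcons f q cs c : scan_right f q (rcons cs c) =
  let r := scan_right f q cs in ((f r.1 c).1, rcons r.2 (f r.1 c).2).
Proof. by elim: cs q => //= c' cs IH q; rewrite IH. Qed.

Lemma scan_left_rcons f q cs c : scan_left f q (rcons cs c) =
  let r := scan_left f (f q c).1 cs in (r.1, rcons r.2 (f q c).2).
Proof. by elim: cs => //= c' cs IH; rewrite IH. Qed.

Lemma size_scan_right f q cs : size (scan_right f q cs).2 = size cs.
Proof. by elim: cs q => //= c cs IH q; rewrite IH. Qed.

Lemma scan_right_map g q cs : scan_right (fun q c => (q, g c)) q cs = (q, map g cs).
Proof. by elim: cs => //= c cs ->. Qed.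

Lemma scan_left_id q cs : scan_left pair q cs = (q, cs).
Proof. by elim: cs => //= c cs ->. Qed.

Definition push_track (d : nat) : scanner := fun q c =>
  if q is Some b then
    if track c d is None then (None, set_track c d (Some b)) else (q, c)
  else (q, c).

Definition pop_track (d : nat) : scanner := fun q c => (track c d, set_track c d q).

Lemma scan_right_push n s d b : (d < K)%N -> (size (s d) < n)%N ->
  scan_right (push_track d) (Some b) (cells n s) = (None, cells n (upd s d (rcons (s d) b))).
Proof.
move=> dK; have idle cs : scan_right (push_track d) None cs = (None, cs).
  by elim: cs => //= c cs ->.
elim: n s => // n IH s hs /=; rewrite track_head_cell // head_cell_upd behead_regs_upd.
case e: (s d) hs => [|b' u] hs /=.
  have behead_d : upd (behead_regs s) d [::] = behead_regs s.
    by apply/funext => r; rewrite /upd /behead_regs; case: eqP => // ->; rewrite e.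
  by rewrite idle behead_d.
have -> : set_track (head_cell s) d (Some b') = head_cell s.
  by rewrite -[RHS](set_track_id _ d) track_head_cell // e.
have behead_d : behead_regs s d = u by rewrite /behead_regs e.
by rewrite IH behead_d.
Qed.

Lemma scan_left_pop n s d : (d < K)%N -> fits n s ->
  scan_left (pop_track d) None (cells n s) = (ohead (s d), cells n (upd s d (behead (s d)))).
Proof.
move=> dK; elim: n s => [|n IH] s hs /=; first by have := hs d dK; rewrite leqn0 => /nilP ->.
by rewrite IH ?track_head_cell ?head_cell_upd ?behead_regs_upd //; exact: fits_behead.
Qed.

Inductive prim : Type :=
| Copy of nat & nat
| Clear of nat
| Push of nat & bool
| Pop of nat
| Trunc of nat & nat
| Coin of nat.

Definition prim_init (o : prim) (b : bool) : option bool :=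
  match o with Push _ b' => Some b' | Coin _ => Some b | _ => None end.

Definition forward (o : prim) : scanner :=
  match o with
  | Copy d r => fun q c => (q, set_track c d (track c r))
  | Clear d => fun q c => (q, set_track c d None)
  | Push d _ | Coin d => push_track d
  | Pop d => fun q c => (q, id c)
  | Trunc d r => fun q c => (q, set_track c d (if track c r is None then None else track c d))
  end.

Definition backward (o : prim) : scanner := if o is Pop d then pop_track d else pair.

Definition prim_effect (o : prim) (b : bool) s : env :=
  match o with
  | Copy d r => upd s d (s r)
  | Clear d => upd s d [::]
  | Push d b' => upd s d (rcons (s d) b')
  | Pop d => upd s d (behead (s d))
  | Trunc d r => upd s d (take (size (s r)) (s d))
  | Coin d => upd s d (rcons (s d) b)
  end.

Definition prim_exit (o : prim) s : option bool := if o is Pop d then ohead (s d) else None.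

Definition prim_regs (o : prim) : nat :=
  match o with
  | Copy d r | Trunc d r => (maxn d r).+1
  | Clear d | Push d _ | Pop d | Coin d => d.+1
  end.

Lemma fits_prim_effect o b n s : (prim_regs o <= K)%N -> fits n s -> fits n.+1 (prim_effect o b s).
Proof.
move=> oK hs r hr; have := hs _ hr.
case: o oK => [d r'|d|d b'|d|d r'|d] /= oK; rewrite /upd; case: eqP => [e|_];
  rewrite ?size_rcons ?size_behead ?size_take_min -?e //; try by lia.
by move: (hs r'); lia.
Qed.

Lemma prim_scan o b n s : (prim_regs o <= K)%N -> fits n s ->
  let f := scan_right (forward o) (prim_init o b) (cells n.+1 s) in
  scan_left (backward o) f.1 f.2 = (prim_exit o s, cells n.+1 (prim_effect o b s)).
Proof.
move=> oK hs f; rewrite {}/f; case: o oK => [d r|d|d b'|d|d r|d] oK.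
- have rK : (r < K)%N by move: oK => /=; lia.
  rewrite scan_right_map scan_left_id; congr pair; apply/esym.
  by apply: (@cells_upd _ _ d (track ^~ r) (fun q => q r)) => q //; rewrite track_head_cell.
- rewrite scan_right_map scan_left_id; congr pair; apply/esym.
  exact: (@cells_upd _ _ d (fun=> None) (fun=> [::])).
- by rewrite scan_right_push ?scan_left_id // ltnS; exact: hs.
- rewrite scan_right_map map_id; apply: scan_left_pop => // r /hs; exact: leqW.
- have [rK dK] : (r < K)%N /\ (d < K)%N by move: oK => /=; lia.
  rewrite scan_right_map scan_left_id; congr pair; apply/esym.
  apply: (@cells_upd _ _ d (fun c => if track c r is None then None else track c d)
    (fun q => take (size (q r)) (q d))) => q.
    by rewrite !track_head_cell //; case: (q r); case: (q d).
  by rewrite /behead_regs; case: (q r) (q d) => [|? ?] [|? ?] //=; rewrite take0.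
- by rewrite scan_right_push ?scan_left_id // ltnS; exact: hs.
Qed.

(* Components are machines with exits: a component hands over to the next one by exiting. *)
Record component : Type := Component {
  comp_state : finType;
  comp_init : comp_state;
  comp_delta : bool -> comp_state -> sym -> (comp_state + option bool) * sym * move }.

Definition machine_of (A : component) : ptm :=
  @Ptm (comp_state A + option bool)%type (option cell) (inl (comp_init A))
    (fun q => if q is inr _ then true else false)
    (fun b q a => if q is inl st then comp_delta b st a else (q, a, MoveN)).

Fixpoint reach (M : ptm) (coin : nat -> bool) (t k : nat) (y z : config M) : Prop :=
  if k is k'.+1 then ~~ halted y /\ reach coin t.+1 k' (step (coin t) y) z else y = z.

Lemma reach_trans M coin t k k' (x y z : config M) :
  reach coin t k x y -> reach coin (t + k) k' y z -> reach coin t (k + k') x z.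
Proof.
elim: k t x => [|k IH] t x /=; first by rewrite addn0 => ->.
by move=> [running hk]; rewrite addnS -addSn => hk'; split=> //; exact: IH hk'.
Qed.

Lemma reach_run M coin t k (x y : config M) :
  reach coin t k x y -> run (fun i => coin (t + i)) k x = y.
Proof.
have runS d n z : run d n.+1 z = run (fun i => d i.+1) n (step (d 0) z) :> config M.
  by elim: n => // n IH; rewrite -[LHS]/(step (d n.+1) (run d n.+1 z)) IH.
elim: k t x => // k IH t x [_ h]; rewrite runS addn0 -(IH _ _ h).
by congr run; apply/funext => i; rewrite addnS addSn.
Qed.

Lemma reach_map (A C : component) (f : comp_state A -> comp_state C)
    (exit : option bool -> comp_state C + option bool)
    (phi := fun q : comp_state A + option bool =>
      match q with inl st => inl (f st) | inr b => exit b end)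
    coin t k q l r q' l' r' :
  (forall b st a, comp_delta b (f st) a = let: (q, d, m) := comp_delta b st a in (phi q, d, m)) ->
  reach (M := machine_of A) coin t k (q, l, r) (q', l', r') ->
  reach (M := machine_of C) coin t k (phi q, l, r) (phi q', l', r').
Proof.
move=> hdelta; elim: k t q l r => [|k IH] t q l r /=; first by move=> [-> -> ->].
case: q => [st|b] [] //= _ h; split=> //; rewrite hdelta.
by case: (comp_delta _ st _) h => [[q a] []] h; exact: IH.
Qed.

Definition performs (A : component) coin t k (l r : seq sym) b (l' r' : seq sym) : Prop :=
  reach (M := machine_of A) coin t k (inl (comp_init A), l, r) (inr b, l', r').

Definition seq_comp (A B : component) : component :=
  @Component (comp_state A + comp_state B)%type (inl (comp_init A))
    (fun b st a => match st with
     | inl st => let: (q, d, m) := comp_delta b st a in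
         (match q with inl st' => inl (inl st') | inr _ => inl (inr (comp_init B)) end, d, m)
     | inr st => let: (q, d, m) := comp_delta b st a in
         (match q with inl st' => inl (inr st') | inr e => inr e end, d, m)
     end).

Lemma performs_seq A B coin t k k' l r b l' r' b' l'' r'' :
  performs A coin t k l r b l' r' -> performs B coin (t + k) k' l' r' b' l'' r'' ->
  performs (seq_comp A B) coin t (k + k') l r b' l'' r''.
Proof.
move=> hA hB; apply: reach_trans.
  apply: (reach_map (C := seq_comp A B) (f := inl) (exit := fun=> inl (inr (comp_init B))) _ hA).
  by move=> c st a /=; case: (comp_delta c st a) => [[[]]].
apply: (reach_map (C := seq_comp A B) (f := inr) (exit := inr) _ hB) => c st a /=.
by case: (comp_delta c st a) => [[[]]].
Qed.

Section Loop.
Variables T A B : component.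

Definition loop_comp : component :=
  @Component (comp_state T + (comp_state A + comp_state B))%type (inl (comp_init T))
    (fun b st a => match st with
     | inl st => let: (q, d, m) := comp_delta b st a in
         (match q with
          | inl st' => inl (inl st')
          | inr (Some true) => inl (inr (inl (comp_init A)))
          | inr (Some false) => inl (inr (inr (comp_init B)))
          | inr None => inr None
          end, d, m)
     | inr (inl st) => let: (q, d, m) := comp_delta b st a in
         (match q with inl st' => inl (inr (inl st')) | inr _ => inl (inl (comp_init T)) end, d, m)
     | inr (inr st) => let: (q, d, m) := comp_delta b st a in
         (match q with inl st' => inl (inr (inr st')) | inr _ => inl (inl (comp_init T)) end, d, m)
     end).

Definition loop_exit (b : option bool) : comp_state loop_comp + option bool :=
  match b with
  | Some true => inl (inr (inl (comp_init A)))
  | Some false => inl (inr (inr (comp_init B)))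
  | None => inr None
  end.

Lemma performs_test coin t k l r b l' r' : performs T coin t k l r b l' r' ->
  reach (M := machine_of loop_comp) coin t k (inl (comp_init loop_comp), l, r)
    (loop_exit b, l', r').
Proof.
move=> h; apply: (reach_map (C := loop_comp) (f := inl) (exit := loop_exit) _ h) => c st a /=.
by case: (comp_delta c st a) => [[[|[[]|]]]].
Qed.

Lemma performs_loop_exit coin t k l r l' r' :
  performs T coin t k l r None l' r' -> performs loop_comp coin t k l r None l' r'.
Proof. exact: performs_test. Qed.

Lemma performs_loop_step coin t k1 k2 k3 l r b l1 r1 b2 l2 r2 b3 l3 r3 :
  performs T coin t k1 l r (Some b) l1 r1 ->
  performs (if b then A else B) coin (t + k1) k2 l1 r1 b2 l2 r2 ->
  performs loop_comp coin (t + k1 + k2) k3 l2 r2 b3 l3 r3 ->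
  performs loop_comp coin t (k1 + k2 + k3) l r b3 l3 r3.
Proof.
move=> /performs_test hT hbody hloop; rewrite -addnA in hloop.
apply: reach_trans hloop; apply: reach_trans hT _.
case: b hbody => hbody.
  apply: (reach_map (C := loop_comp) (f := fun st => inr (inl st))
    (exit := fun=> inl (inl (comp_init T))) _ hbody) => c st a /=.
  by case: (comp_delta c st a) => [[[]]].
apply: (reach_map (C := loop_comp) (f := fun st => inr (inr st))
  (exit := fun=> inl (inl (comp_init T))) _ hbody) => c st a /=.
by case: (comp_delta c st a) => [[[]]].
Qed.

End Loop.

Definition nonblank (a : sym) : bool := if a is Blank then false else true.

Definition input_cell (b b' : bool) : cell := set_track (set_track no_cell 0 (Some b)) 1 (Some b').

(* An input symbol is read as a cell holding its value on track 0 and, on track 1,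
   a bit that tells the binary symbols from the separator. *)
Definition cell_of (a : sym) : cell :=
  match a with
  | Work (Some c) => c
  | Bit b => input_cell b true
  | Sharp => input_cell true false
  | _ => no_cell
  end.

Definition prim_comp (o : prim) : component := @Component (option (bool * option bool))%type None
  (fun b st a => match st with
   | None => (inl (Some (true, prim_init o b)), a, MoveR)
   | Some (true, q) => let: (q', c) := forward o q (cell_of a) in
       match a with
       | Blank => (inl (Some (false, q')), Cel c, MoveN)
       | _ => (inl (Some (true, q')), Cel c, MoveR)
       end
   | Some (false, q) => match a with
       | Work None => (inr q, a, MoveN)
       | _ => let: (q', c) := backward o q (cell_of a) in (inl (Some (false, q')), Cel c, MoveL)
       end
   end).

Definition cell_symbols cs : seq sym := [seq Cel c | c <- cs].

Lemma sweep_right o coin t us q l tl (f := scan_right (forward o) q (map cell_of us)) :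
  all nonblank us -> reach (M := machine_of (prim_comp o)) coin t (size us)
    (inl (Some (true, q)), l, us ++ tl)
    (inl (Some (true, f.1)), rev (cell_symbols f.2) ++ l, tl).
Proof.
rewrite {}/f; elim: us q l t => //= a us IH q l t /andP[ha hus]; split=> //.
rewrite rev_cons cat_rcons; case: (forward o q (cell_of a)) => q' c /=.
by case: a ha => // [b||x] _; exact: IH.
Qed.

Lemma sweep_left o coin t cs q c L r (f := scan_left (backward o) q (rcons cs c)) :
  reach (M := machine_of (prim_comp o)) coin t (size cs).+1
    (inl (Some (false, q)), rev (cell_symbols cs) ++ Home :: L, Cel c :: r)
    (inl (Some (false, f.1)), L, Home :: cell_symbols f.2 ++ r).
Proof.
rewrite {}/f; elim/last_ind: cs q c r t => [|cs c' IH] q c r t /=.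
  by split=> //; case: (backward o q c).
rewrite size_rcons scan_left_rcons /cell_symbols !map_rcons rev_rcons cat_rcons; split=> //.
by case: (backward o q c) => [q' x] /=; exact: IH.
Qed.

Lemma performs_scan o coin t L us tl : all nonblank us -> tl = [::] \/ tl = [:: Blank] ->
  let f := scan_right (forward o) (prim_init o (coin t)) (rcons (map cell_of us) no_cell) in
  let g := scan_left (backward o) f.1 f.2 in
  performs (prim_comp o) coin t ((size us).*2 + 4) L (Home :: us ++ tl) g.1 L
    (Home :: cell_symbols g.2).
Proof.
move=> hus htl; rewrite scan_right_rcons /=.
set f := scan_right _ _ _; set x := forward o f.1 no_cell.
have -> : ((size us).*2 + 4 = 1 + (size us + (1 + ((size us).+1 + 1))))%N by lia.
rewrite /performs; apply: (reach_trans
  (y := (inl (Some (true, prim_init o (coin t))), Home :: L, us ++ tl)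
  : config (machine_of (prim_comp o)))); first by [].
apply: reach_trans (sweep_right _ _ _ _ _ hus) _; rewrite -/f.
apply: (reach_trans
  (y := (inl (Some (false, x.1)), rev (cell_symbols f.2) ++ Home :: L, [:: Cel x.2])
  : config (machine_of (prim_comp o)))).
  by case: htl => ->; rewrite /x /=; case: (forward o f.1 no_cell).
have -> : size us = size f.2 by rewrite size_scan_right size_map.
by apply: reach_trans (sweep_left _ _ _ _ _ _ _ _) _; rewrite cats0.
Qed.

Lemma performs_prim_raw o coin t L us tl n s : (prim_regs o <= K)%N -> fits n s ->
  all nonblank us -> map cell_of us = cells n s -> tl = [::] \/ tl = [:: Blank] ->
  performs (prim_comp o) coin t (n.*2 + 4) L (Home :: us ++ tl) (prim_exit o s) L
    (Home :: cell_symbols (cells n.+1 (prim_effect o (coin t) s))).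
Proof.
move=> oK hs hus us_cells htl; have := performs_scan o coin t L hus htl; cbv zeta.
rewrite us_cells rcons_cells // (prim_scan (coin t) oK hs).
by rewrite -(size_map cell_of us) us_cells size_cells.
Qed.

Definition tape (n : nat) s : seq sym := Home :: cell_symbols (cells n s).

Lemma performs_prim o coin t L n s : (prim_regs o <= K)%N -> fits n s ->
  performs (prim_comp o) coin t (n.*2 + 4) L (tape n s) (prim_exit o s) L
    (tape n.+1 (prim_effect o (coin t) s)).
Proof.
move=> oK hs; rewrite -[tape n s]cats0; apply: performs_prim_raw => //; last by left.
  by elim: (cells n s).
by elim: (cells n s) => //= c cs ->.
Qed.

Inductive prog : Type :=
| Prim of prim
| Seq of prog & prog
| Loop of nat & prog & prog.

Fixpoint compile (p : prog) : component :=
  match p with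
  | Prim o => prim_comp o
  | Seq p1 p2 => seq_comp (compile p1) (compile p2)
  | Loop r p1 p0 => loop_comp (prim_comp (Pop r)) (compile p1) (compile p0)
  end.

Fixpoint prog_regs (p : prog) : nat :=
  match p with
  | Prim o => prim_regs o
  | Seq p1 p2 => maxn (prog_regs p1) (prog_regs p2)
  | Loop r p1 p0 => maxn r.+1 (maxn (prog_regs p1) (prog_regs p0))
  end.

(* [exec d p j s s' k]: the program [p], started in [s] after [j] primitive operations, ends in
   [s'] after [k] more of them; [d i] is the coin available to the [i]-th operation. *)
Inductive exec (d : nat -> bool) : prog -> nat -> env -> env -> nat -> Prop :=
| exec_prim o j s : exec d (Prim o) j s (prim_effect o (d j) s) 1
| exec_seq p1 p2 j s s1 s2 k1 k2 : exec d p1 j s s1 k1 -> exec d p2 (j + k1) s1 s2 k2 ->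
    exec d (Seq p1 p2) j s s2 (k1 + k2)
| exec_exit r p1 p0 j s : s r = [::] -> exec d (Loop r p1 p0) j s s 1
| exec_loop r p1 p0 j s b x s1 s2 k1 k2 : s r = b :: x ->
    exec d (if b then p1 else p0) j.+1 (upd s r x) s1 k1 ->
    exec d (Loop r p1 p0) (j.+1 + k1) s1 s2 k2 -> exec d (Loop r p1 p0) j s s2 (1 + k1 + k2).

(* The time before the [j]-th operation: each one sweeps the tape twice and makes it longer
   by one cell. *)
Definition clock (t n j : nat) : nat := (t + j * (n.*2 + j + 3))%N.

Lemma clockS t n j : clock t n j.+1 = (clock t n j + ((n + j).*2 + 4))%N.
Proof. by rewrite /clock; nia. Qed.

Lemma leq_clock t n n' j j' : (n <= n')%N -> (j <= j')%N -> (clock t n j <= clock t n' j')%N.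
Proof. by rewrite /clock => hn hj; rewrite leq_add2l leq_mul //; lia. Qed.

Lemma clock_inj t n : injective (clock t n).
Proof. by move=> i j /addnI; nia. Qed.

Lemma upd_id s d u : s d = u -> upd s d u = s.
Proof. by move=> <-; apply/funext => r; rewrite /upd; case: eqP => [->|]. Qed.

Section Simulation.
Variables (coin : nat -> bool) (t n : nat).
Let d (j : nat) : bool := coin (clock t n j).

Lemma exec_performs p j s s' k : exec d p j s s' k -> (prog_regs p <= K)%N -> fits (n + j) s ->
  fits (n + (j + k)) s' /\ exists2 T, clock t n (j + k) = (clock t n j + T)%N &
  exists q, forall L, performs (compile p) coin (clock t n j) T L (tape (n + j) s) q L
    (tape (n + (j + k)) s').
Proof.
elim=> {p j s s' k} [ o j s|p1 p2 j s s1 s2 k1 k2 _ IH1 _ IH2|r p1 p0 j s sr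
    |r p1 p0 j s b x s1 s2 k1 k2 sr _ IH1 _ IH2] /= pK hs.
- rewrite addn1 addnS clockS; split; first exact: fits_prim_effect.
  by exists ((n + j).*2 + 4)%N => //; exists (prim_exit o s) => L; exact: performs_prim.
- have [|hs1 [T1 clock1 [q1 perf1]]] := IH1 _ hs; first by lia.
  have [|hs2 [T2 clock2 [q2 perf2]]] := IH2 _ hs1; first by lia.
  rewrite (addnA j); split=> //; exists (T1 + T2)%N; first by rewrite clock2 clock1 addnA.
  by exists q2 => L; apply: performs_seq (perf1 L) _; rewrite -clock1; exact: perf2.
- have rK : (prim_regs (Pop r) <= K)%N by move: pK => /=; lia.
  rewrite addn1 addnS clockS; split; first by move=> i /hs; exact: leqW.
  exists ((n + j).*2 + 4)%N => //; exists None => L; apply: performs_loop_exit.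
  by have := performs_prim coin (clock t n j) L rK hs; rewrite /= sr upd_id.
have rK : (prim_regs (Pop r) <= K)%N by move: pK => /=; lia.
have := fits_prim_effect (d j) rK hs; rewrite /= sr /= -addnS => hs0.
have [|hs1 [T1 clock1 [q1 perf1]]] := IH1 _ hs0; first by move: pK; case: (b); lia.
have [hs2 [T2 clock2 [q2 perf2]]] := IH2 pK hs1.
have -> : (j + (1 + k1 + k2) = j.+1 + k1 + k2)%N by lia.
split=> //; exists (((n + j).*2 + 4) + T1 + T2)%N; first by rewrite clock2 clock1 clockS !addnA.
exists q2 => L; have pop := performs_prim coin (clock t n j) L rK hs.
rewrite /= sr /= -addnS in pop.
have body : performs (if b then compile p1 else compile p0) coin (clock t n j.+1) T1 L
    (tape (n + j.+1) (upd s r x)) q1 L (tape (n + (j.+1 + k1)) s1).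
  by move: (perf1 L); case: (b).
rewrite clockS in body clock1; apply: performs_loop_step pop body _.
by rewrite -clock1; exact: perf2.
Qed.

End Simulation.

Definition home_comp : component := @Component bool true
  (fun _ st a => if st then (inl false, a, MoveL) else (inr None, Home, MoveN)).

Lemma performs_home coin t us : exists2 tl, tl = [::] \/ tl = [:: Blank] &
  performs home_comp coin t 2 [::] us None [::] (Home :: us ++ tl).
Proof.
case: us => [|a us]; first by exists [:: Blank]; [right|].
by exists [::]; [left|rewrite cats0].
Qed.

Definition symbol_bit (W : Type) (a : symbol W) : bool := if a is Bit b then b else true.
Definition symbol_is_bit (W : Type) (a : symbol W) : bool := if a is Bit _ then true else false.

Definition input_regs (us : seq sym) : env := fun r =>
  match r with
  | 0 => map (@symbol_bit _) us
  | 1 => map (@symbol_is_bit _) us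
  | _ => [::]
  end.

Definition is_input (a : sym) : bool := match a with Bit _ | Sharp => true | _ => false end.

Lemma encode_is_input (xs : seq word) : all is_input (encode (option cell) xs).
Proof.
have hx (x : word) : all is_input (map Bit x) by elim: x.
by elim: xs => // x [|y xs] IH //=; rewrite all_cat hx.
Qed.

Lemma cells_input us : all is_input us ->
  map cell_of us = cells (size us) (input_regs us) /\ all nonblank us.
Proof.
elim: us => [|a us IH] //= /andP[ha /IH[-> ->]]; split; last by case: a ha.
have -> : behead_regs (input_regs (a :: us)) = input_regs us by apply/funext => -[|[|r]].
congr cons; apply/ffunP => r; case: a ha => //= [b|] _;
  by rewrite /input_cell !ffunE /=; case: (nat_of_ord r) => [|[|j]].
Qed.

Definition load_comp : component := seq_comp home_comp (prim_comp (Clear 2)).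

Definition load_time (n : nat) : nat := (2 + (n.*2 + 4))%N.

Lemma performs_load coin us : (2 < K)%N -> all is_input us ->
  fits (size us).+1 (input_regs us) /\
  performs load_comp coin 0 (load_time (size us)) [::] us None [::]
    (tape (size us).+1 (input_regs us)).
Proof.
move=> K2 hus; have [us_cells us_nonblank] := cells_input hus.
have [tl htl home] := performs_home coin 0 us.
have hfits : fits (size us) (input_regs us) by move=> [|[|r]] _ //=; rewrite size_map.
split; first by move=> r /hfits; exact: leqW.
have clear := @performs_prim_raw (Clear 2) coin 2 [::] us tl _ _ K2 hfits us_nonblank us_cells htl.
by rewrite /= upd_id // in clear; exact: performs_seq home clear.
Qed.

Definition output_comp (d : nat) : component := @Component (option bool) None
  (fun _ st a => match st with
   | None => (inl (Some true), a, MoveR)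
   | Some true => if track (cell_of a) d is Some b then (inl (Some true), Bit b, MoveR)
                  else (inl (Some false), a, MoveL)
   | Some false => match a with
       | Work None => (inr None, a, MoveR)
       | _ => (inl (Some false), a, MoveL)
       end
   end).

Section Output.
Variables (d : nat) (coin : nat -> bool).
Hypothesis dK : (d < K)%N.

Notation out_reach := (reach (M := machine_of (output_comp d)) coin).

Lemma write_output t n s l : fits n s -> exists r, [/\
  out_reach t (size (s d)) (inl (Some true), l, cell_symbols (cells n s))
    (inl (Some true), rev (map Bit (s d)) ++ l, r),
  leading_bits r = [::] & track (cell_of (head Blank r)) d = None].
Proof.
have no_track : track no_cell d = None by rewrite /track; case: insubP => // r; rewrite ffunE.
elim: n s t l => [|n IH] s t l hs.
  by have := hs d dK; rewrite leqn0 => /nilP ->; exists [::].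
case e: (s d) => [|b u].
  by exists (cell_symbols (cells n.+1 s)); rewrite /= track_head_cell // e.
have [r [written r_bits r_track]] := IH _ t.+1 (Bit b :: l) (fits_behead hs).
exists r; split=> //=; split=> //; rewrite /= track_head_cell // e /= rev_cons cat_rcons.
by rewrite /behead_regs e in written.
Qed.

Lemma rewind_output t (u : word) b L r : out_reach t (size u).+1
  (inl (Some false), rev (map Bit u) ++ Home :: L, Bit b :: r)
  (inl (Some false), L, Home :: map Bit u ++ Bit b :: r).
Proof.
elim/last_ind: u b r t => // u c IH b r t.
by rewrite size_rcons map_rcons rev_rcons cat_rcons; split=> //; exact: IH.
Qed.

Lemma performs_output t n s L : fits n s -> exists l r,
  performs (output_comp d) coin t ((size (s d)).*2 + 3) L (tape n s) None l r /\
  leading_bits r = s d.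
Proof.
move=> hs; have [r [written r_bits r_track]] := write_output t.+1 (Home :: L) hs.
set u := s d in written *.
pose r' := if r is a :: r' then a :: r' else [:: Blank].
exists (Home :: L), (map Bit u ++ r'); split; last first.
  have -> : leading_bits (map Bit u ++ r') = u ++ leading_bits r' by elim: (u) => //= b v ->.
  by rewrite -[RHS]cats0 /r'; case: (r) r_bits => [|a q] //= ->.
have -> : ((size u).*2 + 3 = 1 + (size u + (1 + (size u + 1))))%N by lia.
rewrite /performs; apply: (reach_trans (y := (inl (Some true), Home :: L, cell_symbols (cells n s))
  : config (machine_of (output_comp d)))); first by [].
apply: reach_trans; first by rewrite addn1; exact: written.
apply: (reach_trans (y := (inl (Some false), behead (rev (map Bit u) ++ Home :: L),
  head Blank (rev (map Bit u) ++ Home :: L) :: r') : config (machine_of (output_comp d)))).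
  by rewrite /r'; case: (r) r_track => [|a q] /= ->.
case/lastP: u {written} => [|u b]; first by [].
rewrite size_rcons map_rcons rev_rcons cat_rcons /=.
exact: reach_trans (rewind_output _ _ _ _ _) _.
Qed.

End Output.

End Tracks.

(** * Compiling feasible functions *)

Notation no_oracle := (fun _ : word => false).

Definition append (d r : nat) : prog := Loop r (Prim (Push d true)) (Prim (Push d false)).

Definition times_body (m : nat) : prog := Seq (Prim (Copy m.+3 m)) (append m.+2 m.+3).

(* During a recursion, register [m] holds the part of the argument not yet read, [m.+1] the
   value, [m.+2] its bound and [m.+3] the part already read. *)
Definition rec_regs (a : nat -> nat) (m i : nat) : nat :=
  match i with 0 => m.+3 | 1 => m.+1 | j.+2 => a j end.

Definition rec_body (m : nat) (c : bool) (p : prog) : prog :=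
  Seq p (Seq (Prim (Copy m.+1 m.+4)) (Seq (Prim (Trunc m.+1 m.+2)) (Prim (Push m.+3 c)))).

(* Variable [i] is held in register [a i] and the result goes to register [m];
   registers below [m] are left unchanged. An oracle query returns 0. *)
Fixpoint compile_expr (a : nat -> nat) (m : nat) (e : expr) : prog :=
  match e with
  | EVar i => Prim (Copy m (a i))
  | EEps => Prim (Clear m)
  | EBit b => Seq (Prim (Clear m)) (Prim (Push m b))
  | ECat e1 e2 => Seq (compile_expr a m e1) (Seq (compile_expr a m.+1 e2) (append m m.+1))
  | ETimes e1 e2 =>
      Seq (compile_expr a m e1) (Seq (compile_expr a m.+1 e2) (Seq (Prim (Clear m.+2))
        (Seq (Loop m.+1 (times_body m) (times_body m)) (Prim (Copy m m.+2)))))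
  | EFlip e1 => Prim (Clear m)
  | ERec x z s0 s1 B =>
      Seq (compile_expr a m x) (Seq (compile_expr a m.+1 z) (Seq (compile_expr a m.+2 B)
        (Seq (Prim (Trunc m.+1 m.+2)) (Seq (Prim (Clear m.+3))
        (Seq (Loop m (rec_body m true (compile_expr (rec_regs a m) m.+4 s1))
                     (rec_body m false (compile_expr (rec_regs a m) m.+4 s0)))
        (Prim (Copy m m.+1)))))))
  end.

Definition steps (p : prog) (s s' : env) (k : nat) : Prop := forall d j, exec d p j s s' k.

Lemma steps_copy d r s : steps (Prim (Copy d r)) s (upd s d (s r)) 1.
Proof. by move=> c j; exact: exec_prim. Qed.

Lemma steps_clear d s : steps (Prim (Clear d)) s (upd s d [::]) 1.
Proof. by move=> c j; exact: exec_prim. Qed.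

Lemma steps_push d b s : steps (Prim (Push d b)) s (upd s d (rcons (s d) b)) 1.
Proof. by move=> c j; exact: exec_prim. Qed.

Lemma steps_trunc d r s : steps (Prim (Trunc d r)) s (upd s d (take (size (s r)) (s d))) 1.
Proof. by move=> c j; exact: exec_prim. Qed.

Lemma steps_seq p1 p2 s s1 s2 k1 k2 :
  steps p1 s s1 k1 -> steps p2 s1 s2 k2 -> steps (Seq p1 p2) s s2 (k1 + k2).
Proof. by move=> h1 h2 c j; exact: exec_seq (h1 _ _) (h2 _ _). Qed.

Lemma steps_exit r p1 p0 s : s r = [::] -> steps (Loop r p1 p0) s s 1.
Proof. by move=> sr c j; exact: exec_exit. Qed.

Lemma steps_loop r p1 p0 s b x s1 s2 k1 k2 : s r = b :: x ->
  steps (if b then p1 else p0) (upd s r x) s1 k1 -> steps (Loop r p1 p0) s1 s2 k2 ->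
  steps (Loop r p1 p0) s s2 (1 + k1 + k2).
Proof. by move=> sr h1 h2 c j; exact: exec_loop sr (h1 _ _) (h2 _ _). Qed.

Ltac read_upd := repeat first [rewrite updE | rewrite updN; last by lia].

Lemma steps_append d r s : d != r -> exists s', [/\ steps (append d r) s s' ((size (s r)).*2 + 1),
  s' d = s d ++ s r & forall i, i != d -> i != r -> s' i = s i].
Proof.
move=> dr; move e: (s r) => y; elim: y s e => [|b y IH] s e.
  by exists s; split; [exact: steps_exit|rewrite cats0|].
have push : steps (if b then Prim (Push d true) else Prim (Push d false)) (upd s r y)
    (upd (upd s r y) d (rcons (s d) b)) 1.
  by rewrite -[s d](@updN s r y) //; case: (b); exact: steps_push.
have [|s' [loop s'_d s'_other]] := IH (upd (upd s r y) d (rcons (s d) b)).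
  by rewrite updN ?updE // eq_sym.
exists s'; split; last by move=> i hi hi'; rewrite s'_other // !updN.
  have -> : ((size (b :: y)).*2 + 1 = 1 + 1 + ((size y).*2 + 1))%N by rewrite /=; lia.
  exact: steps_loop e push loop.
by rewrite s'_d updE cat_rcons.
Qed.

Definition expr_bounded (e : expr) (L : term) : Prop :=
  forall w v, (size (eeval w v e) <= size (teval v L))%N.

Lemma expr_bounded_exists e : exists L, expr_bounded e L.
Proof.
have [L [N bounded]] := term_bounded_query_tree e; exists L => w v.
by have := tree_bounded_run w (bounded v); rewrite dtree_run_query_tree.
Qed.

Definition const_term (n : nat) : term := numeral (nseq n true).

Lemma size_teval_const v n : size (teval v (const_term n)) = n.
Proof. by rewrite (teval_std no_oracle) numeral_std size_nseq. Qed.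

Lemma size_teval_cat v t s : size (teval v (TCat t s)) = (size (teval v t) + size (teval v s))%N.
Proof. exact: size_cat. Qed.

Lemma size_teval_times v t s :
  size (teval v (TTimes t s)) = (size (teval v t) * size (teval v s))%N.
Proof. exact: size_flatten_nseq. Qed.

Definition size_tevalE := (size_teval_const, size_teval_cat, size_teval_times).

Definition read_env (a : nat -> nat) (s : env) : env := fun i => s (a i).

Lemma read_env_agree a m s s' : (forall i, (a i < m)%N) -> (forall r, (r < m)%N -> s' r = s r) ->
  read_env a s' = read_env a s.
Proof. by move=> ha agree; apply/funext => i; exact: agree. Qed.

Definition compiles (e : expr) (T : term) : Prop := forall a m s, (forall i, (a i < m)%N) ->
  exists s' k, [/\ steps (compile_expr a m e) s s' k, s' m = eeval no_oracle (read_env a s) e,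
    forall r, (r < m)%N -> s' r = s r & (k <= size (teval (read_env a s) T))%N].

Lemma compiles_var i : compiles (EVar i) (const_term 1).
Proof.
move=> a m s ha; exists (upd s m (s (a i))), 1; split; [exact: steps_copy|by rewrite updE| |].
  by move=> r hr; read_upd.
by rewrite size_teval_const.
Qed.

Lemma compiles_clear e : (forall a m, compile_expr a m e = Prim (Clear m)) ->
  (forall v, eeval no_oracle v e = [::]) -> compiles e (const_term 1).
Proof.
move=> compE evalE a m s ha; exists (upd s m [::]), 1.
split; [by rewrite compE; exact: steps_clear|by rewrite updE evalE| |].
  by move=> r hr; read_upd.
by rewrite size_teval_const.
Qed.

Lemma compiles_bit b : compiles (EBit b) (const_term 2).
Proof.
move=> a m s ha; exists (upd (upd s m [::]) m [:: b]), (1 + 1)%N; split.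
- have push := @steps_push m b (upd s m [::]); rewrite updE in push.
  exact: steps_seq (steps_clear _ _) push.
- by rewrite updE.
- by move=> r hr; read_upd.
- by rewrite size_teval_const.
Qed.

Lemma compiles_pair e1 e2 T1 T2 a m s : compiles e1 T1 -> compiles e2 T2 ->
  (forall i, (a i < m)%N) -> exists s' k, [/\
    forall p s'' k', steps p s' s'' k' ->
      steps (Seq (compile_expr a m e1) (Seq (compile_expr a m.+1 e2) p)) s s'' (k + k'),
    s' m = eeval no_oracle (read_env a s) e1 /\ s' m.+1 = eeval no_oracle (read_env a s) e2,
    forall r, (r < m)%N -> s' r = s r &
    (k <= size (teval (read_env a s) T1) + size (teval (read_env a s) T2))%N].
Proof.
move=> h1 h2 ha; have [s1 [k1 [steps1 s1_m s1_low hk1]]] := h1 a m s ha.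
have ha' i : (a i < m.+1)%N by rewrite ltnS ltnW.
have [s2 [k2 [steps2 s2_m s2_low hk2]]] := h2 a m.+1 s1 ha'.
rewrite (read_env_agree ha s1_low) in s2_m hk2.
exists s2, (k1 + k2)%N; split; [|by rewrite s2_low // s1_m| |exact: leq_add].
  by move=> p s'' k' hp; rewrite -addnA; exact: steps_seq steps1 (steps_seq steps2 hp).
by move=> r hr; rewrite s2_low ?s1_low // ltnS ltnW.
Qed.

Lemma compiles_cat e1 e2 T1 T2 L2 : compiles e1 T1 -> compiles e2 T2 -> expr_bounded e2 L2 ->
  compiles (ECat e1 e2) (TCat (TCat T1 T2) (TCat (TCat L2 L2) (const_term 1))).
Proof.
move=> h1 h2 hL a m s ha.
have [s' [k [steps12 [s'_m s'_m1] s'_low hk]]] := compiles_pair s h1 h2 ha.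
have mm : m != m.+1 by lia.
have [s'' [app s''_m s''_other]] := steps_append s' mm.
exists s'', (k + ((size (s' m.+1)).*2 + 1))%N; split; first exact: steps12.
- by rewrite s''_m s'_m s'_m1.
- by move=> r hr; rewrite s''_other ?s'_low //; lia.
- by have := hL no_oracle (read_env a s); rewrite s'_m1 !size_tevalE; lia.
Qed.

Lemma steps_times_loop m u : exists u', [/\
  steps (Loop m.+1 (times_body m) (times_body m)) u u' (size (u m.+1) * ((size (u m)).*2 + 3) + 1),
  u' m.+2 = u m.+2 ++ flatten (nseq (size (u m.+1)) (u m)) &
  forall r, (r <= m)%N -> u' r = u r].
Proof.
move e: (u m.+1) => y; elim: y u e => [|b y IH] u e.
  by exists u; split; [exact: steps_exit|rewrite cats0|].
pose u1 := upd (upd u m.+1 y) m.+3 (u m).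
have copy : steps (Prim (Copy m.+3 m)) (upd u m.+1 y) u1 1.
  by rewrite /u1 -(@updN u m.+1 y m); [exact: steps_copy|lia].
have mm : m.+2 != m.+3 by lia.
have [u2 [app u2_m2 u2_other]] := steps_append u1 mm.
have u2_low r : (r <= m)%N -> u2 r = u r by move=> hr; rewrite u2_other /u1; read_upd => //; lia.
have [|u3 [loop u3_m2 u3_low]] := IH u2; first by rewrite u2_other /u1; read_upd => //; lia.
rewrite u2_low // in loop u3_m2; exists u3; split.
- have -> : (size (b :: y) * ((size (u m)).*2 + 3) + 1 =
      1 + (1 + ((size (u m)).*2 + 1)) + (size y * ((size (u m)).*2 + 3) + 1))%N.
    by rewrite /= mulSn; lia.
  rewrite /u1 updE -/u1 in app; apply: steps_loop e _ loop.
  by case: (b); exact: steps_seq copy app.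
- by rewrite u3_m2 u2_m2 /u1; read_upd; rewrite /= catA.
- by move=> r hr; rewrite u3_low ?u2_low.
Qed.

Lemma compiles_times e1 e2 T1 T2 L1 L2 :
  compiles e1 T1 -> compiles e2 T2 -> expr_bounded e1 L1 -> expr_bounded e2 L2 ->
  compiles (ETimes e1 e2)
    (TCat (TCat T1 T2) (TCat (const_term 3) (TTimes L2 (TCat (TCat L1 L1) (const_term 3))))).
Proof.
move=> h1 h2 hL1 hL2 a m s ha.
have [s' [k [steps12 [s'_m s'_m1] s'_low hk]]] := compiles_pair s h1 h2 ha.
have [u [loop u_m2 u_low]] := steps_times_loop m (upd s' m.+2 [::]).
have m_neq : m != m.+2 by lia.
have m1_neq : m.+1 != m.+2 by lia.
rewrite updE !updN // s'_m s'_m1 in loop u_m2.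
exists (upd u m (u m.+2)); eexists; split.
- exact: steps12 (steps_seq (steps_clear _ _) (steps_seq loop (steps_copy _ _ _))).
- by rewrite updE u_m2.
- by move=> r hr; rewrite updN ?u_low ?updN ?s'_low //; lia.
- have := hL1 no_oracle (read_env a s); have := hL2 no_oracle (read_env a s).
  by rewrite !size_tevalE; nia.
Qed.

Section Recursion.
Variables (a : nat -> nat) (m : nat).
Hypothesis ha : forall i, (a i < m)%N.

Let rec_env (u : env) : env := econs (u m.+3) (econs (u m.+1) (read_env a u)).

Lemma steps_rec_body e T c u : compiles e T -> exists u' k, [/\
  steps (rec_body m c (compile_expr (rec_regs a m) m.+4 e)) u u' k,
  u' m.+1 = take (size (u m.+2)) (eeval no_oracle (rec_env u) e), u' m.+3 = rcons (u m.+3) c,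
  forall r, (r < m.+3)%N -> r != m.+1 -> u' r = u r & (k <= size (teval (rec_env u) T) + 3)%N].
Proof.
move=> he; have hregs i : (rec_regs a m i < m.+4)%N.
  by case: i => [|[|i]] /=; [lia|lia|have := ha i; lia].
have [u' [k [hsteps u'_m4 u'_low hk]]] := he (rec_regs a m) m.+4 u hregs.
have envE : read_env (rec_regs a m) u = rec_env u by apply/funext => -[|[|i]].
rewrite envE in u'_m4 hk.
pose u1 := upd u' m.+1 (u' m.+4); pose u2 := upd u1 m.+1 (take (size (u1 m.+2)) (u1 m.+1)).
exists (upd u2 m.+3 (rcons (u2 m.+3) c)), (k + (1 + (1 + 1)))%N; split.
- exact: steps_seq hsteps (steps_seq (steps_copy _ _ _)
    (steps_seq (steps_trunc _ _ _) (steps_push _ _ _))).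
- by rewrite /u2 /u1; read_upd; rewrite u'_m4 u'_low.
- by rewrite /u2 /u1; read_upd; rewrite u'_low.
- by move=> r hr hr1; rewrite /u2 /u1 !updN ?u'_low //; lia.
- by rewrite leq_add2r.
Qed.

Variables (s0 s1 : expr) (T0 T1 : term) (v : env) (lx lB N : nat).
Hypotheses (h0 : compiles s0 T0) (h1 : compiles s1 T1).
Hypothesis step_time : forall c p x, (size p <= lx)%N -> (size x <= lB)%N ->
  (size (teval (econs p (econs x v)) (if c then T1 else T0)) <= N)%N.

Let h (c : bool) (p x : word) : word :=
  eeval no_oracle (econs p (econs x v)) (if c then s1 else s0).

Lemma steps_rec_loop u : read_env a u = v -> (size (u m.+3) + size (u m) <= lx)%N ->
  (size (u m.+2) <= lB)%N -> (size (u m.+1) <= lB)%N -> exists u' k, [/\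
    steps (Loop m (rec_body m true (compile_expr (rec_regs a m) m.+4 s1))
                  (rec_body m false (compile_expr (rec_regs a m) m.+4 s0))) u u' k,
    u' m.+1 = (rec_pair (size (u m.+2)) h (u m.+3, u m.+1) (u m)).2,
    forall r, (r < m)%N -> u' r = u r & (k <= size (u m) * (N + 4) + 1)%N].
Proof.
move e: (u m) => y; elim: y u e => [|c y IH] u e uv hp hB hx.
  by exists u, 1; split=> //; exact: steps_exit.
pose u0 := upd u m y.
have u0N r : r != m -> u0 r = u r by exact: updN.
have u0v : read_env a u0 = v.
  by rewrite -uv; apply: read_env_agree ha _ => r hr; rewrite u0N //; lia.
have hc : compiles (if c then s1 else s0) (if c then T1 else T0) by case: (c).
have [u1 [k1 [body u1_m1 u1_m3 u1_low hk1]]] := steps_rec_body c u0 hc.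
rewrite /rec_env u0v !u0N in u1_m1 u1_m3 hk1; try by lia.
have u1N r : (r < m.+3)%N -> r != m.+1 -> r != m -> u1 r = u r.
  by move=> h3 h4 h5; rewrite u1_low ?u0N.
have [| | | | |u2 [k2 [loop u2_m1 u2_low hk2]]] := IH u1.
- by rewrite u1_low /u0 ?updE //; lia.
- by rewrite -uv; apply: read_env_agree ha _ => r hr; rewrite u1N //; lia.
- by rewrite u1_m3 size_rcons; move: hp => /=; lia.
- by rewrite u1N //; lia.
- by rewrite u1_m1 size_take_min; lia.
exists u2, (1 + k1 + k2)%N; split.
- by apply: steps_loop e _ loop; move: body; case: (c).
- by rewrite u2_m1 u1N ?u1_m1 ?u1_m3 //; lia.
- by move=> r hr; rewrite u2_low ?u1N //; lia.
- have u_m3 : (size (u m.+3) <= lx)%N by lia.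
  have := step_time c u_m3 hx; move: hk1 hk2 => /=.
  by rewrite mulSn; move: (size (teval _ _)) (size y * _)%N => p q; lia.
Qed.

End Recursion.

Lemma compiles_rec x z s0 s1 B Tx Tz T0 T1 TB Lx LB
    (sb := fun n => match n with 0 => Lx | 1 => LB | j.+2 => TVar j end)
    (Ts := tsubst sb (TCat T0 T1)) :
  compiles x Tx -> compiles z Tz -> compiles s0 T0 -> compiles s1 T1 -> compiles B TB ->
  expr_bounded x Lx -> expr_bounded B LB ->
  compiles (ERec x z s0 s1 B) (TCat (TCat (TCat Tx Tz) TB)
    (TCat (const_term 4) (TTimes Lx (TCat Ts (const_term 4))))).
Proof.
move=> hx hz h0 h1 hB hLx hLB a m s ha; set v := read_env a s.
have [u2 [k2 [steps_xz [u2_m u2_m1] u2_low hk2]]] := compiles_pair s hx hz ha.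
have ha2 i : (a i < m.+2)%N by have := ha i; lia.
have [u3 [k3 [steps_B u3_m2 u3_low hk3]]] := hB a m.+2 u2 ha2.
rewrite (read_env_agree ha u2_low) in u3_m2 hk3; rewrite -/v in u2_m u2_m1 u3_m2 hk2 hk3.
have := hLx no_oracle v; have := hLB no_oracle v => B_le x_le.
pose u4 := upd (upd u3 m.+1 (take (size (u3 m.+2)) (u3 m.+1))) m.+3 [::].
have u4_m3 : u4 m.+3 = [::] by rewrite /u4 updE.
have u4_m2 : u4 m.+2 = eeval no_oracle v B by rewrite /u4; read_upd.
have u4_m1 : u4 m.+1 = take (size (eeval no_oracle v B)) (eeval no_oracle v z).
  by rewrite /u4; read_upd; rewrite u3_m2 u3_low ?u2_m1.
have u4_m : u4 m = eeval no_oracle v x by rewrite /u4; read_upd; rewrite u3_low ?u2_m.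
have u4_low r : (r < m)%N -> u4 r = s r by move=> hr; rewrite /u4 !updN ?u3_low ?u2_low //; lia.
pose N := size (teval v Ts).
have step_time c p y : (size p <= size (teval v Lx))%N -> (size y <= size (teval v LB))%N ->
    (size (teval (econs p (econs y v)) (if c then T1 else T0)) <= N)%N.
  move=> hp hy; apply: (@leq_trans (size (teval v (tsubst sb (if c then T1 else T0))))).
    by rewrite teval_tsubst; apply: leq_size_teval => -[|[|i]].
  by rewrite /N /Ts !teval_tsubst size_teval_cat; case: (c); [exact: leq_addl|exact: leq_addr].
clearbody Ts.
have [| | | |u5 [k5 [loop u5_m1 u5_low hk5]]] := steps_rec_loop ha h0 h1 step_time (u := u4).
- exact: read_env_agree ha u4_low.
- by rewrite u4_m3 u4_m.
- by rewrite u4_m2.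
- by rewrite u4_m1 size_take_min; lia.
rewrite u4_m3 u4_m2 u4_m1 u4_m in u5_m1 hk5.
exists (upd u5 m (u5 m.+1)); eexists; split.
- exact: steps_xz (steps_seq steps_B (steps_seq (steps_trunc _ _ _)
    (steps_seq (steps_clear _ _) (steps_seq loop (steps_copy _ _ _))))).
- by rewrite updE u5_m1.
- by move=> r hr; rewrite updN ?u5_low ?u4_low //; lia.
- by rewrite !size_tevalE -/v -/N; have := leq_mul x_le (leqnn (N + 4)); lia.
Qed.

Lemma compiles_exists e : exists T, compiles e T.
Proof.
elim: e => [i||b|e1 [T1 h1] e2 [T2 h2]|e1 [T1 h1] e2 [T2 h2]|e1 _
  |x [Tx hx] z [Tz hz] s0 [T0 h0] s1 [T1 h1] B [TB hB]].
- by eexists; exact: compiles_var.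
- by eexists; apply: compiles_clear.
- by eexists; exact: compiles_bit.
- by have [L2 hL2] := expr_bounded_exists e2; eexists; exact: compiles_cat h1 h2 hL2.
- have [L1 hL1] := expr_bounded_exists e1; have [L2 hL2] := expr_bounded_exists e2.
  by eexists; exact: compiles_times h1 h2 hL1 hL2.
- by eexists; apply: compiles_clear.
have [Lx hLx] := expr_bounded_exists x; have [LB hLB] := expr_bounded_exists B.
by eexists; exact: compiles_rec hx hz h0 h1 hB hLx hLB.
Qed.

(** * Representable functions are computed by machines *)

Definition poly_bounded (f : nat -> nat) : Prop :=
  exists p : {poly nat}, forall n, (f n <= p.[n]%R)%N.

Lemma poly_bounded_id : poly_bounded id.
Proof. by exists 'X%R => n; rewrite hornerX. Qed.

Lemma poly_bounded_const k : poly_bounded (fun=> k).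
Proof. by exists (k%:P)%R => n; rewrite hornerC. Qed.

Lemma poly_bounded_add f g :
  poly_bounded f -> poly_bounded g -> poly_bounded (fun n => f n + g n)%N.
Proof. by move=> [p hp] [q hq]; exists (p + q)%R => n; rewrite hornerD leq_add. Qed.

Lemma poly_bounded_mul f g :
  poly_bounded f -> poly_bounded g -> poly_bounded (fun n => f n * g n)%N.
Proof. by move=> [p hp] [q hq]; exists (p * q)%R => n; rewrite hornerM leq_mul. Qed.

Definition term_growth (t : term) (n : nat) : nat := size (teval (fun=> nseq n true) t).

Lemma leq_term_growth v t n :
  (forall i, (size (v i) <= n)%N) -> (size (teval v t) <= term_growth t n)%N.
Proof. by move=> hv; apply: leq_size_teval => i; rewrite size_nseq. Qed.

Lemma poly_bounded_term_growth t : poly_bounded (term_growth t).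
Proof.
rewrite /term_growth; elim: t => [i||b|t IH s IH'|t IH s IH'].
- by have [p hp] := poly_bounded_id; exists p => n; rewrite size_nseq; exact: hp.
- exact: poly_bounded_const.
- exact: poly_bounded_const.
- by have [p hp] := poly_bounded_add IH IH'; exists p => n; rewrite size_teval_cat; exact: hp.
- by have [p hp] := poly_bounded_mul IH IH'; exists p => n; rewrite size_teval_times; exact: hp.
Qed.

(* In [x], the values of the input symbols; in [k], ones on the bits and zeros on the separators. *)
Fixpoint decode_arg (i : nat) (x k : word) : word :=
  if i is j.+1 then
    decode_arg j (drop (size (true :: leading_ones k)) x) (drop (size (true :: leading_ones k)) k)
  else take (size (leading_ones k)) x.

Lemma feasible_decode_arg i f g :
  feasible f -> feasible g -> feasible (fun w v => decode_arg i (f w v) (g w v)).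
Proof.
elim: i f g => [|i IH] f g hf hg; have hl := feasible_leading_ones hg.
  exact: feasible_take.
by apply: IH; apply: feasible_drop => //; exact: feasible_cons.
Qed.

Lemma decode_arg_encode W i (xs : seq word) : decode_arg i (map (@symbol_bit W) (encode W xs))
  (map (@symbol_is_bit W) (encode W xs)) = nth [::] xs i.
Proof.
have valE x : map (@symbol_bit W) (map Bit x) = x by elim: x => //= b x ->.
have bitE (x : word) : map (@symbol_is_bit W) (map Bit x) = nseq (size x) true.
  by elim: x => //= b x ->.
have decode_nil j : decode_arg j [::] [::] = [::] by elim: j.
elim: xs i => [|x [|y xs] IH] i; first by rewrite nth_nil decode_nil.
  rewrite /= valE bitE; case: i => [|i] /=; rewrite leading_ones_nseq size_nseq.
    exact: take_size.
  by rewrite !drop_oversize ?size_nseq // decode_nil nth_nil.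
rewrite -[encode W _]/(map Bit x ++ Sharp :: encode W (y :: xs)) !map_cat valE bitE.
case: i => [|i]; rewrite /= leading_ones_cat size_nseq; first by rewrite take_size_cat.
have drop_sep n (u v : word) b : size u = n -> drop n.+1 (u ++ b :: v) = v.
  by move=> <-; rewrite -cat_rcons drop_size_cat // size_rcons.
by rewrite !drop_sep ?size_nseq // IH.
Qed.

Definition toss_loop (r q : nat) : prog := Loop r (Prim (Coin q)) (Prim (Coin q)).

Lemma exec_toss_loop d r q j s : r != q -> exists s', [/\
  exec d (toss_loop r q) j s s' ((size (s r)).*2 + 1),
  s' q = s q ++ [seq d (j + i.*2.+1) | i <- iota 0 (size (s r))] &
  forall i, i != r -> i != q -> s' i = s i].
Proof.
move=> rq; move e: (s r) => y; elim: y j s e => [|b y IH] j s e.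
  by exists s; split; [exact: exec_exit|rewrite cats0|].
have toss := exec_prim d (Coin q) j.+1 (upd s r y).
set s1 := prim_effect _ _ _ in toss.
have [|s' [loop s'_q s'_other]] := IH (j.+1 + 1)%N s1; first by rewrite /s1 /= updN ?updE.
exists s'; split.
- have -> : ((size (b :: y)).*2 + 1 = 1 + 1 + ((size y).*2 + 1))%N by rewrite /=; lia.
  by apply: exec_loop e _ loop; case: (b).
- rewrite s'_q /s1 /= updE updN 1?eq_sym // cat_rcons addn1; congr (_ ++ _ :: _).
    by rewrite addn1.
  rewrite -[iota 1 _]/(iota (1 + 0) _) iotaDl -map_comp; apply: eq_map => i /=; congr d; lia.
- by move=> i hi hi'; rewrite s'_other // /s1 /= !updN.
Qed.

Section LazyMachine.
Variables (D : term) (eD e : expr).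
Hypothesis eDE : forall w v, eeval w v eD = teval v D.

Let arg_regs (i : nat) : nat := if i is _.+1 then 1 else 0.
Let sample_regs (i : nat) : nat := if i is j.+1 then arg_regs j else 3.

Definition lazy_prog : prog :=
  Seq (compile_expr arg_regs 2 eD) (Seq (Prim (Clear 3))
    (Seq (toss_loop 2 3) (compile_expr sample_regs 4 e))).

(* The time at which the coins are tossed does not depend on their outcomes. *)
Lemma exec_lazy_prog : exists T, forall s, exists j0, forall d, exists s' k,
  [/\ exec d lazy_prog 0 s s' k,
      s' 4 = eeval no_oracle (econs [seq d (j0 + i.*2.+1) |
        i <- iota 0 (size (teval (read_env arg_regs s) D))] (read_env arg_regs s)) e &
      (k <= size (teval (read_env arg_regs s) T))%N].
Proof.
have [T1 h1] := compiles_exists eD; have [T2 h2] := compiles_exists e.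
pose T3 := tsubst (fun i => if i is j.+1 then TVar j else D) T2.
exists (TCat T1 (TCat (const_term 2) (TCat (TCat D D) T3))) => s; set v := read_env arg_regs s.
have arg_lt i : (arg_regs i < 2)%N by case: i.
have [s1 [k1 [steps1 s1_2 s1_low hk1]]] := h1 arg_regs 2 s arg_lt.
rewrite -/v eDE in s1_2 hk1; exists (k1 + 1)%N => d.
have [s2 [loop s2_3 s2_other]] :=
  @exec_toss_loop d 2 3 (0 + k1 + 1) (upd s1 3 [::]) isT.
rewrite updE updN // s1_2 in loop s2_3.
have sample_lt i : (sample_regs i < 4)%N by case: i => [|[|i]].
have [s3 [k3 [steps3 s3_4 s3_low hk3]]] := h2 sample_regs 4 s2 sample_lt.
have envE : read_env sample_regs s2 =
    econs [seq d (k1 + 1 + i.*2.+1) | i <- iota 0 (size (teval v D))] v.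
  apply/funext => -[|i]; first by rewrite /read_env /= s2_3.
  by case: i => [|i]; rewrite /read_env /= s2_other // updN // s1_low.
rewrite envE in s3_4 hk3.
exists s3; eexists; split; [|exact: s3_4|].
  exact: exec_seq (steps1 _ _) (exec_seq (steps_clear _ _ _ _) (exec_seq loop (steps3 _ _))).
have : (k3 <= size (teval v T3))%N.
  apply: leq_trans hk3 _; rewrite teval_tsubst; apply: leq_size_teval => -[|i] //=.
  by rewrite size_map size_iota.
by clearbody T3; rewrite !size_tevalE; lia.
Qed.

Let K : nat := maxn 5 (prog_regs lazy_prog).
Let W : finType := option {ffun 'I_K -> option bool}.

Definition lazy_machine : ptm := machine_of (seq_comp (@load_comp K)
  (seq_comp (compile K lazy_prog) (output_comp K 4))).

Definition input_env (xs : seq word) : env := read_env arg_regs (input_regs (encode W xs)).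

Definition run_bound (g : nat -> nat) (n : nat) : nat :=
  (clock (load_time n) n.+1 (g n) + ((n.+1 + g n).*2 + 3))%N.

Lemma poly_bounded_run_bound g : poly_bounded g -> poly_bounded (run_bound g).
Proof.
move=> hg.
suff [p hp] : poly_bounded (fun n => 2 + (n + n + 4) + g n * (n + 1 + (n + 1) + g n + 3) +
    (n + 1 + g n + (n + 1 + g n) + 3))%N.
  by exists p => n; rewrite /run_bound /clock /load_time -!addnn -(addn1 n); exact: hp.
by repeat first [exact: hg | exact: poly_bounded_id | exact: poly_bounded_const
  | apply: poly_bounded_add | apply: poly_bounded_mul].
Qed.

Lemma lazy_machine_halts : exists2 B, poly_bounded B & forall xs,
  exists2 lab : nat -> nat, injective lab & forall c, exists2 k, (k <= B (size (encode W xs)))%N &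
    halted (run c k (init lazy_machine xs)) /\
    output (run c k (init lazy_machine xs)) = eeval no_oracle
      (econs [seq c (lab i) | i <- iota 0 (size (teval (input_env xs) D))] (input_env xs)) e.
Proof.
have [T hT] := exec_lazy_prog; exists (run_bound (term_growth T)).
  exact/poly_bounded_run_bound/poly_bounded_term_growth.
move=> xs; set n := size _; have [j0 hexec] := hT (input_regs (encode W xs)).
exists (fun i => clock (load_time n) n.+1 (j0 + i.*2.+1)).
  by move=> i j /clock_inj; lia.
move=> c; have [s' [k [prog_exec s'_4 hk]]] := hexec (fun i => c (clock (load_time n) n.+1 i)).
have K2 : (2 < K)%N by rewrite /K; lia.
have K4 : (4 < K)%N by rewrite /K; lia.
have [fits0 load] := performs_load c K2 (encode_is_input K xs).
rewrite -/n in fits0 load; rewrite -[n.+1]addn0 in fits0.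
have [fits' [t clock_t [q prog_perf]]] := exec_performs prog_exec (leq_maxr _ _) fits0.
have clock0 : clock (load_time n) n.+1 0 = load_time n by exact: addn0.
rewrite clock0 !add0n addn0 in fits' clock_t prog_perf.
have [l [r [out_perf r_bits]]] := performs_output c K4 (load_time n + t) [::] fits'.
have := reach_run (performs_seq load (performs_seq (prog_perf [::]) out_perf)).
set m := (load_time n + _)%N => hrun; exists m; last first.
  have -> : run c m (init lazy_machine xs) = (inr None, l, r) by [].
  by split; [|rewrite -s'_4; exact: r_bits].
have hkn : (k <= term_growth T n)%N.
  by apply: leq_trans hk (leq_term_growth _ _) => -[|i]; rewrite /read_env /= size_map.
have := leq_clock (load_time n) (leqnn n.+1) hkn; have := fits' 4 K4.
by rewrite /m /run_bound clock_t; lia.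
Qed.

End LazyMachine.

Section Representable.
Local Open Scope classical_set_scope.

Lemma expr_machine (R : realType) e : exists2 M : ptm, polytime M &
  forall (P : probability (coin_space nat) R) (Q : probability (coin_space word) R),
  fair P -> fair Q -> forall xs y,
  P (outputs M xs y) = Q [set w | eeval w (nth [::] xs) e = y].
Proof.
have [e1 e1E] : feasible (fun w v => eeval w (fun i => decode_arg i (v 0) (v 1)) e).
  by apply: feasible_eval => i; apply: feasible_decode_arg; exact: feasible_var.
have [L [D bounded]] := term_bounded_query_tree e1.
have [e2 e2E] := feasible_lazy_run e1.
have [eD eDE] := feasible_teval D (feasible_env_shift 0).
have [B [p hp] hrun] := lazy_machine_halts e2 eDE.
exists (lazy_machine eD e2) => [|P Q fairP fairQ xs y].
  exists p => xs c; have [lab _ /(_ c)[k hk [halt _]]] := hrun xs.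
  by rewrite (run_halted halt) //; exact: leq_trans hk (hp _).
have [lab lab_inj halts] := hrun xs.
set v := input_env _ _ xs in halts; set n := size (teval v D) in halts.
rewrite (@outputs_halted _ xs y (fun c =>
  lazy_run (query_tree v e1) [seq c (lab i) | i <- iota 0 n])); last first.
  by move=> c; have [k _ [halt out]] := halts c; exists k => //; rewrite out e2E.
have pruned := @tree_bounded_prune _ _ _ [::] _ (bounded v).
rewrite (fair_word n _ y fairP lab_inj) (@word_weight_lazy_run R _ y _ _ n [::] pruned).
rewrite -(fair_dtree_run fairQ _ (prune_fresh [::] _)); congr (Q _).
have eE w : dtree_run w (prune [::] (query_tree v e1)) = eeval w (nth [::] xs) e.
  rewrite prune_run // dtree_run_query_tree e1E; congr eeval; apply/funext => i.
  exact: decode_arg_encode.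
by apply/seteqP; split=> w /=; rewrite eE.
Qed.

Lemma holds_instance w G xs y :
  holds w (fun=> [::]) (instance G xs y) <-> holds w (scons y (nth [::] xs)) G.
Proof. by rewrite !holds_std sat_fsubst; apply: sat_ext => -[|i]; exact: numeral_std. Qed.

Lemma ex_unique_std G k : proves NIA [::] (iter k FAll (ex_unique G)) ->
  forall w v y y', holds w (scons y v) G -> holds w (scons y' v) G -> y = y'.
Proof.
move=> NIA_G w v y y' /holds_std hy /holds_std hy'.
have NIA_std A (r : nat -> std w) : NIA A -> sat r A := (std_NIA w).2 A r.
have /sat_iterAll/(_ v)/sat_ex_unique[z _ only_z] :
    forall r : nat -> std w, sat r (iter k FAll (ex_unique G)).
  by move=> r; apply: (soundness _ NIA_G) => // A q; exact: NIA_std.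
by rewrite (only_z _ hy) (only_z _ hy').
Qed.

Theorem representable_RFP (R : realType) (k : nat) (f : random_function R k) :
  representable f -> RFP f.
Proof.
move=> [G [hS _ NIA_G fE]]; have [e he] := witnessing hS NIA_G.
have [M poly_M outputsE] := expr_machine R e; exists M; split=> // xs y.
rewrite fE (outputsE _ (coin_measure R word)); try exact: coin_measure_fair.
congr (coin_measure _ _ _).
apply/seteqP; split=> w; rewrite /interp /= holds_instance; last by move=> <-; exact: he.
by move=> hy; exact: ex_unique_std NIA_G _ _ _ _ (he _ _) hy.
Qed.

End Representable.

Theorem theorem3p7 (R : realType) (k : nat) (f : random_function R k) :
  representable f <-> RFP f.
Proof. by split; [exact: representable_RFP|exact: RFP_representable]. Qed.
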